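(* Let $\Omega\subset\mathbb{R}^n$ be an open set. (i) If $f\in BV(\mathbb{R}^n)$ and either $\Omega$ is bounded or $\Omega=\mathbb{R}^n$, then $$\limsup_{\alpha\to1^-}|D^\alpha f|(\Omega)\le|Df|(\overline{\Omega}).$$ (ii) If $f\in BV_{\rm loc}(\mathbb{R}^n)$ and $\Omega$ is bounded, then $$\Gamma(L^1_{\rm loc})\text{-}\limsup_{\alpha\to1^-}|D^\alpha f|(\Omega)\le|Df|(\overline{\Omega}).$$ In addition, if $f=\chi_E$, then the recovery sequences $(f_\alpha)_{\alpha\in(0,1)}$ in (i) and (ii) can be taken of the form $f_\alpha=\chi_{E_\alpha}$ for some measurable sets $(E_\alpha)_{\alpha\in(0,1)}$; that is, there exist measurable sets $E_\alpha\subset\mathbb{R}^n$, $\alpha\in(0,1)$, with $\chi_{E_\alpha}\to\chi_E$ as $\alpha\to1^-$ in $L^1(\mathbb{R}^n)$ in case (i), respectively in $L^1_{\rm loc}(\mathbb{R}^n)$ in case (ii), such that $\limsup_{\alpha\to1^-}|D^\alpha\chi_{E_\alpha}|(\Omega)\le|D\chi_E|(\overline{\Omega})$.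
   Context: Here $n\in\mathbb{N}$, $n\ge1$, $Df$ is the distributional gradient measure of $f$ and $|Df|$ its total variation measure. For $\alpha\in(0,1)$ let $\mu_{n,\alpha}:=2^\alpha\pi^{-n/2}\,\Gamma\big(\tfrac{n+\alpha+1}{2}\big)/\Gamma\big(\tfrac{1-\alpha}{2}\big)$, and for $\varphi\in C^\infty_c(\mathbb{R}^n;\mathbb{R}^n)$ let $$\mathrm{div}^\alpha\varphi(x):=\mu_{n,\alpha}\int_{\mathbb{R}^n}\frac{(y-x)\cdot(\varphi(y)-\varphi(x))}{|y-x|^{n+\alpha+1}}\,dy,\qquad x\in\mathbb{R}^n,$$ which belongs to $L^1(\mathbb{R}^n)\cap L^\infty(\mathbb{R}^n)$. For $\Omega\subset\mathbb{R}^n$ open, $$|D^\alpha g|(\Omega):=\sup\Big\{\int_{\mathbb{R}^n} g\,\mathrm{div}^\alpha\varphi\,dx:\ \varphi\in C^\infty_c(\Omega;\mathbb{R}^n),\ \|\varphi\|_{L^\infty(\Omega;\mathbb{R}^n)}\le1\Big\}\in[0,+\infty]$$ whenever $g\in L^1_{\rm loc}(\mathbb{R}^n)$ is such that $g\,\mathrm{div}^\alpha\varphi\in L^1(\mathbb{R}^n)$ for all such $\varphi$ (in particular for $g\in L^1(\mathbb{R}^n)$ or $g\in L^\infty(\mathbb{R}^n)$), and $|D^\alpha g|(\Omega):=+\infty$ for the other $g\in L^1_{\rm loc}(\mathbb{R}^n)$. For functionals $F_\alpha$ on a metric space $X$, $\Gamma(X)\text{-}\limsup_{\alpha\to1^-}F_\alpha(f):=\inf\{\limsup_{\alpha\to1^-}F_\alpha(f_\alpha):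 f_\alpha\to f\text{ in }X\text{ as }\alpha\to1^-\}$. In (ii), $F_\alpha(g)=|D^\alpha g|(\Omega)$ on $X=L^1_{\rm loc}(\mathbb{R}^n)$. *)

(* Defs.v *)
From HB Require Import structures.
From mathcomp Require Import all_boot all_order all_algebra.
From mathcomp Require Import all_classical all_reals all_analysis.

Set Implicit Arguments.
Unset Strict Implicit.
Unset Printing Implicit Defensive.
Import Order.TTheory GRing.Theory Num.Theory.
Import numFieldNormedType.Exports.

Local Open Scope classical_set_scope.
Local Open Scope ring_scope.

(* As for n.-tuple T in MathComp-Analysis, the sigma-algebra on row vectors is
   the one generated by the coordinates; on 'rV[R]_n it is the Borel one. *)
Section measurable_rV.
Context {d} {T : sigmaRingType d} (n : nat).

Let coord : 'I_n -> 'rV[T]_n -> T := fun i x => x ord0 i.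

Let rV_set0 : g_sigma_preimage coord set0.
Proof. exact: sigma_algebra0. Qed.

Let rV_setC A : g_sigma_preimage coord A -> g_sigma_preimage coord (~` A).
Proof. exact: sigma_algebraC. Qed.

Let rV_bigcup (F : (set 'rV[T]_n)^nat) :
  (forall i, g_sigma_preimage coord (F i)) ->
  g_sigma_preimage coord (\bigcup_i (F i)).
Proof. exact: sigma_algebra_bigcup. Qed.

HB.instance Definition _ := @isMeasurable.Build (measure_tuple_display d)
  'rV[T]_n (g_sigma_preimage coord) rV_set0 rV_setC rV_bigcup.

End measurable_rV.

Section rV_measurability.

Lemma measurable_rV_coord d (T : sigmaRingType d) n (i : 'I_n) :
  measurable_fun [set: 'rV[T]_n] (fun x : 'rV[T]_n => x ord0 i).
Proof.
move=> _ Y mY; rewrite setTI; apply: sub_sigma_algebra => /=.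
rewrite -bigcup_seq/=; exists i => /=; first by rewrite mem_index_enum.
by exists Y => //; rewrite setTI.
Qed.

Lemma measurable_fun_rV d1 d2 (T1 : measurableType d1) (T2 : measurableType d2)
    n (f : T1 -> 'rV[T2]_n) :
  (forall i, measurable_fun [set: T1] (fun x => f x ord0 i)) ->
  measurable_fun [set: T1] f.
Proof.
move=> mf _ A; rewrite setTI.
pose G := image_set_system [set: T1] f (@measurable _ T1).
suff H : @measurable _ 'rV[T2]_n `<=` G.
  by move=> /H; rewrite /G /image_set_system/= setTI.
apply: smallest_sub.
  by apply: sigma_algebra_image; exact: sigma_algebra_measurable.
rewrite -bigcup_seq/=; apply: bigcup_sub => i _ _ [B mB <-].
rewrite /G /image_set_system/= !setTI.
by rewrite -[X in measurable X]setTI; exact: mf.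
Qed.

End rV_measurability.

Section lebesgue_rV.
Context {R : realType}.

Definition rV_cons n (p : measurableTypeR R * 'rV[R]_n) : 'rV[R]_n.+1 :=
  row_mx (p.1 : R)%:M p.2.

Definition rV_uncons n (x : 'rV[R]_n.+1) : measurableTypeR R * 'rV[R]_n :=
  (x ord0 ord0, \row_(i < n) x ord0 (lift ord0 i)).

Lemma rV_cons0 n (p : measurableTypeR R * 'rV[R]_n) :
  rV_cons p ord0 ord0 = p.1.
Proof.
rewrite /rV_cons (_ : ord0 = lshift n ord0 :> 'I_(1 + n)); last exact/val_inj.
by rewrite [LHS]row_mxEl mxE mulr1n.
Qed.

Lemma rV_consS n (p : measurableTypeR R * 'rV[R]_n) i :
  rV_cons p ord0 (lift ord0 i) = p.2 ord0 i.
Proof.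
rewrite /rV_cons (_ : lift ord0 i = rshift 1 i :> 'I_(1 + n)); last exact/val_inj.
by rewrite [LHS]row_mxEr.
Qed.

Lemma rV_consK n : cancel (@rV_cons n) (@rV_uncons n).
Proof.
move=> [a x]; rewrite /rV_uncons rV_cons0; congr pair.
by apply/rowP => i; rewrite mxE rV_consS.
Qed.

Lemma rV_unconsK n : cancel (@rV_uncons n) (@rV_cons n).
Proof.
move=> x; apply/rowP => i; case: (unliftP ord0 i) => [j|] ->.
  by rewrite rV_consS mxE.
by rewrite rV_cons0.
Qed.

Lemma measurable_rV_cons n : measurable_fun setT (@rV_cons n).
Proof.
apply: measurable_fun_rV => i; case: (unliftP ord0 i) => [j|] ->.
  rewrite (_ : (fun _ => _) = (fun x : 'rV[R]_n => x ord0 j) \o snd).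
    by apply: measurableT_comp => //; exact: measurable_rV_coord.
  by apply/funext => p /=; rewrite rV_consS.
rewrite (_ : (fun _ => _) = fst) //.
by apply/funext => p /=; rewrite rV_cons0.
Qed.

Lemma measurable_rV_uncons n : measurable_fun setT (@rV_uncons n).
Proof.
apply/measurable_fun_pairP; split; first exact: measurable_rV_coord.
apply: measurable_fun_rV => i.
rewrite (_ : (fun _ => _) = (fun x : 'rV[R]_n.+1 => x ord0 (lift ord0 i))).
  exact: measurable_rV_coord.
by apply/funext => x /=; rewrite mxE.
Qed.

Section rV_step.
Variables (n : nat) (m : {sigma_finite_measure set 'rV[R]_n -> \bar R}).

Definition lebesgue_rV_step : set 'rV[R]_n.+1 -> \bar R :=
  pushforward (lebesgue_measure \x m)%E (@rV_cons n).

Let step0 : lebesgue_rV_step set0 = 0%E.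
Proof. by rewrite /lebesgue_rV_step /pushforward preimage_set0 measure0. Qed.

Let step_ge0 A : (0 <= lebesgue_rV_step A)%E.
Proof. exact: (measure_ge0 (lebesgue_measure \x m)%E). Qed.

Let step_sigma_additive : semi_sigma_additive lebesgue_rV_step.
Proof.
move=> F mF tF mUF; rewrite /lebesgue_rV_step /pushforward preimage_bigcup.
apply: measure_semi_sigma_additive.
- by move=> k; rewrite -[X in measurable X]setTI; exact: measurable_rV_cons.
- apply/trivIsetP => /= i j _ _ ij; rewrite -preimage_setI.
  by move/trivIsetP : tF => /(_ _ _ _ _ ij) ->//; rewrite preimage_set0.
- rewrite -preimage_bigcup -[X in measurable X]setTI.
  exact: measurable_rV_cons.
Qed.

HB.instance Definition _ := isMeasure.Build _ _ _ lebesgue_rV_step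
  step0 step_ge0 step_sigma_additive.

Let step_sigma_finite : sigma_finite setT lebesgue_rV_step.
Proof.
have /sigma_finiteP[F [TF ndF Foo]] :=
  sigma_finiteT (@lebesgue_measure R : {sigma_finite_measure set _ -> \bar R}).
have /sigma_finiteP[G [TG ndG Goo]] := sigma_finiteT m.
exists (fun k => @rV_uncons n @^-1` (F k `*` G k)).
  apply/seteqP; split => [x _|//].
  have [i _ Fi] : (\bigcup_i F i) (rV_uncons x).1 by rewrite -TF.
  have [j _ Gj] : (\bigcup_i G i) (rV_uncons x).2 by rewrite -TG.
  exists (maxn i j) => //; split.
    by move: Fi; exact/subsetPset/ndF/leq_maxl.
  by move: Gj; exact/subsetPset/ndG/leq_maxr.
move=> k; have [mF Fk] := Foo k; have [mG Gk] := Goo k; split.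
  rewrite -[X in measurable X]setTI; apply: measurable_rV_uncons => //.
  exact: measurableX.
rewrite /lebesgue_rV_step /pushforward -comp_preimage.
rewrite (_ : _ \o _ = id); last by apply/funext; exact: rV_consK.
by rewrite preimage_id product_measure1E// lte_mul_pinfty// ge0_fin_numE.
Qed.

HB.instance Definition _ := Measure_isSigmaFinite.Build _ _ _ lebesgue_rV_step
  step_sigma_finite.

End rV_step.

(* lebesgue_rV_box below characterizes this measure. *)
Fixpoint lebesgue_rV n : {sigma_finite_measure set 'rV[R]_n -> \bar R} :=
  match n with
  | 0%N => \d_(0 : 'rV[R]_0)
  | n'.+1 => lebesgue_rV_step (lebesgue_rV n')
  end.

Lemma lebesgue_rV_box n (A : 'I_n -> set (measurableTypeR R)) :
  (forall i, measurable (A i)) ->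
  lebesgue_rV n [set x | forall i, A i (x ord0 i)] =
  (\prod_(i < n) lebesgue_measure (A i))%E.
Proof.
elim: n A => [|n IH] A mA.
  rewrite big_ord0 /= diracE mem_set// => -[].
  by [].
rewrite big_ord_recl /= /lebesgue_rV_step /pushforward.
rewrite -IH => [|i]; last exact: mA.
have mB : measurable [set x : 'rV[R]_n | forall i, A (lift ord0 i) (x ord0 i)].
  rewrite (_ : mkset _ = \bigcap_(i in [set: 'I_n])
      ((fun x : 'rV[R]_n => x ord0 i) @^-1` A (lift ord0 i))).
    apply: fin_bigcap_measurable => // i _.
    have := @measurable_rV_coord _ R n i measurableT _ (mA (lift ord0 i)).
    by rewrite setTI.
  by apply/seteqP; split => [x Ax i _|x Ax i]; exact: Ax.
rewrite -product_measure1E//.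
congr (_ _); apply/seteqP; split => [p /= Ap|p /= [A0 Ap] i].
  split; first by have := Ap ord0; rewrite rV_cons0.
  by move=> i; have := Ap (lift ord0 i); rewrite rV_consS.
by case: (unliftP ord0 i) => [j|] ->; rewrite ?rV_consS ?rV_cons0.
Qed.

End lebesgue_rV.

Section test_functions.
Context {R : realType} (n : nat).

Definition edot (x y : 'rV[R]_n) : R := \sum_(i < n) x ord0 i * y ord0 i.

(* The library norm of 'rV[R]_n is the sup norm. *)
Definition enorm (x : 'rV[R]_n) : R := Num.sqrt (edot x x).

Definition partial (W : normedModType R) (i : 'I_n) (phi : 'rV[R]_n -> W) :
  'rV[R]_n -> W := 'D_(delta_mx ord0 i) phi.

Definition iter_partial (W : normedModType R) (s : seq 'I_n)
  (phi : 'rV[R]_n -> W) : 'rV[R]_n -> W := foldr (@partial W) phi s.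

(* All iterated partial derivatives exist and are continuous. *)
Definition smooth (W : normedModType R) (phi : 'rV[R]_n -> W) : Prop :=
  forall s : seq 'I_n, continuous (iter_partial s phi) /\
    forall i x, derivable (iter_partial s phi) x (delta_mx ord0 i).

Definition supp (W : normedModType R) (phi : 'rV[R]_n -> W) : set 'rV[R]_n :=
  closure [set x | phi x != 0].

Definition Cc_smooth (W : normedModType R) (Omega : set 'rV[R]_n) :
    set ('rV[R]_n -> W) :=
  [set phi | [/\ smooth phi, compact (supp phi) & supp phi `<=` Omega]].

End test_functions.
Arguments Cc_smooth {R n} W Omega.

Section fractional_variation.
Context {R : realType} {n : nat}.
Local Notation leb := (lebesgue_rV n : {sigma_finite_measure set 'rV[R]_n -> \bar R}).

Definition Gamma (s : R) : R :=
  \int[lebesgue_measure]_(t in `]0, +oo[) (t `^ (s - 1) * expR (- t)).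

Definition frac_const (alpha : R) : R :=
  2 `^ alpha * pi `^ (- (n%:R / 2)) *
  Gamma ((n%:R + alpha + 1) / 2) / Gamma ((1 - alpha) / 2).

(* At y = x the quotient below is 0 / 0 = 0. *)
Definition frac_div (alpha : R) (phi : 'rV[R]_n -> 'rV[R]_n) (x : 'rV[R]_n) : R :=
  frac_const alpha *
  \int[leb]_y (edot (y - x) (phi y - phi x) /
               enorm (y - x) `^ (n%:R + alpha + 1)).

Definition test_fields (Omega : set 'rV[R]_n) : set ('rV[R]_n -> 'rV[R]_n) :=
  [set phi | Cc_smooth 'rV[R]_n Omega phi /\
    ('N[leb]_+oo [EFin \o ((fun x => enorm (phi x)) \_ Omega)] <= 1)%E].

Definition frac_variation (alpha : R) (g : 'rV[R]_n -> R)
    (Omega : set 'rV[R]_n) : \bar R :=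
  if `[< forall phi, test_fields Omega phi ->
         leb.-integrable setT (EFin \o (fun x => g x * frac_div alpha phi x)) >]
  then ereal_sup [set (\int[leb]_x (g x * frac_div alpha phi x))%:E
                 | phi in test_fields Omega]
  else +oo%E.

End fractional_variation.

Section bounded_variation.
Context {R : realType} {n : nat}.
Local Notation leb := (lebesgue_rV n : {sigma_finite_measure set 'rV[R]_n -> \bar R}).

Definition L1 (f : 'rV[R]_n -> R) : Prop := leb.-integrable setT (EFin \o f).

Definition L1loc (f : 'rV[R]_n -> R) : Prop := measurable_fun setT f /\
  forall K, compact K -> leb.-integrable K (EFin \o f).

(* An R^n-valued Radon measure is a set function on the bounded Borel sets
   (radon_val), sigma-additive inside each compact set. By the Jordan
   decomposition its components are exactly the differences of two positive
   measures finite on compact sets. The two measures need not be mutually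
   singular: neither the values, nor the integrals of functions with compact
   support, nor the variation below depend on the choice of the pair. *)
Record radon := Radon {
  radon_pos : 'I_n -> {measure set 'rV[R]_n -> \bar R} ;
  radon_neg : 'I_n -> {measure set 'rV[R]_n -> \bar R} ;
  radon_pos_fin : forall i K, compact K -> (radon_pos i K < +oo)%E ;
  radon_neg_fin : forall i K, compact K -> (radon_neg i K < +oo)%E }.

Definition radon_val (nu : radon) (B : set 'rV[R]_n) : 'rV[R]_n :=
  \row_(i < n) (fine (radon_pos nu i B) - fine (radon_neg nu i B)).

Definition radon_int (nu : radon) (i : 'I_n) (phi : 'rV[R]_n -> R) : R :=
  \int[radon_pos nu i]_x phi x - \int[radon_neg nu i]_x phi x.

(* Countable partitions of B into bounded Borel sets: if B itself is bounded,
   this is the usual total variation; otherwise radon_val nu B may be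
   undefined but the pieces always have a value. *)
Definition variation_measure (nu : radon) (B : set 'rV[R]_n) : \bar R :=
  ereal_sup [set (\sum_(0 <= k <oo) (enorm (radon_val nu (A k)))%:E)%E
    | A in [set A : (set 'rV[R]_n)^nat |
        [/\ forall k, measurable (A k) /\ bounded_set (A k),
            trivIset setT A & \bigcup_k A k = B]]].

Definition is_gradient (f : 'rV[R]_n -> R) (nu : radon) : Prop :=
  forall phi : 'rV[R]_n -> R, Cc_smooth R setT phi -> forall i : 'I_n,
    \int[leb]_x (f x * partial i phi x) = - radon_int nu i phi.

Definition BV (f : 'rV[R]_n -> R) : Prop :=
  L1 f /\ exists2 nu, is_gradient f nu & (variation_measure nu setT < +oo)%E.

(* Finiteness of the gradient measure on compact sets is part of radon. *)
Definition BVloc (f : 'rV[R]_n -> R) : Prop :=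
  L1loc f /\ exists nu, is_gradient f nu.

Definition L1_cvg (f_ : R -> 'rV[R]_n -> R) (f : 'rV[R]_n -> R) : Prop :=
  (\int[leb]_x `|f_ alpha x - f x|%:E)%E @[alpha --> 1^'-] --> 0%E.

Definition L1loc_cvg (f_ : R -> 'rV[R]_n -> R) (f : 'rV[R]_n -> R) : Prop :=
  forall K : set 'rV[R]_n, compact K ->
  (\int[leb]_(x in K) `|f_ alpha x - f x|%:E)%E @[alpha --> 1^'-] --> 0%E.

End bounded_variation.
Arguments radon : clear implicits.

Definition limsup1 {R : realType} (F : R -> \bar R) : \bar R :=
  limf_esup F (1 : R)^'-.

(* X is the underlying set of the metric space and cvgX its convergence, as
   alpha tends to 1 from below, of families indexed by ]0, 1[. *)
Definition Gamma_limsup {R : realType} {T : Type} (X : set T)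
    (cvgX : (R -> T) -> T -> Prop) (F : R -> T -> \bar R) (f : T) : \bar R :=
  ereal_inf [set limsup1 (fun alpha => F alpha (f_ alpha))
    | f_ in [set f_ : R -> T |
        (forall alpha, 0 < alpha < 1 -> X (f_ alpha)) /\ cvgX f_ f]].

(* Main.v *)
(* Write the pairing of g with the fractional divergence of phi as the
   frac_const multiple of the integral of h(z) / |z|^(n+alpha+1), where
   h(z) = \int g(x) z.(phi(x+z) - phi(x)) dx, and decompose the kernel into
   layers: |z|^(-2s) is proportional to the integral over u > |z|^2 of
   u^(-s-2) (u - |z|^2)_+.  For u < r^2, integration by parts against
   (u - |z|^2)_+^2 / 4 turns the divergence of the translates of phi averaged
   over a ball into the layer integral of h, so that integral is at most
   |Df|(Omega_r) times the integral of (u - |z|^2)_+^2 / 4, where Omega_r is the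
   r-neighbourhood of Omega.  The resulting constant tends to 1 as alpha -> 1,
   the volume of the ball being identified with a value of Gamma through the
   Gaussian integral; the layers u > r^2 contribute O(1 - alpha) ||g||_1.  Then
   let r -> 0.  For f only locally BV, truncate f to balls whose radius tends to
   infinity so slowly that (1 - alpha) times the L^1 norm still vanishes; near
   the bounded Omega the truncation is eventually f, and truncating an indicator
   gives an indicator. *)

Require Import Defs.
From HB Require Import structures.
From mathcomp Require Import all_boot all_order all_algebra.
From mathcomp Require Import ring lra.
From mathcomp Require Import all_classical all_reals all_analysis.
From mathcomp Require Import measurable_realfun ess_sup_inf.
Set Implicit Arguments.
Unset Strict Implicit.
Unset Printing Implicit Defensive.
Import Order.TTheory GRing.Theory Num.Theory.
Import numFieldNormedType.Exports.
Local Open Scope classical_set_scope.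
Local Open Scope ring_scope.

(** * Lebesgue measure on row vectors *)

(** The field [(u - |z|^2)_+ z] is minus the gradient of [(u - |z|^2)_+^2 / 4], whose gradient is
    Lipschitz. This dictates the layers: with indicators of balls one would meet surface integrals,
    whereas here difference quotients and translation invariance do the integration by parts. The
    derivative falls on [z -> \int g(x) phi(x + z) dx], which is as regular as [phi] even when [g]
    is only integrable. The obstacle is uniformity in [phi]. Absolute convergence at [z = 0] uses
    the Lipschitz constant of [phi], which its sup norm does not control; that constant must serve
    for Fubini only and be absent from the final bound. Integrating the layers up to [r^2] gives a
    factor of order [1/(1 - alpha)], which the denominator [Gamma((1 - alpha)/2)] compensates. Since
    only an upper limit is claimed, the limit of the constant is reached by bounding one value of
    Gamma from above and the other from below. The estimate for fixed [alpha] concerns a function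
    [g] equal to [f] near [Omega] only, so that it serves both for [f] and for its truncations. *)

Section rV_borel.
Context {R : realType}.

Lemma measurable_rV_itv n (a b : 'I_n -> R) :
  measurable [set x : 'rV[R]_n | forall i, a i < x ord0 i < b i].
Proof.
rewrite (_ : mkset _ = \bigcap_(i in [set: 'I_n])
      ((fun x : 'rV[R]_n => x ord0 i) @^-1` `]a i, b i[%classic)).
  apply: fin_bigcap_measurable => // i _.
  have mi : measurable (`]a i, b i[%classic : set (measurableTypeR R)).
    exact: measurable_itv.
  by have := @measurable_rV_coord _ _ n i measurableT _ mi; rewrite setTI.
apply/seteqP; split => [x Ax i _|x Ax i].
  by rewrite /= in_itv/=; exact: Ax.
by have := Ax i I; rewrite /= in_itv.
Qed.

(** The sigma-algebra is generated by the coordinates, so an open set has to be a countable union of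
    boxes: cubes with rational centre and half-width [1/(k+1)], enumerated by [unpickle]. *)
Lemma open_measurable_rV n (A : set 'rV[R]_n) : open A -> measurable A.
Proof.
move=> oA.
pose B (q : 'rV[rat]_n * nat) := [set x : 'rV[R]_n |
  forall i, ratr (q.1 ord0 i) - q.2.+1%:R^-1 < x ord0 i
            < ratr (q.1 ord0 i) + q.2.+1%:R^-1].
pose P := [set k : nat | exists2 q, unpickle k = Some q & B q `<=` A].
pose C k := if unpickle k is Some q then B q else set0.
have -> : A = \bigcup_(k in P) C k.
  apply/seteqP; split => [x Ax|x [k [q qk BA]]]; last by rewrite /C qk => /BA.
  have /nbhs_ballP[e /= e0 eA] : nbhs x A by exact: open_nbhs_nbhs.
  (* The factor 2: the rational centre is only within [1/(k+1)] of [x], so the points of the cube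
     are within twice that of [x]. *)
  have [k ke] : exists k : nat, k.+1%:R^-1 * 2 < e.
    exists (Num.truncn (2 / e)); rewrite mulrC ltr_pdivrMr// mulrC.
    by rewrite -ltr_pdivrMr//; exact: truncnS_gt.
  have k0 : 0 < k.+1%:R^-1 :> R by rewrite invr_gt0.
  pose r : R := k.+1%:R^-1; rewrite -/r in ke k0.
  have /choice[q qP] : forall i : 'I_n, exists q : rat,
      (ratr q : R) \in `](x ord0 i - r), (x ord0 i + r)[.
    move=> i; have [|q qi] := @rat_in_itvoo R (x ord0 i - r)
      (x ord0 i + r); [lra|by exists q].
  exists (pickle ((\row_i q i, k) : 'rV[rat]_n * nat)).
    exists (\row_i q i, k); first by rewrite pickleK.
    move=> y /= By; apply: eA; split=> // i' i; rewrite ord1 /ball/=.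
    have := By i; have := qP i; rewrite in_itv/= mxE -/r => /andP[q1 q2] /andP[q3 q4].
    rewrite ltr_norml -!/r; apply/andP; split; lra.
  rewrite /C pickleK => i /=; have := qP i; rewrite -/r in_itv/= mxE => /andP[q1 q2].
  by apply/andP; split; lra.
apply: bigcup_measurable => k [q qk _]; rewrite /C qk.
exact: measurable_rV_itv.
Qed.

Lemma closed_measurable_rV n (A : set 'rV[R]_n) : closed A -> measurable A.
Proof.
move=> cA; rewrite -[A]setCK; apply: measurableC.
by apply: open_measurable_rV; exact: closed_openC.
Qed.

Lemma continuous_measurable_rV n (f : 'rV[R]_n -> R) :
  continuous f -> measurable_fun setT f.
Proof.
move=> cf; apply: (measurability _ (RGenOpens.measurableE R)) => _ [_ [a [b ->] <-]].
rewrite setTI; apply: open_measurable_rV.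
by move/continuousP : cf; apply.
Qed.

Lemma measurable_rV_affine n (c : R) (h : 'rV[R]_n) :
  measurable_fun setT (fun x : 'rV[R]_n => c *: x + h).
Proof.
apply: measurable_fun_rV => i.
rewrite (_ : (fun _ => _) = (fun x : 'rV[R]_n => c * x ord0 i + h ord0 i)); last first.
  by apply/funext => x; rewrite !mxE.
apply: measurable_funD => //; apply: measurable_funM => //.
exact: measurable_rV_coord.
Qed.

Lemma measurable_rV_add n :
  measurable_fun setT (fun p : 'rV[R]_n * 'rV[R]_n => p.1 + p.2).
Proof.
apply: measurable_fun_rV => i.
rewrite (_ : (fun _ => _) = (fun p : 'rV[R]_n * 'rV[R]_n =>
   p.1 ord0 i + p.2 ord0 i)); last by apply/funext => p; rewrite !mxE.
by apply: measurable_funD; apply: (measurableT_comp (measurable_rV_coord _)).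
Qed.

End rV_borel.

(** * Dilations and translations under the integral *)

Section affine_change_of_variables.
Context {R : realType}.
Local Notation leb n := (lebesgue_rV n : {sigma_finite_measure set 'rV[R]_n -> \bar R}).
Local Notation mu := (@lebesgue_measure R).

(** Both sides are measures in [A], so comparing them on half-open intervals is enough. *)
Lemma lebesgue_measure_affine (c h : R) (c0 : 0 < c) (A : set (measurableTypeR R)) :
  measurable A ->
  mu A = (c%:E *
    pushforward mu (fun a : measurableTypeR R => (c * a + h)%R : measurableTypeR R) A)%E.
Proof.
have mp : measurable_fun setT (fun a : measurableTypeR R => c * a + h : measurableTypeR R).
  by apply: measurable_funD => //; exact: measurable_funM.
pose m' := mscale (NngNum (ltW c0))
  (pushforward mu (fun a : measurableTypeR R => c * a + h : measurableTypeR R)).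
pose m := m' mp.
move=> mA; rewrite -[RHS]/(m A); apply: lebesgue_measure_unique => //= _ [[a b]] _ <-.
rewrite /m /mscale/= /pushforward.
rewrite (_ : _ @^-1` _ = `](a - h) / c, (b - h) / c]%classic); last first.
  apply/seteqP; split => x /=; rewrite !in_itv/= ltr_pdivrMr// ler_pdivlMr//.
    by move=> /andP[? ?]; apply/andP; split; lra.
  by move=> /andP[? ?]; apply/andP; split; lra.
rewrite !lebesgue_measure_itv/= !lte_fin ltr_pM2r ?invr_gt0// ltrD2r.
case: ifPn => // _; last by rewrite mule0.
rewrite -!EFinB -EFinM; congr EFin; field.
by rewrite gt_eqF.
Qed.

Lemma ge0_integral_affine (c h : R) (c0 : 0 < c) (F : measurableTypeR R -> \bar R) :
  measurable_fun setT F -> (forall x, 0 <= F x)%E ->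
  (\int[mu]_a F a = c%:E * \int[mu]_a F (c * a + h)%R)%E.
Proof.
move=> mF F0.
have mp : measurable_fun setT (fun a : measurableTypeR R => c * a + h : measurableTypeR R).
  by apply: measurable_funD => //; exact: measurable_funM.
pose m' := mscale (NngNum (ltW c0))
  (pushforward mu (fun a : measurableTypeR R => c * a + h : measurableTypeR R)).
pose m := m' mp.
transitivity (\int[m]_a F a)%E.
  apply: eq_measure_integral => //= A mA _.
  by rewrite (lebesgue_measure_affine h c0 mA).
rewrite ge0_integral_mscale//=; congr (_ * _)%E.
by rewrite ge0_integral_pushforward.
Qed.

Lemma ge0_integral_rV0 (F : 'rV[R]_0 -> \bar R) :
  (\int[leb 0]_x F x)%E = F 0.
Proof.
rewrite (_ : F = fun=> F 0); last first.
  by apply/funext => x; congr F; apply/rowP => -[].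
rewrite /=.
by rewrite integral_dirac// diracT mul1e.
Qed.

Lemma ge0_integral_rVS n (F : 'rV[R]_n.+1 -> \bar R) :
  measurable_fun setT F -> (forall x, 0 <= F x)%E ->
  (\int[leb n.+1]_x F x = \int[mu]_a \int[leb n]_y F (rV_cons (a, y)))%E.
Proof.
move=> mF F0; rewrite /= ge0_integral_pushforward//; last exact: measurable_rV_cons.
have mFc : measurable_fun setT (F \o @rV_cons R n).
  by apply: measurableT_comp => //; exact: measurable_rV_cons.
by rewrite (fubini_tonelli1 _ mFc)// => p; exact: F0.
Qed.

Lemma rV_cons_affine n (c a : R) (h : 'rV[R]_n.+1) (y : 'rV[R]_n) :
  c *: rV_cons (a, y) + h =
  rV_cons (c * a + (rV_uncons h).1, c *: y + (rV_uncons h).2).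
Proof.
apply/rowP => i; rewrite mxE [X in X + _]mxE.
case: (unliftP ord0 i) => [j|] ->; first by rewrite !rV_consS/= !mxE.
by rewrite !rV_cons0.
Qed.

(** The induction peels off the first coordinate, as the construction of [lebesgue_rV] does. The
    case [c = 1] is translation invariance; the case [h = 0] gives the scaling of ball volumes. *)
Lemma ge0_integral_rV_affine n (c : R) (h : 'rV[R]_n) (c0 : 0 < c)
    (F : 'rV[R]_n -> \bar R) :
  measurable_fun setT F -> (forall x, 0 <= F x)%E ->
  (\int[leb n]_x F x = (c ^+ n)%:E * \int[leb n]_x F (c *: x + h)%R)%E.
Proof.
elim: n h F => [|n IH] h F mF F0.
  by rewrite !ge0_integral_rV0 expr0 mul1e; congr F; apply/rowP => -[].
have mcons a : measurable_fun setT (fun y : 'rV[R]_n => F (rV_cons (a, y))).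
  apply: (measurableT_comp mF).
  by apply: measurableT_comp; [exact: measurable_rV_cons|exact: measurable_fun_pair].
have mpair h' : measurable_fun setT (fun p : measurableTypeR R * 'rV[R]_n =>
    F (rV_cons (p.1, c *: p.2 + h'))).
  apply: (measurableT_comp mF); apply: (measurableT_comp (@measurable_rV_cons R n)).
  apply: measurable_fun_pair => //.
  by apply: (measurableT_comp (measurable_rV_affine c h')).
rewrite !ge0_integral_rVS//; last first.
  by apply: (measurableT_comp mF); exact: measurable_rV_affine.
under eq_integral => a _ do rewrite (IH (rV_uncons h).2 _ (mcons a))//.
rewrite ge0_integralZl//; last 3 first.
- exact: (measurable_fun_fubini_tonelli_F _ (mpair (rV_uncons h).2)).
- by move=> a _; exact: integral_ge0.
- by rewrite lee_fin exprn_ge0// ltW.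
rewrite [in LHS](ge0_integral_affine (rV_uncons h).1 c0).
- rewrite muleA -EFinM -exprSr; congr (_ * _)%E.
  apply: eq_integral => a _; apply: eq_integral => y _.
  by rewrite rV_cons_affine.
- exact: (measurable_fun_fubini_tonelli_F _ (mpair (rV_uncons h).2)).
- by move=> a; exact: integral_ge0.
Qed.

End affine_change_of_variables.

(** * Layers of the kernel *)

Section power_integrals.
Context {R : realType}.
Local Notation mu := (@lebesgue_measure R).

Lemma powRN_cvgy0 (a : R) : 0 < a -> x `^ (- a) @[x --> +oo] --> (0 : R).
Proof.
move=> a0; apply/cvgrPdist_le => /= e e0.
near=> x.
have x0 : 0 < x by near: x; exact: nbhs_pinfty_gt.
rewrite sub0r normrN ger0_norm ?powR_ge0// powRN -[leRHS]invrK lef_pV2 ?posrE ?powR_gt0 ?invr_gt0//.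
have -> : e^-1 = (e^-1 `^ a^-1) `^ a.
  by rewrite -powRrM mulVf ?gt_eqF// powRr1// invr_ge0 ltW.
have ex : e^-1 `^ a^-1 < x by near: x; exact: nbhs_pinfty_gt.
by apply: ge0_ler_powR; rewrite ?nnegrE ?powR_ge0// ltW.
Unshelve. all: by end_near. Qed.

Lemma continuous_powR (b : R) x : 0 < x -> {for x, continuous (fun v : R => v `^ b)}.
Proof.
move=> x0; apply: differentiable_continuous; apply/derivable1_diffP.
by apply: derivable_powR; rewrite in_itv/= x0.
Qed.

Lemma is_derive_powR_div (b x : R) : 0 < x -> b != 0 ->
  is_derive x 1 (fun v : R => b^-1 * v `^ b) (x `^ (b - 1)).
Proof.
move=> x0 b0; have := @is_derive1_powR R b x x0 => h.
have := @is_deriveZ _ _ _ _ b^-1 _ _ _ h.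
by rewrite /GRing.scale/= mulrA mulVf// mul1r.
Qed.

Lemma integral_powR_gt (b c : R) : 0 < b -> 0 < c ->
  (\int[mu]_(v in `]c, +oo[) (v `^ (- b - 1))%:E = (c `^ (- b) / b)%:E)%E.
Proof.
move=> b0 c0; rewrite integral_itv_obnd_cbnd; last first.
  by apply/measurable_EFinP; apply: measurable_funTS; exact: measurable_powR.
have b0' : - b != 0 by rewrite oppr_eq0 gt_eqF.
rewrite (@ge0_continuous_FTC2y _ _ (fun v => (- b)^-1 * v `^ (- b)) c 0).
- by rewrite sub0e -EFinN -mulNr invrN opprK mulrC.
- by move=> x _; exact: powR_ge0.
- apply: continuous_in_subspaceT => x; rewrite inE/= in_itv/= andbT => cx.
  by apply: continuous_powR; exact: lt_le_trans cx.
- by rewrite -[X in _ --> X](mulr0 (- b)^-1); apply: cvgMr; exact: powRN_cvgy0.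
- move=> x cx; have := is_derive_powR_div (lt_trans c0 cx) b0'.
  by case.
- apply: cvg_at_right_filter; apply: cvgMr.
  exact: continuous_powR.
- move=> x; rewrite in_itv/= andbT => cx.
  have := is_derive_powR_div (lt_trans c0 cx) b0'.
  by rewrite derive1E; case.
Qed.

(** For [b < 1] the integrand blows up at 0, so the fundamental theorem is applied on [[c/(k+2), c]]
    and the integral is recovered as a monotone limit. *)
Lemma integral_powR_lt (b c : R) : 0 < b -> 0 < c ->
  (\int[mu]_(v in `]0%R, c[) (v `^ (b - 1))%:E = (c `^ b / b)%:E)%E.
Proof.
move=> b0 c0; rewrite integral_itv_bndo_bndc; last first.
  by apply/measurable_EFinP; apply: measurable_funTS; exact: measurable_powR.
have b0' : b != 0 by rewrite gt_eqF.
(* Dividing by [k+2] keeps every left end, also the one at [k = 0], strictly below [c]. *)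
pose a k : R := c / k.+2%:R.
have a0 k : 0 < a k by rewrite divr_gt0.
have ac k : a k < c by rewrite ltr_pdivrMr// ltr_pMr// ltr1n.
pose F k := `[a k, c]%classic.
have UF : \bigcup_k F k = `]0, c]%classic.
  apply/seteqP; split => [x [k _]|x]; rewrite /F/= !in_itv/= => /andP[xa xc].
    by rewrite xc andbT (lt_le_trans (a0 k)).
  exists (Num.truncn (c / x)) => //=; rewrite in_itv/= xc andbT /a.
  rewrite ler_pdivrMr// mulrC -ler_pdivrMr// ltW// (lt_trans (truncnS_gt _))//.
  by rewrite ltr_nat.
have -> : (\int[mu]_(v in `]0%R, c]) (v `^ (b - 1))%:E =
   limn (fun k => \int[mu]_(v in F k) (v `^ (b - 1))%:E))%E.
  apply/esym/cvg_lim => //; rewrite -UF; apply: ge0_nondecreasing_set_cvg_integral.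
  - move=> i j ij; apply/subsetPset => x; rewrite /F/= !in_itv/= => /andP[+ ->].
    rewrite andbT; apply: le_trans.
    by rewrite ler_pM2l// lef_pV2 ?posrE// ler_nat.
  - by move=> i; exact: measurable_itv.
  - by move=> i; apply/measurable_EFinP; apply: measurable_funTS; exact: measurable_powR.
  - by move=> i x _; rewrite lee_fin powR_ge0.
have E k : (\int[mu]_(v in F k) (v `^ (b - 1))%:E = (b^-1 * c `^ b - b^-1 * a k `^ b)%:E)%E.
  rewrite (@continuous_FTC2 _ _ (fun v => b^-1 * v `^ b) (a k) c)//.
  - apply: continuous_in_subspaceT => x; rewrite inE/= in_itv/= => /andP[cx _].
    by apply: continuous_powR; exact: lt_le_trans cx.
  - split.
    + move=> x; rewrite in_itv/= => /andP[cx _].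
      by have [] := is_derive_powR_div (lt_trans (a0 k) cx) b0'.
    + by apply: cvg_at_right_filter; apply: cvgMr; exact: continuous_powR.
    + by apply: cvg_at_left_filter; apply: cvgMr; exact: continuous_powR.
  - move=> x; rewrite in_itv/= => /andP[cx _].
    by rewrite derive1E; have [] := is_derive_powR_div (lt_trans (a0 k) cx) b0'.
under eq_fun do rewrite E.
apply/cvg_lim => //; apply: cvg_EFin; first exact: nearW.
rewrite /comp/= mulrC -[X in _ --> X]subr0; apply: cvgB; first exact: cvg_cst.
rewrite -[X in _ --> X](mulr0 b^-1); apply: cvgMr.
have := powR_cvg0 b0 => /cvg_at_rightP; apply; split => [//|].
rewrite /a -[X in _ --> X](mulr0 c); apply: cvgMr.
have := @cvg_harmonic R.
by rewrite -(cvg_shiftS (fun k : nat => k.+1%:R^-1 : R)).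
Qed.

Lemma integral_expRN_gt (a : R) :
  (\int[mu]_(v in `]a, +oo[) (expR (- v))%:E = (expR (- a))%:E)%E.
Proof.
rewrite integral_itv_obnd_cbnd; last first.
  apply/measurable_EFinP; apply: measurable_funTS.
  by apply: measurableT_comp => //; exact: measurable_funN.
have dF (x : R) : is_derive x 1 (fun v : R => - expR (- v)) (expR (- x)).
  have h1 : is_derive x (1 : R) (fun v : R => - v) (- 1).
    exact: is_deriveN (is_derive_id x 1).
  have := is_deriveN (is_derive1_comp (is_derive_expR (- x)) h1).
  by rewrite mulrN1 opprK.
have cF (x : R) : {for x, continuous (fun v : R => - expR (- v))}.
  apply: differentiable_continuous; apply/derivable1_diffP; by case: (dF x).
have cf (x : R) : {for x, continuous (fun v : R => expR (- v))}.
  apply: differentiable_continuous; apply/derivable1_diffP.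
  by have := derivableN (@ex_derive _ _ _ _ _ _ _ (dF x)); rewrite (_ : - _ = (fun v : R => expR (- v)))//;
    apply/funext => v; rewrite /GRing.opp/= opprK.
rewrite (@ge0_continuous_FTC2y _ _ (fun v => - expR (- v)) a 0).
- by rewrite sub0e -EFinN opprK.
- by move=> x _; exact: expR_ge0.
- by apply: continuous_subspaceT.
- rewrite -oppr0; apply: cvgN.
  exact: cvgr_expR.
- by move=> x _; case: (dF x).
- by apply: cvg_at_right_filter; exact: cF.
- by move=> x _; rewrite derive1E; case: (dF x).
Qed.

End power_integrals.

(** Nonnegative functions with finite integrals are integrable, so a difference of them, of whatever
    sign, may be integrated termwise. *)
Lemma ge0_integral_lincomb d (T : measurableType d) (R : realType)
    (m : {measure set T -> \bar R}) (D : set T) (f g : T -> R) (k l a b : R) :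
  measurable D -> measurable_fun D f -> measurable_fun D g ->
  (forall x, D x -> 0 <= f x) -> (forall x, D x -> 0 <= g x) ->
  (\int[m]_(x in D) (f x)%:E = a%:E)%E -> (\int[m]_(x in D) (g x)%:E = b%:E)%E ->
  (\int[m]_(x in D) (k * f x - l * g x)%:E = (k * a - l * b)%:E)%E.
Proof.
move=> mD mf mg f0 g0 fa gb.
have I (h : T -> R) (c : R) : measurable_fun D h -> (forall x, D x -> 0 <= h x) ->
    (\int[m]_(x in D) (h x)%:E = c%:E)%E -> m.-integrable D (EFin \o h).
  move=> mh h0 hc; apply/integrableP; split; first exact/measurable_EFinP.
  rewrite (eq_integral (EFin \o h)) ?hc ?ltry// => x.
  by rewrite inE => Dx; rewrite /= ger0_norm// h0.
under eq_integral do rewrite EFinB !EFinM.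
rewrite integralB//; [|exact: (integrableZl mD k (I _ _ mf f0 fa))
                      |exact: (integrableZl mD l (I _ _ mg g0 gb))].
rewrite (integralZl mD (I _ _ mg g0 gb)) (integralZl mD (I _ _ mf f0 fa)).
by rewrite [X in (_ * X - _)%E]fa [X in (_ - _ * X)%E]gb -!EFinM -EFinB.
Qed.

Lemma gt0_powRD (R : realType) (x r s : R) : 0 < x -> x `^ (r + s) = x `^ r * x `^ s.
Proof. by move=> x0; rewrite powRD//; apply/implyP => _; rewrite gt_eqF. Qed.

Lemma gt0_powRD1 (R : realType) (x r : R) : 0 < x -> x `^ (r + 1) = x `^ r * x.
Proof. by move=> x0; rewrite gt0_powRD// powRr1// ltW. Qed.

(** * Euclidean balls and the layer-cake formula *)

Section euclidean_layers.
Context {R : realType}.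
Local Notation leb n := (lebesgue_rV n : {sigma_finite_measure set 'rV[R]_n -> \bar R}).
Local Notation mu := (@lebesgue_measure R).

Lemma edot_ge0 n (z : 'rV[R]_n) : 0 <= edot z z.
Proof. by apply: sumr_ge0 => i _; rewrite -expr2 sqr_ge0. Qed.

Lemma edotZZ n (c : R) (z : 'rV[R]_n) : edot (c *: z) (c *: z) = c ^+ 2 * edot z z.
Proof.
rewrite /edot mulr_sumr; apply: eq_bigr => i _; rewrite !mxE expr2.
by rewrite mulrACA.
Qed.

Lemma edot_rV_cons n a (y : 'rV[R]_n) :
  edot (rV_cons (a, y)) (rV_cons (a, y)) = a ^+ 2 + edot y y.
Proof.
rewrite /edot big_ord_recl rV_cons0 expr2; congr (_ + _).
by apply: eq_bigr => i _; rewrite rV_consS.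
Qed.

Lemma measurable_edot n : measurable_fun setT (fun z : 'rV[R]_n => edot z z).
Proof.
apply: measurable_sum => i.
by apply: measurable_funM; exact: measurable_rV_coord.
Qed.

(** The region [|f|^2 < g] is encoded as an indicator of a difference, so that the joint
    measurability that Tonelli asks for comes by composition. *)
Lemma measurable_layer n d (T : measurableType d) (f : T -> 'rV[R]_n) (g : T -> R) :
  measurable_fun setT f -> measurable_fun setT g ->
  measurable_fun setT (fun p => \1_(`]0%R, +oo[%classic) (g p - edot (f p) (f p)) : R).
Proof.
move=> mf mg; apply: measurableT_comp; last first.
  by apply: measurable_funB => //; exact: (measurableT_comp (@measurable_edot n)).
by apply: measurable_indic; exact: measurable_itv.
Qed.

Lemma measurable_eball n (u : R) : measurable [set z : 'rV[R]_n | edot z z < u].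
Proof.
rewrite (_ : mkset _ = setT `&` (fun z : 'rV[R]_n => edot z z) @^-1` `]-oo, u[%classic).
  by apply: measurable_edot => //; exact: measurable_itv.
by rewrite setTI; apply/seteqP; split => x /=; rewrite in_itv.
Qed.

Lemma indic_gt0E (a b : R) : (\1_(`]0%R, +oo[%classic) (a - b) : R) = (b < a)%R%:R.
Proof.
by rewrite indicE; congr (_%:R); rewrite mem_setE/= in_itv/= andbT subr_gt0.
Qed.

Lemma integral_gt_indic (w : R -> R) (a : R) :
  (\int[mu]_(u in `]a, +oo[) (w u)%:E =
   \int[mu]_u ((w u * \1_(`]0%R, +oo[%classic) (u - a))%:E))%E.
Proof.
rewrite integral_mkcond; apply: eq_integral => u _.
rewrite indic_gt0E patchE mem_setE/= in_itv/= andbT.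
by case: ifPn; rewrite ?mulr1 ?mulr0.
Qed.

(** Volume of the Euclidean unit ball; [eball_volE] shows that [fine] loses nothing here. *)
Definition eball_vol n : R := fine (leb n [set z | edot z z < 1]).

Lemma indic_eball n (z : 'rV[R]_n) (u : R) :
  \1_[set z : 'rV[R]_n | edot z z < u] z = (edot z z < u)%R%:R :> R.
Proof. by rewrite indicE; congr ((nat_of_bool _)%:R); apply/idP/idP; rewrite inE. Qed.

Lemma integral_eball n (u : R) :
  (\int[leb n]_z (\1_[set z : 'rV[R]_n | edot z z < u]%R z)%:E =
   leb n [set z | edot z z < u]%R)%E.
Proof. by rewrite integral_indic ?setIT//; exact: measurable_eball. Qed.

Lemma eball_measure_powR n (u : R) : 0 < u ->
  leb n [set z | edot z z < u] = ((u `^ (n%:R / 2))%:E * leb n [set z | edot z z < 1]%R)%E.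
Proof.
move=> u0; have s0 : 0 < Num.sqrt u by rewrite sqrtr_gt0.
rewrite -!integral_eball (ge0_integral_rV_affine 0 s0)//; last first.
  by apply/measurable_EFinP; apply: measurable_indic; exact: measurable_eball.
congr (_ * _)%E.
  rewrite mulrC powRrM powR12_sqrt ?powR_mulrn ?sqrtr_ge0 ?ltW//.
apply: eq_integral => z _; rewrite !indic_eball addr0 edotZZ sqr_sqrtr ?ltW//.
by rewrite gtr_pMr.
Qed.

(** Tonelli: for fixed [u] the admissible [z] form the ball of squared radius [u], whose measure is
    [u^(n/2)] times that of the unit ball. The volume of the ball, the integral of the bump and the
    majorant of the layers are all computed through this formula. *)
Lemma ge0_integral_layers n (w : R -> R) :
  measurable_fun setT w -> (forall u, 0 < u -> 0 <= w u) ->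
  (\int[leb n]_z \int[mu]_(u in `](edot z z), +oo[) (w u)%:E =
   leb n [set z | edot z z < 1]%R *
   \int[mu]_(u in `]0%R, +oo[) (u `^ (n%:R / 2) * w u)%:E)%E.
Proof.
move=> mw w0.
under eq_integral do rewrite integral_gt_indic.
pose f (p : 'rV[R]_n * measurableTypeR R) : \bar R :=
  (w p.2 * \1_(`]0%R, +oo[%classic) (p.2 - edot p.1 p.1))%:E.
have f0 p : (0 <= f p)%E.
  rewrite /f lee_fin indic_gt0E; case: ltP => [h|]; last by rewrite mulr0.
  by rewrite mulr1 w0// (le_lt_trans _ h)// edot_ge0.
have mf : measurable_fun setT f.
  apply/measurable_EFinP/measurable_funM; last exact: measurable_layer.
  exact: (measurableT_comp mw).
rewrite (fubini_tonelli f mf f0).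
rewrite -ge0_integralZl//; last 2 first.
- by apply/measurable_EFinP/measurable_funTS/measurable_funM.
- by move=> u /=; rewrite in_itv/= andbT => u0; rewrite lee_fin mulr_ge0 ?powR_ge0 ?w0.
rewrite [RHS]integral_mkcond; apply: eq_integral => u _.
rewrite patchE mem_setE/= in_itv/= andbT /f/=.
case: ifPn => [u0|]; last first.
  rewrite -leNgt => u0; apply: integral0_eq => z _; rewrite indic_gt0E.
  by rewrite ltNge (le_trans u0) ?edot_ge0//= mulr0.
under eq_integral do rewrite indic_gt0E EFinM.
rewrite ge0_integralZl//; last 2 first.
- apply/measurable_EFinP.
  rewrite (_ : (fun _ => _) = \1_[set z : 'rV[R]_n | edot z z < u] :> (_ -> R)).
    by apply: measurable_indic; exact: measurable_eball.
  by apply/funext => z; rewrite indic_eball.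
- by rewrite lee_fin w0.
have -> : (\int[leb n]_z ((edot z z < u)%R%:R)%:E = leb n [set z | edot z z < u]%R)%E.
  by rewrite -integral_eball; apply: eq_integral => z _; rewrite indic_eball.
rewrite eball_measure_powR// EFinM muleA [RHS]muleC.
by congr (_ * _)%E; exact: muleC.
Qed.

Lemma ge0_integral_gauss_rV n :
  (\int[leb n]_z (expR (- edot z z))%:E = (Num.sqrt pi ^+ n)%:E)%E.
Proof.
have mg k : measurable_fun setT (fun z : 'rV[R]_k => (expR (- edot z z))%:E).
  apply/measurable_EFinP; apply: measurableT_comp => //.
  by apply: measurable_funN; exact: measurable_edot.
elim: n => [|n IH]; first by rewrite ge0_integral_rV0 /edot big_ord0 oppr0 expR0.
rewrite ge0_integral_rVS//.
have step (a : R) : (\int[leb n]_y (expR (- edot (rV_cons (a, y)) (rV_cons (a, y))))%:E =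
    (gauss_fun a)%:E * (Num.sqrt pi ^+ n)%:E)%E.
  under eq_integral => y _ do rewrite edot_rV_cons opprD expRD EFinM.
  rewrite ge0_integralZl//; first by rewrite IH.
  exact: mg.
under eq_integral => a _ do rewrite step.
rewrite ge0_integralZr//.
- by rewrite integralT_gauss -EFinM exprS.
- apply/measurable_EFinP; exact: measurable_gauss_fun.
- by move=> x _; rewrite lee_fin expR_ge0.
Qed.

(** With [w u = exp(-u)] in [ge0_integral_layers], the Gaussian integral becomes the volume of the
    ball times the integral defining Gamma at [n/2 + 1]. A finite positive product forces both
    factors to be finite and positive, whence the case analysis on extended reals. *)
Lemma eball_volE n : [/\ leb n [set z | edot z z < 1] = (eball_vol n)%:E,
  0 < eball_vol n &
  (\int[mu]_(u in `]0%R, +oo[) (u `^ (n%:R / 2) * expR (- u))%:E =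
   (Num.sqrt pi ^+ n / eball_vol n)%:E)%E].
Proof.
have mw : measurable_fun setT (fun u : R => expR (- u)).
  by apply: measurableT_comp => //; exact: measurable_funN.
have := ge0_integral_layers n mw (fun u _ => expR_ge0 (- u)).
under eq_integral do rewrite integral_expRN_gt.
rewrite ge0_integral_gauss_rV /eball_vol.
have p0 : 0 < Num.sqrt (pi : R) ^+ n by rewrite exprn_gt0// sqrtr_gt0 pi_gt0.
have : (0 <= leb n [set z | edot z z < 1]%R)%E by exact: measure_ge0.
have : (0 <= \int[mu]_(u in `]0%R, +oo[) (u `^ (n%:R / 2) * expR (- u))%:E)%E.
  by apply: integral_ge0 => u _; rewrite lee_fin mulr_ge0 ?powR_ge0 ?expR_ge0.
case: (leb n _) => [x| |//]; case: (integral _ _ _) => [y| |//].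
- rewrite !lee_fin -EFinM => y0 x0 [pxy]; rewrite /=.
  have x1 : 0 < x.
    by rewrite lt_neqAle x0 andbT; apply/eqP => x00; rewrite pxy -x00 mul0r ltxx in p0.
  by split => //; rewrite pxy mulrC mulKf ?gt_eqF.
- move=> _; rewrite lee_fin le_eqVlt => /orP[/eqP<-|x0].
    by rewrite mul0e => -[pE]; rewrite pE ltxx in p0.
  by rewrite gt0_muley ?lte_fin.
- move=> y0 _; move: y0; rewrite lee_fin le_eqVlt => /orP[/eqP<-|y0].
    by rewrite mule0 => -[pE]; rewrite pE ltxx in p0.
  by rewrite gt0_mulye ?lte_fin.
- by move=> _ _; rewrite mulyy.
Qed.

(** [u^(-s-2) (u - r)] is [u^(-s-1) - r u^(-s-2)], and [1/s - 1/(s+1) = 1/(s (s+1))]. With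
    [r = |z|^2] and [s = (n + alpha + 1)/2] this is the layer decomposition of the kernel. *)
Lemma integral_layer_kernel (s r : R) : 0 < s -> 0 < r ->
  (\int[mu]_(u in `]r, +oo[) (u `^ (- s - 2) * (u - r))%:E =
   (r `^ (- s) / (s * (s + 1)))%:E)%E.
Proof.
move=> s0 r0; have s10 : 0 < s + 1 by rewrite addr_gt0.
have := @ge0_integral_lincomb _ _ _ mu `]r, +oo[%classic _ _ 1 r _ _ _ _ _ _ _
  (integral_powR_gt s0 r0) (integral_powR_gt s10 r0).
move=> H; transitivity (1 * (r `^ (- s) / s) - r * (r `^ (- (s + 1)) / (s + 1)))%:E.
  rewrite -H//.
  - apply: eq_integral => u; rewrite inE/= in_itv/= andbT => ru.
    have u0 : 0 < u by apply: lt_trans ru.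
    congr EFin; rewrite mulrBr [X in _ - X]mulrC; rewrite mul1r; congr (_ - r * (u `^ _)); last ring.
    rewrite (_ : - s - 1 = (- s - 2) + 1); last by ring.
    by rewrite gt0_powRD1.
  - by apply: measurable_funTS; exact: measurable_powR.
  - by apply: measurable_funTS; exact: measurable_powR.
  - by move=> u _; exact: powR_ge0.
  - by move=> u _; exact: powR_ge0.
congr EFin.
rewrite (_ : r `^ (- (s + 1)) = r `^ (- s) * r^-1); last first.
  by rewrite opprD gt0_powRD// powR_inv1// ltW.
by field; rewrite !gt_eqF.
Qed.

(** The bump is itself a superposition of balls: [(u - |z|^2)^2 / 4] is the integral of [(u - v)/2]
    over [v] from [|z|^2] to [u]. The layer formula then leaves the integral of [v^(n/2) (u - v)/2]
    over []0, u[]. *)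
Lemma integral_eball_bump n (u : R) : 0 < u ->
  (\int[leb n]_z (Num.max (u - edot z z) 0 ^+ 2 / 4)%:E =
   (eball_vol n * u `^ (n%:R / 2 + 2) /
    (2 * (n%:R / 2 + 1) * (n%:R / 2 + 2)))%:E)%E.
Proof.
move=> u0; pose k : R := n%:R / 2; rewrite -/k.
have k0 : 0 <= k by rewrite divr_ge0.
have k1 : 0 < k + 1 by rewrite ltr_wpDl.
have k2 : 0 < k + 2 by rewrite ltr_wpDl.
pose w (v : R) := Num.max (u - v) 0 / 2.
have w0 v : 0 <= w v by rewrite divr_ge0// le_max lexx orbT.
have mw : measurable_fun setT w.
  apply: measurable_funM => //; apply: measurable_maxr => //.
  by apply: measurable_funB.
transitivity (\int[leb n]_z \int[mu]_(v in `](edot z z), +oo[) (w v)%:E)%E.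
  apply: eq_integral => z _; set r := edot z z.
  have [ur|ru] := leP u r.
    rewrite max_r ?subr_le0// expr0n/= mul0r; apply/esym/integral0_eq => v /=.
    rewrite in_itv/= andbT => rv; rewrite /w max_r ?mul0r//.
    by rewrite subr_le0 ltW// (le_lt_trans ur).
  rewrite max_l ?subr_ge0 ?ltW// integral_itv_obnd_cbnd; last first.
    by apply/measurable_EFinP; apply: measurable_funTS.
  transitivity (\int[mu]_(v in `[r, u]) ((u - v) / 2)%:E)%E; last first.
    rewrite integral_mkcond [RHS]integral_mkcond; apply: eq_integral => v _.
    rewrite !patchE !mem_setE/= !in_itv/= andbT /w.
    have [rv/=|//] := leP r v; have [vu|uv] := leP v u.
      by rewrite max_l ?subr_ge0.
    by rewrite max_r ?mul0r// subr_le0 ltW.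
  have dF (v : R) : is_derive v 1 (fun v : R => - 4^-1 * ((u - v) * (u - v))) ((u - v) / 2).
    have h : is_derive v (1 : R) (fun v : R => u - v) (0 - 1).
      exact: is_deriveB (is_derive_cst u v 1) (is_derive_id v 1).
    have := @is_deriveZ _ _ _ _ (- 4^-1) _ _ _ (is_deriveM h h).
    by rewrite /GRing.scale/= (_ : - 4^-1 * _ = (u - v) / 2)//; field.
  have cF (v : R) : {for v, continuous (fun v : R => - 4^-1 * ((u - v) * (u - v)))}.
    by apply: differentiable_continuous; apply/derivable1_diffP; case: (dF v).
  rewrite (@continuous_FTC2 _ _ (fun v => - 4^-1 * ((u - v) * (u - v))) r u)//.
  - by rewrite -EFinB; congr EFin; field.
  - apply: continuous_subspaceT => v; apply: cvgMl.
    by apply: cvgB; [exact: cvg_cst|exact: cvg_id].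
  - split.
    + by move=> v _; case: (dF v).
    + by apply: cvg_at_right_filter; exact: cF.
    + by apply: cvg_at_left_filter; exact: cF.
  - by move=> v _; rewrite derive1E; case: (dF v).
rewrite ge0_integral_layers//; have [-> _ _] := eball_volE n.
have := @ge0_integral_lincomb _ _ _ mu `]0%R, u[%classic _ _ (u / 2) 2^-1 _ _ _ _ _ _ _
  (integral_powR_lt k1 u0) (integral_powR_lt k2 u0).
move=> H; transitivity ((eball_vol n)%:E *
   (u / 2 * (u `^ (k + 1) / (k + 1)) - 2^-1 * (u `^ (k + 2) / (k + 2)))%:E)%E.
  rewrite -H//; [congr (_ * _)%E|..].
  - rewrite [LHS]integral_mkcond [RHS]integral_mkcond; apply: eq_integral => v _.
    rewrite !patchE !mem_setE/= !in_itv/= andbT /w.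
    have [v0/=|//] := ltP 0 v; have [vu|uv] := ltP v u; last first.
      by rewrite max_r ?mul0r ?mulr0// subr_le0.
    rewrite max_l ?subr_ge0 ?ltW//; congr EFin.
    rewrite (_ : k + 2 - 1 = k + 1); last by ring.
    rewrite addrK gt0_powRD1//.
    by field.
  - by apply: measurable_funTS; exact: measurable_powR.
  - by apply: measurable_funTS; exact: measurable_powR.
  - by move=> v _; exact: powR_ge0.
  - by move=> v _; exact: powR_ge0.
rewrite -EFinM; congr EFin.
have -> : u `^ (k + 2) = u `^ (k + 1) * u.
  by rewrite -gt0_powRD1//; congr (_ `^ _); ring.
by field; rewrite !gt_eqF.
Qed.

End euclidean_layers.

(** * The kernel integral, split at a squared radius [c] *)

Section kernel_bound.
Context {R : realType}.
Local Notation leb n := (lebesgue_rV n : {sigma_finite_measure set 'rV[R]_n -> \bar R}).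
Local Notation mu := (@lebesgue_measure R).

(** The negative part of [f] may have any integral, even an infinite one: discarding it only
    increases the left side. *)
Lemma le_integral_ge0 d (T : measurableType d) (m : {measure set T -> \bar R})
    (D : set T) (f g : T -> \bar R) : measurable D ->
  measurable_fun D f -> measurable_fun D g -> (forall x, D x -> 0 <= g x)%E ->
  (forall x, D x -> f x <= g x)%E -> (\int[m]_(x in D) f x <= \int[m]_(x in D) g x)%E.
Proof.
move=> mD mf mg g0 fg; rewrite integralE.
apply: (@le_trans _ _ (\int[m]_(x in D) f^\+ x)%E).
  by rewrite geeDl// oppe_le0 integral_ge0.
apply: ge0_le_integral => //; first exact: measurable_funepos.
by move=> x Dx; rewrite funeposE ge_max fg// g0.
Qed.

(* The common shape, in the squared radius [u], of the near and far parts of all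
   the integrals below; the exponents are those left by integrating over balls. *)
Definition power_pieces (e d c a b : R) (u : R) : R :=
  if u < c then a * u `^ (e - 1) else b * u `^ (- d - 1).

Lemma power_pieces_ge0 e d c a b u : 0 <= a -> 0 <= b -> 0 <= power_pieces e d c a b u.
Proof. by move=> a0 b0; rewrite /power_pieces; case: ifPn => _; rewrite mulr_ge0 ?powR_ge0. Qed.

Lemma measurable_power_pieces e d c a b : measurable_fun setT (power_pieces e d c a b).
Proof.
apply: measurable_fun_ifT.
- exact: measurable_fun_ltr.
- by apply: measurable_funM => //; exact: measurable_powR.
- by apply: measurable_funM => //; exact: measurable_powR.
Qed.

Lemma integral_power_pieces e d c a b : 0 < e -> 0 < d -> 0 < c -> 0 <= a -> 0 <= b ->
  (\int[mu]_(u in `]0%R, +oo[) (power_pieces e d c a b u)%:E =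
   (a * (c `^ e / e) + b * (c `^ (- d) / d))%:E)%E.
Proof.
move=> e0 d0 c0 a0 b0.
have mp D : measurable_fun D (fun u : R => (power_pieces e d c a b u)%:E).
  by apply/measurable_EFinP; apply: measurable_funTS; exact: measurable_power_pieces.
have -> : `]0, +oo[%classic = `]0, c[%classic `|` `[c, +oo[%classic :> set R.
  apply/seteqP; split => x; rewrite /= !in_itv/= !andbT.
    by move=> x0; have [xc|cx] := ltP x c; [left; rewrite x0|right].
  by case=> [/andP[]//|]; exact: lt_le_trans.
rewrite ge0_integral_setU//; [|exact: mp|..]; last 2 first.
- by move=> x _; rewrite lee_fin power_pieces_ge0.
- apply/disj_setPS => x [] /=; rewrite !in_itv/= andbT => /andP[_ xc] cx.
  by rewrite ltNge cx in xc.
rewrite EFinD; congr (_ + _)%E.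
  rewrite EFinM -integral_powR_lt// -ge0_integralZl//.
  - apply: eq_integral => u; rewrite inE/= in_itv/= => /andP[_ uc].
    by rewrite /power_pieces uc EFinM.
  - by apply/measurable_EFinP; apply: measurable_funTS; exact: measurable_powR.
  - by move=> x _; rewrite lee_fin powR_ge0.
rewrite -integral_itv_obnd_cbnd; last exact: mp.
rewrite EFinM -integral_powR_gt// -ge0_integralZl//.
- apply: eq_integral => u; rewrite inE/= in_itv/= andbT => cu.
  by rewrite /power_pieces ltNge ltW//= EFinM.
- by apply/measurable_EFinP; apply: measurable_funTS; exact: measurable_powR.
- by move=> x _; rewrite lee_fin powR_ge0.
Qed.

Lemma enorm_powR n (z : 'rV[R]_n) (s : R) : enorm z `^ s = edot z z `^ (s / 2).
Proof. by rewrite /enorm -powR12_sqrt ?edot_ge0// -powRrM mulrC. Qed.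

Variables (n : nat) (alpha : R).
Hypothesis alpha01 : 0 < alpha < 1.

Let e := (1 - alpha) / 2.
Let d := alpha / 2.
Let s := (n%:R + alpha + 1) / 2.

Let e0 : 0 < e. Proof. by case/andP: alpha01 => *; rewrite /e; lra. Qed.
Let d0 : 0 < d. Proof. by case/andP: alpha01 => *; rewrite /d; lra. Qed.
Let s0 : 0 < s.
Proof. by case/andP: alpha01 => *; rewrite divr_gt0// addr_gt0// ltr_wpDl. Qed.

Variables (h : 'rV[R]_n -> R) (L M c : R).
Hypothesis mh : measurable_fun setT h.
Hypotheses (L0 : 0 <= L) (M0 : 0 <= M) (c0 : 0 < c).
Hypothesis hL : forall z, `|h z| <= L * edot z z.
Hypothesis hM : forall z, `|h z| <= M * Num.sqrt (edot z z).

(** Integrating out [u] gives the kernel quotient of [h] up to the factor [s (s+1)]; integrating out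
    [z] first gives the layers. *)
Let F (p : 'rV[R]_n * measurableTypeR R) : R :=
  p.2 `^ (- s - 2) * (Num.max (p.2 - edot p.1 p.1) 0 * h p.1).

(** Majorant of [|F|] on [|z|^2 < u], constant in [z]: the bump is at most [u], and [h] at most
    [L u] for [u < c], [M sqrt u] beyond. The factor [u^(-n/2)] anticipates the measure of the ball,
    so that integration in [z] leaves [eball_vol] times [power_pieces]. *)
Let W (u : R) : R := u `^ (- (n%:R / 2)) * power_pieces e d c L M u.

Let mF : measurable_fun setT F.
Proof.
apply: measurable_funM; first exact: (measurableT_comp (measurable_powR _)).
apply: measurable_funM; last exact: (measurableT_comp mh).
apply: measurable_maxr => //; apply: measurable_funB => //.
exact: (measurableT_comp (@measurable_edot R n)).
Qed.

Let W_ge0 u : 0 <= W u.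
Proof. by rewrite mulr_ge0 ?powR_ge0 ?power_pieces_ge0. Qed.

Let mW : measurable_fun setT W.
Proof.
apply: measurable_funM; first exact: measurable_powR.
exact: measurable_power_pieces.
Qed.

Let F_le z u : `|F (z, u)| <= W u * \1_(`]0%R, +oo[%classic) (u - edot z z).
Proof.
rewrite indic_gt0E /F/=; case: ltP => [zu|uz]; last first.
  by rewrite max_r ?subr_le0// mul0r mulr0 normr0 mulr0.
have u0 : 0 < u by apply: le_lt_trans zu; exact: edot_ge0.
have zu' := ltW zu; have u0' := ltW u0.
rewrite mulr1 max_l ?subr_ge0// normrM ger0_norm ?powR_ge0//.
rewrite normrM ger0_norm ?subr_ge0//.
apply: (@le_trans _ _ (u `^ (- s - 1) * `|h z|)).
  rewrite (_ : - s - 1 = (- s - 2) + 1); last by ring.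
  rewrite gt0_powRD1// -mulrA ler_wpM2l ?powR_ge0// ler_wpM2r//.
  by rewrite gerBl edot_ge0.
rewrite /W /power_pieces; case: ltP => uc.
  rewrite mulrCA -gt0_powRD//.
  rewrite (_ : - (n%:R / 2) + (e - 1) = (- s - 1) + 1); last by rewrite /s /e; field.
  rewrite gt0_powRD1// mulrCA ler_wpM2l ?powR_ge0// (le_trans (hL z))//.
  by rewrite ler_wpM2l.
rewrite mulrCA -gt0_powRD//.
rewrite (_ : - (n%:R / 2) + (- d - 1) = (- s - 1) + 2^-1); last by rewrite /s /d; field.
rewrite (gt0_powRD (- s - 1) 2^-1)// mulrCA ler_wpM2l ?powR_ge0// (le_trans (hM z))//.
by rewrite ler_wpM2l// powR12_sqrt// ler_wsqrtr.
Qed.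

Let integral_W : (\int[leb n]_z \int[mu]_(u in `](edot z z), +oo[) (W u)%:E =
  (eball_vol n * (L * (c `^ e / e) + M * (c `^ (- d) / d)))%:E)%E.
Proof.
rewrite ge0_integral_layers//; have [-> _ _] := @eball_volE R n.
rewrite EFinM -integral_power_pieces//; congr (_ * _)%E.
apply: eq_integral => u; rewrite inE/= in_itv/= andbT => u0.
by rewrite /W mulrA -gt0_powRD// subrr powRr0 mul1r.
Qed.

Let F_integrable : (leb n \x mu)%E.-integrable setT (EFin \o F).
Proof.
apply/integrable12ltyP; first exact/measurable_EFinP.
apply: (@le_lt_trans _ _ (\int[leb n]_z \int[mu]_(u in `](edot z z), +oo[) (W u)%:E)%E).
  apply: ge0_le_integral => //.
  - by move=> z _; exact: integral_ge0.
  - apply: (measurable_fun_fubini_tonelli_F (abse \o (EFin \o F))) => //.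
      by apply: measurableT_comp => //; exact/measurable_EFinP.
    by move=> p; exact: abse_ge0.
  - rewrite (_ : (fun z => _) = (fun z : 'rV[R]_n => \int[mu]_u
      (W u * \1_(`]0%R, +oo[%classic) (u - edot z z))%:E)%E); last first.
      by apply/funext => z; rewrite integral_gt_indic.
    apply: (measurable_fun_fubini_tonelli_F (fun p : 'rV[R]_n * measurableTypeR R =>
      (W p.2 * \1_(`]0%R, +oo[%classic) (p.2 - edot p.1 p.1))%:E)).
      apply/measurable_EFinP/measurable_funM; last exact: measurable_layer.
      exact: (measurableT_comp mW).
    by move=> p; rewrite lee_fin mulr_ge0.
  - move=> z _; rewrite integral_gt_indic; apply: ge0_le_integral => //.
    + apply/measurable_EFinP; apply: measurableT_comp => //.
      exact: measurableT_comp.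
    + apply/measurable_EFinP/measurable_funM => //.
      apply: measurableT_comp; last exact: measurable_funB.
      by apply: measurable_indic; exact: measurable_itv.
    + by move=> u _; rewrite /= lee_fin.
by rewrite integral_W ltry.
Qed.

Let h0 z : edot z z = 0 -> h z = 0.
Proof. by move=> z0; apply/eqP; rewrite -normr_le0 (le_trans (hL z))// z0 mulr0. Qed.

Let integral_F z : (\int[mu]_u (F (z, u))%:E =
  ((s * (s + 1))^-1 * (h z / enorm z `^ (n%:R + alpha + 1)))%:E)%E.
Proof.
(* At [|z| = 0] the layer integral of the kernel diverges, but there [h z = 0] makes both sides
   0. *)
have := edot_ge0 z; rewrite le_eqVlt => /orP[/eqP z0|z0].
  rewrite h0// mul0r mulr0; apply: integral0_eq => u _.
  by rewrite /F/= h0// !mulr0.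
transitivity (\int[mu]_u ((h z)%:E *
    (u `^ (- s - 2) * (u - edot z z) * \1_(`]0%R, +oo[%classic) (u - edot z z))%:E))%E.
  apply: eq_integral => u _; rewrite -EFinM; congr EFin; rewrite /F/= indic_gt0E.
  case: ltP => zu; last by rewrite max_r ?subr_le0// mul0r !mulr0.
  by rewrite max_l ?subr_ge0 ?ltW// mulr1; ring.
have I := integral_layer_kernel s0 z0.
have II : mu.-integrable setT (fun u => (u `^ (- s - 2) * (u - edot z z) *
     \1_(`]0%R, +oo[%classic) (u - edot z z))%:E).
  apply/integrableP; split.
    apply/measurable_EFinP/measurable_funM.
      by apply: measurable_funM; [exact: measurable_powR|exact: measurable_funB].
    apply: measurableT_comp; last exact: measurable_funB.
    by apply: measurable_indic; exact: measurable_itv.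
  rewrite integral_gt_indic in I.
  under eq_integral => u _.
    rewrite gee0_abs; last first.
      rewrite lee_fin indic_gt0E; case: ltP => zu; last by rewrite mulr0.
      by rewrite mulr1 mulr_ge0 ?powR_ge0// subr_ge0 ltW.
    over.
  by rewrite I ltry.
rewrite integralZl// -integral_gt_indic I -EFinM; congr EFin.
by rewrite enorm_powR -/s powRN; field; rewrite !gt_eqF ?powR_gt0// addr_gt0.
Qed.

(** Fubini for the absolutely convergent [F]: its inner integral in [u] is integrable in [z], and is
    a nonzero multiple of the quotient. *)
Lemma kernel_integrable :
  (leb n).-integrable setT (EFin \o (fun z => h z / enorm z `^ (n%:R + alpha + 1))).
Proof.
have := integrable_fubini_F F_integrable.
rewrite /fubini_F; under [X in integrable _ _ X]eq_fun do rewrite /= integral_F.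
move=> /(integrableZl measurableT (s * (s + 1))); apply: eq_integrable => // z _.
by rewrite -EFinM mulrA divff ?mul1r// gt_eqF// mulr_gt0// addr_gt0.
Qed.

Let F_bump_integrable u : 0 < u ->
  (leb n).-integrable setT (fun z => (Num.max (u - edot z z) 0 * h z)%:E).
Proof.
move=> u0; have [volE vol0 _] := @eball_volE R n.
have mE : measurable_fun setT (fun z => (Num.max (u - edot z z) 0 * h z)%:E).
  apply/measurable_EFinP/measurable_funM => //; apply: measurable_maxr => //.
  by apply: measurable_funB => //; exact: measurable_edot.
apply/integrableP; split => //.
apply: (@le_lt_trans _ _ (\int[leb n]_z ((u * (L * u))%:E *
    (\1_[set z : 'rV[R]_n | (edot z z < u)%R] z)%:E))%E).
  apply: ge0_le_integral => //.
  - exact: measurableT_comp.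
  - apply: measurable_funeM; apply/measurable_EFinP; apply: measurable_indic.
    exact: measurable_eball.
  - move=> z _; rewrite -EFinM lee_fin indic_eball; case: ltP => zu; last first.
      by rewrite max_r ?subr_le0// mul0r mulr0 normr0.
    have zu' := ltW zu; rewrite mulr1 max_l ?subr_ge0// normrM ger0_norm ?subr_ge0//.
    apply: ler_pM => //; rewrite ?subr_ge0// ?gerBl ?edot_ge0//.
    by rewrite (le_trans (hL z))// ler_wpM2l.
rewrite ge0_integralZl//; last 2 first.
- apply/measurable_EFinP; apply: measurable_indic; exact: measurable_eball.
- by rewrite lee_fin !mulr_ge0// ltW.
by rewrite integral_eball eball_measure_powR// volE -!EFinM ltry.
Qed.

(** Fubini in the other order. For [u < c] the hypothesis replaces the bound through [L] by one
    through [V]; for [u >= c] the bound by [W] keeps [M]. Thus [L] secures convergence and is absent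
    from the conclusion. *)
Lemma kernel_integral_le V : 0 <= V ->
  (forall u, 0 < u < c ->
    (\int[leb n]_z (Num.max (u - edot z z) 0 * h z)%:E <=
     V%:E * \int[leb n]_z (Num.max (u - edot z z) 0 ^+ 2 / 4)%:E)%E) ->
  \int[leb n]_z (h z / enorm z `^ (n%:R + alpha + 1)) <=
    s * (s + 1) * eball_vol n * (V * (c `^ e / e) / (2 * (n%:R / 2 + 1) * (n%:R / 2 + 2)) +
       M * (c `^ (- d) / d)).
Proof.
move=> V0 hV.
have [volE vol0 _] := @eball_volE R n.
set k := (2 * (n%:R / 2 + 1) * (n%:R / 2 + 2)).
have k0 : 0 < k by rewrite !mulr_gt0// ltr_wpDl// divr_ge0.
have k0' := ltW k0; have vol0' := ltW vol0.
have s10 : 0 < s * (s + 1) by rewrite mulr_gt0// addr_gt0.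
rewrite -mulrA -ler_pdivrMl//.
have XE := fineK (integrable_fin_num measurableT kernel_integrable).
rewrite -lee_fin EFinM /Rintegral XE -integralZl//; last exact: kernel_integrable.
rewrite (eq_integral (fun z => \int[mu]_u (EFin \o F) (z, u)))%E; last first.
  by move=> z _; rewrite [RHS]integral_F.
rewrite (Fubini F_integrable).
set E := fun u : measurableTypeR R => (\int[leb n]_z (EFin \o F) (z, u))%E.
have EE u : 0 < u -> E u = ((u `^ (- s - 2))%:E *
    \int[leb n]_z (Num.max (u - edot z z) 0 * h z)%:E)%E.
  move=> u0; rewrite -integralZl//; last exact: F_bump_integrable.
have mE : measurable_fun setT E by exact: measurable_fubini_G F_integrable.
(* For [u <= 0] the bump vanishes identically. *)
have -> : (\int[mu]_u E u = \int[mu]_(u in `]0%R, +oo[) E u)%E.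
  rewrite [RHS]integral_mkcond; apply: eq_integral => u _.
  rewrite patchE mem_setE/= in_itv/= andbT; case: ltP => // u0.
  apply: integral0_eq => z _; rewrite /F/= max_r ?mul0r ?mulr0//.
  by rewrite subr_le0 (le_trans u0)// edot_ge0.
apply: (@le_trans _ _ (\int[mu]_(u in `]0%R, +oo[)
    (power_pieces e d c (eball_vol n * V / k) (eball_vol n * M) u)%:E)%E); last first.
  rewrite integral_power_pieces// ?mulr_ge0 ?invr_ge0// lee_fin.
  by rewrite le_eqVlt; apply/orP; left; apply/eqP; ring.
have pp0 u : 0 <= power_pieces e d c (eball_vol n * V / k) (eball_vol n * M) u.
  by rewrite power_pieces_ge0 ?mulr_ge0 ?invr_ge0.
apply: le_integral_ge0 => //.
- exact: measurable_funTS.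
- apply/measurable_EFinP; apply: measurable_funTS; exact: measurable_power_pieces.
- by move=> u _; rewrite lee_fin.
move=> u; rewrite /= in_itv/= andbT => u0.
have [uc|cu] := ltP u c.
  rewrite /power_pieces uc EE//.
  apply: (@le_trans _ _ ((u `^ (- s - 2))%:E *
      (V%:E * \int[leb n]_z (Num.max (u - edot z z) 0 ^+ 2 / 4)%:E))%E).
    by rewrite lee_wpmul2l// ?lee_fin ?powR_ge0// hV// u0.
  rewrite integral_eball_bump// -!EFinM lee_fin.
  rewrite (_ : e - 1 = (- s - 2) + (n%:R / 2 + 2)); last by rewrite /e /s; field.
  rewrite (gt0_powRD (- s - 2))// -/k le_eqVlt; apply/orP; left; apply/eqP.
  by field; rewrite gt_eqF.
apply: (@le_trans _ _ (\int[leb n]_z ((W u)%:E *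
   (\1_[set z : 'rV[R]_n | (edot z z < u)%R] z)%:E))%E).
  apply: le_integral_ge0 => //.
  - apply/measurable_EFinP; apply: (measurableT_comp mF) => //.
  - apply: measurable_funeM; apply/measurable_EFinP; apply: measurable_indic.
    exact: measurable_eball.
  - by move=> z _; rewrite -EFinM lee_fin mulr_ge0.
  - move=> z _; rewrite -EFinM lee_fin (le_trans (ler_norm _))//.
    by rewrite (le_trans (F_le _ _))// indic_gt0E indic_eball.
rewrite ge0_integralZl//; last 2 first.
- apply/measurable_EFinP; apply: measurable_indic; exact: measurable_eball.
- by rewrite lee_fin.
rewrite integral_eball eball_measure_powR// volE -!EFinM lee_fin /W.
have u1 : u `^ (- (n%:R / 2)) * u `^ (n%:R / 2) = 1.
  by rewrite -gt0_powRD// addNr powRr0.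
rewrite /power_pieces ltNge cu/= le_eqVlt; apply/orP; left; apply/eqP.
transitivity (u `^ (- (n%:R / 2)) * u `^ (n%:R / 2) *
  (eball_vol n * M * u `^ (- d - 1))); first by ring.
by rewrite u1 mul1r.
Qed.

End kernel_bound.

Lemma bounded_support_integrable d (T : measurableType d) (R : realType)
    (m : {measure set T -> \bar R}) (f : T -> R) (K : R) (S : set T) :
  measurable S -> (m S < +oo)%E -> measurable_fun setT f -> 0 <= K ->
  (forall x, `|f x| <= K * \1_S x) ->
  m.-integrable setT (EFin \o f) /\ `|\int[m]_x f x| <= K * fine (m S).
Proof.
move=> mS Soo mf K0 fK.
have mI : measurable_fun setT (fun x => (\1_S x)%:E : \bar R).
  by apply/measurable_EFinP; exact: measurable_indic.
have KS : (\int[m]_x (K%:E * (\1_S x)%:E) = (K * fine (m S))%:E)%E.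
  rewrite ge0_integralZl ?lee_fin// integral_indic// setIT EFinM fineK//.
  by rewrite ge0_fin_numE.
have fle : (\int[m]_x `|(f x)%:E| <= (K * fine (m S))%:E)%E.
  rewrite -KS; apply: ge0_le_integral => //.
  - by apply: measurableT_comp => //; exact/measurable_EFinP.
  - exact: measurable_funeM.
  - by move=> x _; rewrite -EFinM /= lee_fin.
have fI : m.-integrable setT (EFin \o f).
  apply/integrableP; split; first exact/measurable_EFinP.
  by apply: le_lt_trans fle _; rewrite ltry.
split => //; apply: le_trans (le_normr_Rintegral _ fI) _ => //.
rewrite -lee_fin /Rintegral fineK//; apply: integrable_fin_num => //.
exact: (integrable_norm fI).
Qed.

(** * Integration by parts against the layers *)

Section bump_by_parts.
Context {R : realType} {n : nat}.
Local Notation leb := (lebesgue_rV n : {sigma_finite_measure set 'rV[R]_n -> \bar R}).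

Lemma measurable_rV_shift (h : 'rV[R]_n) : measurable_fun setT (fun x : 'rV[R]_n => x + h).
Proof.
have := @measurable_rV_affine R n 1 h.
by under eq_fun do rewrite scale1r.
Qed.

Lemma ge0_integral_rV_shift (h : 'rV[R]_n) (f : 'rV[R]_n -> \bar R) :
  measurable_fun setT f -> (forall x, 0 <= f x)%E ->
  (\int[leb]_x f x)%E = (\int[leb]_x f (x + h)%R)%E.
Proof.
move=> mf f0; rewrite (ge0_integral_rV_affine h ltr01 mf f0) expr1n mul1e.
by apply: eq_integral => x _; rewrite scale1r.
Qed.

Lemma integral_rV_shift (h : 'rV[R]_n) (f : 'rV[R]_n -> \bar R) :
  measurable_fun setT f -> (\int[leb]_x f x)%E = (\int[leb]_x f (x + h)%R)%E.
Proof.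
move=> mf; rewrite integralE [RHS]integralE.
congr (_ - _)%E.
  rewrite (ge0_integral_rV_shift h (measurable_funepos mf))//.
  by apply: eq_integral => x _; rewrite !funeposE.
rewrite (ge0_integral_rV_shift h (measurable_funeneg mf))//.
by apply: eq_integral => x _; rewrite !funenegE.
Qed.

Lemma edot_coord_le (z : 'rV[R]_n) i : z ord0 i ^+ 2 <= edot z z.
Proof.
rewrite /edot (bigD1 i)//= -expr2 lerDl sumr_ge0// => j _.
by rewrite -expr2 sqr_ge0.
Qed.

Lemma edot_shift (z : 'rV[R]_n) (t : R) i :
  edot (z + t *: delta_mx ord0 i) (z + t *: delta_mx ord0 i) =
  edot z z + 2 * t * z ord0 i + t ^+ 2.
Proof.
rewrite /edot (bigD1 i)//= [in RHS](bigD1 i)//= !mxE !eqxx/= mulr1.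
rewrite [X in _ + X = _](eq_bigr (fun j => z ord0 j * z ord0 j)); first by ring.
by move=> j /negbTE ji; rewrite !mxE/= ji mulr0 addr0.
Qed.

Lemma eball_bounded_integrable (f : 'rV[R]_n -> R) (K v : R) :
  measurable_fun setT f -> 0 <= K -> 0 < v ->
  (forall z, `|f z| <= K * \1_[set z : 'rV[R]_n | edot z z < v] z) ->
  leb.-integrable setT (EFin \o f) /\
  `|\int[leb]_z f z| <= K * (v `^ (n%:R / 2) * eball_vol n).
Proof.
move=> mf K0 v0 fK; have [volE vol0 _] := @eball_volE R n.
have lebE : leb [set z | edot z z < v] = (v `^ (n%:R / 2) * eball_vol n)%:E.
  by rewrite eball_measure_powR// volE EFinM.
have leboo : (leb [set z | (edot z z < v)%R] < +oo)%E by rewrite lebE ltry.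
have [fI fle] := bounded_support_integrable (measurable_eball v) leboo mf K0 fK.
split => //; have <- : fine (leb [set z | edot z z < v]) = v `^ (n%:R / 2) * eball_vol n.
  by rewrite lebE.
exact: fle.
Qed.

(** The square of the positive part has a Lipschitz derivative, so its first-order remainder is
    quadratic even across the kink. *)
Lemma maxr0_sqr_taylor (a d : R) :
  `|Num.max (a + d) 0 ^+ 2 - Num.max a 0 ^+ 2 - 2 * Num.max a 0 * d| <= d ^+ 2.
Proof.
rewrite ler_norml; have [ad|ad] := leP (a + d) 0; have [a0|a0] := leP a 0;
  by apply/andP; split; nra.
Qed.

Variables (u : R) (i : 'I_n) (psi psi' : 'rV[R]_n -> R) (A M : R).
Hypotheses (u0 : 0 < u) (M0 : 0 <= M).
Hypotheses (mpsi : measurable_fun setT psi) (mpsi' : measurable_fun setT psi').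
Hypothesis psiA : forall z, `|psi z| <= A.
Hypothesis psiM : forall z t,
  `|psi (z + t *: delta_mx ord0 i) - psi z - t * psi' z| <= M * t ^+ 2.

Let P (z : 'rV[R]_n) := Num.max (u - edot z z) 0.
Let e : 'rV[R]_n := delta_mx ord0 i.
(** The ball of squared radius [v] contains the support of the bump and of its translates by at most
    1, since [|z|^2 <= 2 |z + t e|^2 + 2 t^2]. *)
Let v := 2 * u + 2.
Let S := [set z : 'rV[R]_n | edot z z < v].

Let mP : measurable_fun setT P.
Proof.
apply: measurable_maxr => //; apply: measurable_funB => //.
exact: measurable_edot.
Qed.

Let P0 z : 0 <= P z. Proof. by rewrite le_max lexx orbT. Qed.

Let P_far z : z \notin S -> P z = 0.
Proof.
move=> zS; have : v <= edot z z by rewrite leNgt; apply: contra zS; rewrite inE.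
by rewrite /v => vz; rewrite /P max_r// subr_le0; have := u0; lra.
Qed.

Let Pu z : P z <= u.
Proof. by rewrite /P ge_max gerBl edot_ge0 ltW. Qed.

Let Pshift_far z t : `|t| <= 1 -> z \notin S -> P (z + t *: e) = 0.
Proof.
move=> t1 zS; have vz : v <= edot z z by rewrite leNgt; apply: contra zS; rewrite inE.
rewrite /P max_r// subr_le0 edot_shift.
have zi := edot_coord_le z i.
have t2 : t ^+ 2 <= 1 by move: t1; rewrite ler_norml => /andP[? ?]; nra.
move: vz; rewrite /v => vz.
(* Half of this square gives [2 t z_i >= - z_i^2 / 2 - 2 t^2], hence
   [|z + t e|^2 >= |z|^2 / 2 - t^2 >= u]. *)
have := sqr_ge0 (z ord0 i + 2 * t); rewrite sqrrD exprMn => H.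
have : 0 <= (z ord0 i + 2 * t) ^+ 2 / 2 by rewrite divr_ge0 ?sqr_ge0.
nra.
Qed.

Let psi'A z : `|psi' z| <= 2 * A + M.
Proof.
have := psiM z 1; rewrite scale1r mul1r expr1n mulr1 => H.
have := psiA z; have := psiA (z + delta_mx ord0 i).
move: H; rewrite !ler_norml => /andP[? ?] /andP[? ?] /andP[? ?].
by apply/andP; split; lra.
Qed.

Let A0 : 0 <= A. Proof. exact: le_trans (psiA 0). Qed.

Let mpsi_shift t : measurable_fun setT (fun z : 'rV[R]_n => psi (z + t *: e)).
Proof. by apply: (measurableT_comp mpsi); exact: measurable_rV_shift. Qed.

Let q z := P z ^+ 2 / 4.

Let mq : measurable_fun setT q.
Proof. by apply: measurable_funM => //; exact: measurable_funX. Qed.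

Let mq_shift t : measurable_fun setT (fun z : 'rV[R]_n => q (z + t *: e)).
Proof. by apply: (measurableT_comp mq); exact: measurable_rV_shift. Qed.

Let qP z : 0 <= q z <= u ^+ 2 / 4.
Proof.
rewrite /q divr_ge0 ?sqr_ge0//= ler_wpM2r// ler_sqr ?nnegrE//.
exact: ltW.
Qed.

Let v0 : 0 < v. Proof. by rewrite /v; have := u0; lra. Qed.
Let u0' := ltW u0.
Let v0' := ltW v0.

Let indicS z : \1_S z = (z \in S)%:R :> R. Proof. by rewrite indicE. Qed.

Let I_bounded (f : 'rV[R]_n -> R) K : measurable_fun setT f -> 0 <= K ->
  (forall z, z \notin S -> f z = 0) -> (forall z, z \in S -> `|f z| <= K) ->
  leb.-integrable setT (EFin \o f) /\
  `|\int[leb]_z f z| <= K * (v `^ (n%:R / 2) * eball_vol n).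
Proof.
move=> mf K0 f0 fK; apply: eball_bounded_integrable => // z; rewrite indicS.
have [zS|zS] := boolP (z \in S); first by rewrite mulr1 fK.
by rewrite mulr0 f0// normr0.
Qed.

Let q_bounded_integrable (f g : 'rV[R]_n -> R) K :
  measurable_fun setT f -> measurable_fun setT g -> 0 <= K ->
  (forall z, 0 <= g z <= u ^+ 2 / 4) -> (forall z, z \notin S -> g z = 0) ->
  (forall z, `|f z| <= K) ->
  leb.-integrable setT (EFin \o (fun z => g z * f z)).
Proof.
move=> mf mg K0 g0 gS fK; have [] // := @I_bounded (fun z => g z * f z) (u ^+ 2 / 4 * K).
- exact: measurable_funM.
- by rewrite mulr_ge0// divr_ge0// sqr_ge0.
- by move=> z zS; rewrite gS ?mul0r.
- move=> z _; have /andP[gz0 gzu] := g0 z.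
  by rewrite normrM ger0_norm// ler_pM.
Qed.

Let coord_S z : z \in S -> z ord0 i ^+ 2 <= v.
Proof. by rewrite inE => zS; rewrite (le_trans (edot_coord_le z i))// ltW. Qed.

Let mcoord : measurable_fun setT (fun z : 'rV[R]_n => z ord0 i).
Proof. exact: measurable_rV_coord. Qed.

Lemma bump_coord_integrable :
  leb.-integrable setT (EFin \o (fun z => Num.max (u - edot z z) 0 * (z ord0 i * psi z))).
Proof.
have [] // := @I_bounded (fun z => P z * (z ord0 i * psi z)) (u * ((v + 1) * A)).
- by apply: measurable_funM => //; exact: measurable_funM.
- by rewrite !mulr_ge0// addr_ge0.
- by move=> z /P_far ->; rewrite mul0r.
- move=> z zS; rewrite normrM ger0_norm// ler_pM// normrM ler_pM//.
  have := coord_S zS; rewrite -real_normK ?num_real//.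
  have := normr_ge0 (z ord0 i); nra.
Qed.

Let q_far z : z \notin S -> q z = 0.
Proof. by move=> /P_far zS; rewrite /q zS expr0n/= mul0r. Qed.

Lemma bump_sqr_integrable :
  leb.-integrable setT (EFin \o (fun z => Num.max (u - edot z z) 0 ^+ 2 / 4 * psi' z)).
Proof.
apply: (q_bounded_integrable mpsi' mq _ qP q_far psi'A).
by rewrite addr_ge0 ?mulr_ge0.
Qed.

(** Translation invariance moves a shift by [t e] from [psi] onto the bump [q] as a shift by
    [- t e]. Expanding either side to first order in [t], with remainders [G] and [H] of order
    [t^2], shows that [t] times the difference of the two integrals is of order [t^2]; then [t]
    tends to 0. *)
Lemma bump_by_parts :
  \int[leb]_z (Num.max (u - edot z z) 0 * (z ord0 i * psi z)) =
  \int[leb]_z (Num.max (u - edot z z) 0 ^+ 2 / 4 * psi' z).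
Proof.
rewrite -[LHS]/(\int[leb]_z (P z * (z ord0 i * psi z))).
rewrite -[RHS]/(\int[leb]_z (q z * psi' z)).
have qt_far t z : `|t| <= 1 -> z \notin S -> q (z + t *: e) = 0.
  by move=> t1 /(Pshift_far t1) zS; rewrite /q zS expr0n/= mul0r.
have i2 : leb.-integrable setT (EFin \o (fun z => q z * psi z)).
  exact: (q_bounded_integrable mpsi mq A0 qP q_far psiA).
have i3 := bump_sqr_integrable.
have i1 t : leb.-integrable setT (EFin \o (fun z : 'rV[R]_n => q z * psi (z + t *: e))).
  by apply: (q_bounded_integrable (mpsi_shift t) mq A0 qP q_far) => z.
have i4 t : `|t| <= 1 -> leb.-integrable setT (EFin \o (fun z : 'rV[R]_n => q (z + t *: e) * psi z)).
  by move=> t1; apply: (q_bounded_integrable mpsi (mq_shift t) A0 _ _ psiA) => // z; exact: qt_far.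
set I1 := \int[leb]_z _; set I2 := \int[leb]_z _.
pose C := v `^ (n%:R / 2) * eball_vol n.
(* [K1] is the bound on [q] times the remainder constant of [psi]. In [K2], [8 v + 2] bounds
   [(2 z_i - t)^2] on [S] for [|t| <= 1], and [u / 2] accounts for the term [t^2] in the expansion
   of [|z - t e|^2]. *)
pose K1 := u ^+ 2 / 4 * M; pose K2 := ((8 * v + 2) / 4 + u / 2) * A.
have K10 : 0 <= K1 by rewrite mulr_ge0// divr_ge0// sqr_ge0.
have K20 : 0 <= K2 by rewrite mulr_ge0// addr_ge0// divr_ge0// addr_ge0// mulr_ge0.
have C0 : 0 <= C by rewrite mulr_ge0 ?powR_ge0//; have [_ /ltW] := @eball_volE R n.
have main t : 0 < t <= 1 -> `|I1 - I2| <= (K1 + K2) * C * t.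
  move=> /andP[t0 t1].
  have nt1 : `|- t| <= 1 by rewrite normrN ger0_norm// ltW.
  pose G z := q z * psi (z + t *: e) - q z * psi z - t * (q z * psi' z).
  pose H z := q (z + (- t) *: e) * psi z - q z * psi z - t * (P z * (z ord0 i * psi z)).
  have [_ HG] : leb.-integrable setT (EFin \o G) /\ `|\int[leb]_z G z| <= K1 * t ^+ 2 * C.
    apply: I_bounded.
    - apply: measurable_funB; last first.
        by apply: measurable_funM => //; exact: measurable_funM.
      by apply: measurable_funB; exact: measurable_funM.
    - by rewrite mulr_ge0// sqr_ge0.
    - by move=> z zS; rewrite /G (@q_far z)// !mul0r mulr0 !subr0.
    - move=> z _; rewrite /G (_ : _ - _ = q z * (psi (z + t *: e) - psi z - t * psi' z)); last by ring.
      have /andP[q0 qu] := qP z.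
      by rewrite normrM ger0_norm// /K1 -mulrA ler_pM.
  have [_ HH] : leb.-integrable setT (EFin \o H) /\ `|\int[leb]_z H z| <= K2 * t ^+ 2 * C.
    apply: I_bounded.
    - apply: measurable_funB; last first.
        by apply: measurable_funM => //; apply: measurable_funM => //; exact: measurable_funM.
      by apply: measurable_funB; exact: measurable_funM.
    - by rewrite mulr_ge0// sqr_ge0.
    - by move=> z zS; rewrite /H (@q_far z)// qt_far// P_far// !mul0r mulr0 !subr0.
    - move=> z zS; rewrite /H (_ : _ - _ = (q (z + (- t) *: e) - q z - t * (P z * z ord0 i)) * psi z); last by ring.
      rewrite normrM /K2 mulrAC ler_pM//.
      have zi := coord_S zS.
      pose dd := 2 * t * z ord0 i - t ^+ 2.
      have := maxr0_sqr_taylor (u - edot z z) dd.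
      have -> : u - edot z z + dd = u - edot (z + (- t) *: e) (z + (- t) *: e).
        by rewrite edot_shift /dd; ring.
      rewrite -/(P z) -/(P (z + (- t) *: e)) => T.
      have -> : q (z + - t *: e) - q z - t * (P z * z ord0 i) =
        (P (z + - t *: e) ^+ 2 - P z ^+ 2 - 2 * P z * dd) / 4 - P z * t ^+ 2 / 2.
        by rewrite /q /dd; field.
      apply: (le_trans (ler_normB _ _)).
      rewrite [leRHS]mulrDl lerD//.
        rewrite normrM (ger0_norm (_ : 0 <= 4^-1))// [leRHS]mulrAC ler_wpM2r//.
        rewrite (le_trans T)// /dd.
        have -> : (2 * t * z ord0 i - t ^+ 2) ^+ 2 = (2 * z ord0 i - t) ^+ 2 * t ^+ 2 by ring.
        rewrite ler_wpM2r ?sqr_ge0//.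
        have := sqr_ge0 (2 * z ord0 i + t); nra.
      rewrite ger0_norm; last by rewrite divr_ge0// mulr_ge0// sqr_ge0.
      by rewrite [leLHS]mulrAC ler_wpM2r ?sqr_ge0// ler_wpM2r.
  have EG : \int[leb]_z G z = \int[leb]_z (q z * psi (z + t *: e)) -
      \int[leb]_z (q z * psi z) - t * I2.
    rewrite /G RintegralB//; last 2 first.
    - exact: (integrableB measurableT (i1 t) i2).
    - exact: (integrableZl measurableT t i3).
    by rewrite RintegralB// RintegralZl.
  have EH : \int[leb]_z H z = \int[leb]_z (q (z + (- t) *: e) * psi z) -
      \int[leb]_z (q z * psi z) - t * I1.
    rewrite /H RintegralB//; last 2 first.
    - exact: (integrableB measurableT (i4 _ nt1) i2).
    - exact: (integrableZl measurableT t bump_coord_integrable).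
    rewrite RintegralB ?RintegralZl//; [exact: bump_coord_integrable|exact: i4].
  have ET : \int[leb]_z (q (z + (- t) *: e) * psi z) = \int[leb]_z (q z * psi (z + t *: e)).
    rewrite /Rintegral (integral_rV_shift (t *: e)); last first.
      by apply/measurable_EFinP; exact: measurable_funM.
    by congr fine; apply: eq_integral => z _; rewrite scaleNr addrK.
  have : `|t * (I1 - I2)| <= (K1 + K2) * C * t ^+ 2.
    have -> : t * (I1 - I2) = \int[leb]_z G z - \int[leb]_z H z by rewrite EG EH ET; ring.
    rewrite (le_trans (ler_normB _ _))// (le_trans (lerD HG HH))//.
    by rewrite le_eqVlt; apply/orP; left; apply/eqP; ring.
  by rewrite normrM gtr0_norm// expr2 mulrA -[leRHS]mulrC ler_pM2l// mulrC.
apply/eqP; rewrite -subr_eq0 -normr_le0; apply/ler_addgt0Pr => eps eps0; rewrite add0r.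
pose K := (K1 + K2) * C.
have K0 : 0 <= K by rewrite mulr_ge0// addr_ge0.
have K1' : 0 < K + 1 by rewrite ltr_wpDl.
pose t := Num.min 1 (eps / (K + 1)).
have t0 : 0 < t by rewrite lt_min ltr01 divr_gt0.
apply: (le_trans (main t _)); first by rewrite t0 ge_min lexx.
rewrite -/K (le_trans (ler_wpM2l K0 (_ : t <= eps / (K + 1))))//.
  by rewrite ge_min lexx orbT.
by rewrite mulrA ler_pdivrMr// mulrC ler_wpM2l ?ltW// ltrDl.
Qed.

End bump_by_parts.

(** * Smooth test functions *)

Section smooth_test_functions.
Context {R : realType} {n : nat}.
Local Notation leb := (lebesgue_rV n : {sigma_finite_measure set 'rV[R]_n -> \bar R}).

Lemma iter_partial_coord (phi : 'rV[R]_n -> 'rV[R]_n) (i : 'I_n) (s : seq 'I_n) :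
  smooth phi ->
  iter_partial s (fun x => phi x ord0 i) = (fun x => iter_partial s phi x ord0 i).
Proof.
move=> sphi; elim: s => // j s IH; rewrite /= IH; apply/funext => x.
by rewrite /partial derive_mx ?mxE//; exact: (sphi s).2.
Qed.

Lemma smooth_coord (phi : 'rV[R]_n -> 'rV[R]_n) (i : 'I_n) :
  smooth phi -> smooth (fun x => phi x ord0 i).
Proof.
move=> sphi s; rewrite iter_partial_coord//; have [cs ds] := sphi s; split.
  move=> x; apply: (@continuous_comp _ _ _ (iter_partial s phi)
    (fun M : 'rV[R]_n => M ord0 i)); [exact: cs|exact: coord_continuous].
by move=> j x; have /derivable_mxP := ds j x; apply.
Qed.

Lemma supp_coord (phi : 'rV[R]_n -> 'rV[R]_n) (i : 'I_n) :
  supp (fun x => phi x ord0 i) `<=` supp phi.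
Proof.
apply: closure_subset => x /=; apply: contra => /eqP ->.
by rewrite mxE.
Qed.

Lemma Cc_smooth_coord Omega (phi : 'rV[R]_n -> 'rV[R]_n) (i : 'I_n) :
  Cc_smooth 'rV[R]_n Omega phi -> Cc_smooth R Omega (fun x => phi x ord0 i).
Proof.
move=> [sphi cphi phiO]; split; first exact: smooth_coord.
- by apply: (subclosed_compact _ cphi); [exact: closed_closure|exact: supp_coord].
- exact: subset_trans (@supp_coord phi i) phiO.
Qed.

Lemma continuous_sum_rV (I : finType) (f : I -> 'rV[R]_n -> R) :
  (forall i, continuous (f i)) -> continuous (fun x => \sum_i f i x).
Proof.
move=> cf; elim: (index_enum I) => [|i s IH].
  under eq_fun do rewrite big_nil.
  exact: cst_continuous.
under eq_fun do rewrite big_cons.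
by move=> x; exact: (cvgD (cf i x) (IH x)).
Qed.

Lemma continuous_shift_rV (z : 'rV[R]_n) : continuous (fun x : 'rV[R]_n => x + z).
Proof.
move=> x.
have h1 : (id y @[y --> x] --> (x : 'rV[R]_n)) by move=> A HA; exact: HA.
have h2 : ((cst z y : 'rV[R]_n) @[y --> x] --> z) by apply: cst_continuous.
exact: cvgD h1 h2.
Qed.

Lemma growth_rate_shift (f : 'rV[R]_n -> R) (z x v : 'rV[R]_n) :
  (fun h : R => h^-1 *: (((fun y => f (y + z)) \o shift x) (h *: v) - f (x + z))) =
  (fun h : R => h^-1 *: ((f \o shift (x + z)) (h *: v) - f (x + z))).
Proof. by apply/funext => h /=; rewrite addrA. Qed.

Lemma iter_partial_shift (psi : 'rV[R]_n -> R) (z : 'rV[R]_n) (s : seq 'I_n) :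
  iter_partial s (fun x => psi (x + z)) = (fun x => iter_partial s psi (x + z)).
Proof.
elim: s => // j s IH; rewrite /= IH; apply/funext => x.
by rewrite /partial /derive growth_rate_shift.
Qed.

Lemma smooth_shift (psi : 'rV[R]_n -> R) (z : 'rV[R]_n) :
  smooth psi -> smooth (fun x => psi (x + z)).
Proof.
move=> spsi s; rewrite iter_partial_shift; have [cs ds] := spsi s; split.
  move=> x; apply: (@continuous_comp _ _ _ (fun y : 'rV[R]_n => y + z)
    (iter_partial s psi)); [exact: continuous_shift_rV|exact: cs].
by move=> j x; have := ds j (x + z); rewrite /derivable growth_rate_shift.
Qed.

Lemma supp_shift (psi : 'rV[R]_n -> R) (z : 'rV[R]_n) :
  supp (fun x => psi (x + z)) `<=` (fun x => x + z) @^-1` supp psi.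
Proof.
have cl : closed ((fun x : 'rV[R]_n => x + z) @^-1` supp psi).
  apply: closed_comp; last exact: closed_closure.
  by move=> x _; exact: continuous_shift_rV.
rewrite [X in _ `<=` X](closure_id _).1//; apply: closure_subset => x /= h.
exact: subset_closure.
Qed.

Lemma Cc_smooth_shift Omega (psi : 'rV[R]_n -> R) (z : 'rV[R]_n) :
  Cc_smooth R Omega psi ->
  Cc_smooth R ((fun x => x + z) @^-1` Omega) (fun x => psi (x + z)).
Proof.
move=> [sp cp pO]; split; first exact: smooth_shift.
- have : compact ((fun x => x + (- z)) @` supp psi).
    apply: continuous_compact => //; apply: continuous_subspaceT.
    exact: continuous_shift_rV.
  move=> /subclosed_compact; apply; first exact: closed_closure.
  move=> x /supp_shift xz; exists (x + z) => //.
  by rewrite addrK.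
- by move=> x /supp_shift /pO.
Qed.

Lemma smooth_continuous (psi : 'rV[R]_n -> R) : smooth psi -> continuous psi.
Proof. by move=> /(_ [::]) []. Qed.

Lemma partial_notin_supp (psi : 'rV[R]_n -> R) (i : 'I_n) x :
  ~ supp psi x -> partial i psi x = 0.
Proof.
move=> xs; rewrite /partial -[RHS](derive_cst (0 : R) x (delta_mx ord0 i)).
apply: near_eq_derive.
have : nbhs x (~` supp psi).
  by apply: open_nbhs_nbhs; split => //; apply: closed_openC; exact: closed_closure.
apply: filterS => y ys; apply/eqP; apply: contrapT => /negP py.
by apply: ys; exact: subset_closure.
Qed.

Lemma Cc_smooth_partial Omega (psi : 'rV[R]_n -> R) (i : 'I_n) :
  Cc_smooth R Omega psi -> Cc_smooth R Omega (partial i psi).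
Proof.
move=> [sp cp pO].
have H : supp (partial i psi) `<=` supp psi.
  rewrite [X in _ `<=` X](closure_id _).1; last exact: closed_closure.
  apply: closure_subset => x /= /eqP px; apply: contrapT => nps.
  by apply: px; exact: partial_notin_supp.
split; last exact: subset_trans pO.
- move=> s; have := sp (rcons s i); rewrite /iter_partial.
  by rewrite !foldr_rcons.
- by apply: (subclosed_compact _ cp) => //; exact: closed_closure.
Qed.

Lemma Cc_smooth_bounded Omega (psi : 'rV[R]_n -> R) :
  Cc_smooth R Omega psi -> exists2 A, 0 <= A & forall x, `|psi x| <= A.
Proof.
move=> [sp cp _].
have : compact (psi @` supp psi).
  apply: continuous_compact => //; apply: continuous_subspaceT.
  exact: smooth_continuous.
move=> /compact_bounded[A [_ HA]]; exists (Num.max (A + 1) 0); first by rewrite le_max lexx orbT.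
move=> x; have [xs|xs] := pselect (supp psi x).
  rewrite le_max; apply/orP; left; apply: (HA (A + 1)); first by rewrite ltrDl.
  by exists x.
suff -> : psi x = 0 by rewrite normr0 le_max lexx orbT.
by apply: contrapT => /eqP px; apply: xs; exact: subset_closure.
Qed.

(** The one-variable mean value theorem along the line, the difference quotients of [f] at [r] being
    those of [psi] in direction [e]. The two signs of [t] need separate intervals. *)
Lemma MVT_partial (psi : 'rV[R]_n -> R) (i : 'I_n) x t : smooth psi ->
  exists2 c, `|c| <= `|t| /\ `|c - t| <= `|t| &
    psi (x + t *: delta_mx ord0 i) - psi x = t * partial i psi (x + c *: delta_mx ord0 i).
Proof.
move=> sp; set e := delta_mx ord0 i.
pose f (r : R) := psi (x + r *: e).
have df (r : R) : is_derive r 1 f (partial i psi (x + r *: e)).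
  have Ef : (fun h : R => h^-1 *: ((f \o shift r) (h *: (1 : R)) - f r)) =
    (fun h : R => h^-1 *: ((psi \o shift (x + r *: e)) (h *: e) - psi (x + r *: e))).
    apply/funext => h /=; rewrite /f/= [h *: 1](mulr1 h) scalerDl; congr (_ *: (psi _ - _)).
    by rewrite addrCA.
  have := (sp [::]).2 i (x + r *: e); rewrite -/e /= => dp.
  apply: DeriveDef; first by rewrite /derivable Ef.
  by rewrite /partial /derive Ef.
have cf : continuous f.
  move=> r; apply: differentiable_continuous; apply/derivable1_diffP; by case: (df r).
have f0 : f 0 = psi x by rewrite /f scale0r addr0.
have [t0|t0] := leP 0 t.
  have [|c] := @MVT_segment _ f (fun r => partial i psi (x + r *: e)) 0 t t0 (fun r _ => df r).
    exact: continuous_subspaceT.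
  rewrite in_itv/= => /andP[c0 ct]; rewrite f0 subr0 => E; exists c.
    by rewrite distrC !ger0_norm ?subr_ge0// gerBl.
  by rewrite mulrC.
have [|c] := @MVT_segment _ f (fun r => partial i psi (x + r *: e)) t 0 (ltW t0) (fun r _ => df r).
  exact: continuous_subspaceT.
rewrite in_itv/= => /andP[tc c0]; rewrite f0 sub0r => E; exists c.
  rewrite (ler0_norm c0) (ltr0_norm t0) ger0_norm ?subr_ge0//; split; lra.
by rewrite -[LHS]opprB E mulrN opprK mulrC.
Qed.

(** A partial derivative is again a test function, hence Lipschitz; comparing it at the mean value
    point with its value at [x] makes the remainder quadratic. Summing the constants over the
    coordinates makes them uniform in the direction. *)
Lemma Cc_smooth_taylor Omega (psi : 'rV[R]_n -> R) : Cc_smooth R Omega psi ->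
  exists L M, [/\ 0 <= L, 0 <= M,
    forall i x t, `|psi (x + t *: delta_mx ord0 i) - psi x| <= L * `|t| &
    forall i x t, `|psi (x + t *: delta_mx ord0 i) - psi x - t * partial i psi x|
      <= M * t ^+ 2].
Proof.
move=> cp.
have lip (f : 'rV[R]_n -> R) : Cc_smooth R Omega f -> exists2 L, 0 <= L &
    forall i x t, `|f (x + t *: delta_mx ord0 i) - f x| <= L * `|t|.
  move=> cf.
  have /choice[A HA] : forall i, exists A, 0 <= A /\ forall x, `|partial i f x| <= A.
    by move=> i; have [A A0 HA] := Cc_smooth_bounded (Cc_smooth_partial i cf); exists A.
  exists (\sum_i A i); first by rewrite sumr_ge0// => i _; have [] := HA i.
  move=> i x t; have [c _ ->] := MVT_partial i x t (let: And3 s _ _ := cf in s).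
  rewrite normrM mulrC ler_wpM2r//; have [_ HAi] := HA i.
  rewrite (le_trans (HAi _))// (bigD1 i)//= lerDl sumr_ge0// => j _.
  by have [] := HA j.
have [L L0 HL] := lip _ cp.
have /choice[B HB] : forall i, exists B, 0 <= B /\
   forall j x t, `|partial i psi (x + t *: delta_mx ord0 j) - partial i psi x| <= B * `|t|.
  by move=> i; have [B B0 HB] := lip _ (Cc_smooth_partial i cp); exists B.
exists L, (\sum_i B i); split => //; first by rewrite sumr_ge0// => i _; have [] := HB i.
move=> i x t; have [c [ct _] ->] := MVT_partial i x t (let: And3 s _ _ := cp in s).
rewrite -mulrBr normrM -real_normK ?num_real// expr2 mulrCA ler_wpM2l//.
have [B0 HBi] := HB i; rewrite (le_trans (HBi _ _ _))//.
apply: ler_pM => //; rewrite (bigD1 i)//= lerDl sumr_ge0// => j _.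
by have [] := HB j.
Qed.

(** Go from [x] to [x + z] along the axes, one coordinate after the other. *)
Lemma lipschitz_coord_sum (psi : 'rV[R]_n -> R) L :
  (forall i x t, `|psi (x + t *: delta_mx ord0 i) - psi x| <= L * `|t|) ->
  forall x z, `|psi (x + z) - psi x| <= L * \sum_i `|z ord0 i|.
Proof.
move=> HL x z; rewrite [in psi _](row_sum_delta z).
elim/big_ind2 : _ x => [x|sy y sa a Hy Ha x|i _ x].
- by rewrite addr0 subrr normr0 mulr0 lexx.
- rewrite addrA -[_ - psi x](subrKA (psi (x + y))) (le_trans (ler_normD _ _))//.
  by rewrite mulrDr [leRHS]addrC lerD.
- exact: HL.
Qed.

Lemma sum_coord_le (z : 'rV[R]_n) : \sum_i `|z ord0 i| <= n%:R * Num.sqrt (edot z z).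
Proof.
rewrite (le_trans (ler_sum _ (_ : forall i, _ -> `|z ord0 i| <= Num.sqrt (edot z z))))//.
  by move=> i _; rewrite -sqrtr_sqr ler_wsqrtr// edot_coord_le.
by rewrite sumr_const card_ord mulr_natl.
Qed.

Lemma edot_cauchy_schwarz (x y : 'rV[R]_n) : edot x y <= enorm x * enorm y.
Proof.
have [y0|y0] := eqVneq (edot y y) 0.
  have Y i : y ord0 i = 0.
    apply/eqP; rewrite -sqrf_eq0 eq_le sqr_ge0 andbT -y0; exact: edot_coord_le.
  rewrite /edot big1 => [|i _]; last by rewrite Y mulr0.
  by rewrite mulr_ge0 ?sqrtr_ge0.
have Y0 : 0 < edot y y by rewrite lt_neqAle eq_sym y0 edot_ge0.
rewrite /enorm -sqrtrM ?edot_ge0//.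
rewrite (le_trans (ler_norm _))// -sqrtr_sqr ler_wsqrtr//.
have edotE (t : R) : edot (x - t *: y) (x - t *: y) =
    edot x x - 2 * t * edot x y + t ^+ 2 * edot y y.
  rewrite /edot !mulr_sumr -sumrB -big_split/=; apply: eq_bigr => i _.
  by rewrite !mxE; ring.
have := edot_ge0 (x - (edot x y / edot y y) *: y); rewrite edotE.
rewrite (_ : _ + _ = edot x x - edot x y ^+ 2 / edot y y); last by field.
by rewrite subr_ge0 ler_pdivrMr.
Qed.

(* The essential bound holds everywhere: a continuous field exceeding it at a
   point would exceed it on a box, which has positive measure. *)
Lemma test_fields_enorm_le1 Omega (phi : 'rV[R]_n -> 'rV[R]_n) : open Omega ->
  test_fields Omega phi -> forall x, edot (phi x) (phi x) <= 1.
Proof.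
move=> oO [[sphi cphi phiO] phi1] x0.
rewrite leNgt; apply/negP => phx.
have cphii i : continuous (fun x => phi x ord0 i).
  exact: smooth_continuous (smooth_coord i sphi).
have cedot : continuous (fun x => edot (phi x) (phi x)).
  by apply: continuous_sum_rV => i x; exact: (cvgM (cphii i x) (cphii i x)).
have Ox0 : Omega x0.
  apply: phiO; apply: subset_closure => /=; apply: contraTneq phx => ->.
  by rewrite -leNgt /edot big1// => i _; rewrite mxE mul0r.
pose A := Omega `&` [set x | 1 < edot (phi x) (phi x)].
have oA : open A.
  apply: openI => //; rewrite (_ : mkset _ = (fun x => edot (phi x) (phi x)) @^-1` `]1, +oo[%classic).
    by apply: open_comp => [x _|]; [exact: cedot|exact: interval_open].
  by apply/seteqP; split => x /=; rewrite in_itv/= andbT.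
have /nbhs_ballP[e /= e0 eA] : nbhs x0 A by exact: open_nbhs_nbhs.
pose B := [set x : 'rV[R]_n | forall i, `]x0 ord0 i - e, x0 ord0 i + e[%classic (x ord0 i)].
have BA : B `<=` A.
  move=> x Bx; apply: eA; split=> // i' i; rewrite ord1 /ball/=.
  have := Bx i; rewrite /= in_itv/= => /andP[? ?].
  by rewrite ltr_norml; apply/andP; split; lra.
have mB : measurable B.
  rewrite (_ : B = [set x : 'rV[R]_n | forall i,
      x0 ord0 i - e < x ord0 i < x0 ord0 i + e]); first exact: measurable_rV_itv.
  by apply/seteqP; split => x Bx i; have := Bx i; rewrite /= in_itv.
have leB : (0 < leb B)%E.
  rewrite (lebesgue_rV_box (A := fun i => `]x0 ord0 i - e, x0 ord0 i + e[%classic)) => [|i]; last exact: measurable_itv.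
  rewrite (eq_bigr (fun=> (e + e)%:E)); last first.
    move=> i _; rewrite lebesgue_measure_itv/= lte_fin ifT; last by lra.
    by rewrite -EFinB; congr EFin; ring.
  elim/big_ind : _ => //; first exact: mule_gt0.
  by move=> i _; rewrite lte_fin addr_gt0.
have leT : (0 < leb setT)%E by rewrite (lt_le_trans leB)// le_measure ?inE.
move: phi1; rewrite unlock /Lnorm leT => /ess_supP[N [mN N0 HN]].
have : (leb B <= leb N)%E.
  apply: le_measure; rewrite ?inE// => x Bx; apply: HN => /=.
  have [Ox x1] := BA _ Bx.
  rewrite patchE mem_set//= lee_fin ger0_norm ?sqrtr_ge0//.
  apply/negP; rewrite -ltNge -sqrtr1 /enorm ltr_sqrt//.
  exact: lt_trans x1.
by rewrite N0 leNgt leB.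
Qed.

End smooth_test_functions.

(** * The total variation measure *)

Section variation_measure_bounds.
Context {R : realType} {n : nat}.
Variable nu : radon R n.
Implicit Types U K A : set 'rV[R]_n.

Lemma enorm_ge0 (x : 'rV[R]_n) : 0 <= enorm x.
Proof. exact: sqrtr_ge0. Qed.

Lemma measurable_norm_rV : measurable_fun setT (fun x : 'rV[R]_n => `|x|).
Proof. by apply: continuous_measurable_rV; exact: norm_continuous. Qed.

(** The shells cut an unbounded set into bounded pieces, the only ones that [variation_measure]
    admits. *)
Definition norm_shell (j : nat) : set 'rV[R]_n := [set x | j%:R <= `|x| < j.+1%:R].

Lemma measurable_norm_shell j : measurable (norm_shell j).
Proof.
rewrite (_ : norm_shell j = setT `&` (fun x : 'rV[R]_n => `|x|) @^-1` `[j%:R, j.+1%:R[%classic).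
  by apply: measurable_norm_rV => //; exact: measurable_itv.
by rewrite setTI; apply/seteqP; split => x; rewrite /norm_shell/= in_itv.
Qed.

Lemma bounded_norm_shell A j : A `<=` norm_shell j -> bounded_set A.
Proof.
move=> Aj; exists j.+1%:R; split; first exact: num_real.
by move=> M jM x /Aj /andP[_ /ltW xj]; apply: (le_trans xj); exact: ltW.
Qed.

Lemma norm_shellP x : norm_shell (Num.truncn `|x|) x.
Proof. exact: truncn_itv. Qed.

Lemma norm_shell_inj i j x : norm_shell i x -> norm_shell j x -> i = j.
Proof.
by move=> /truncn_def <- /truncn_def <-.
Qed.

(** The finite family is completed to an admissible partition of [U]: the first [#|T|] indices carry
    the given sets, the others the remainder [V] cut along the norm shells. *)
Lemma finite_sum_le_variation (T : finType) (A : T -> set 'rV[R]_n) U :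
  measurable U -> (forall c, measurable (A c)) -> (forall c, bounded_set (A c)) ->
  (forall c c' x, A c x -> A c' x -> c = c') -> (forall c, A c `<=` U) ->
  ((\sum_c enorm (radon_val nu (A c)))%:E <= variation_measure nu U)%E.
Proof.
move=> mU mA bA tA AU; set N := #|T|.
pose V := U `\` \bigcup_(c in [set: T]) A c.
have mV : measurable V.
  by apply: measurableD => //; apply: fin_bigcup_measurable => // c _; exact: mA.
pose B k : set 'rV[R]_n :=
  if insub k is Some i then A (enum_val (i : 'I_N)) else V `&` norm_shell (k - N).
have BN k : (N <= k)%N -> B k = V `&` norm_shell (k - N).
  by move=> Nk; rewrite /B insubN// -leqNgt.
have Bi (i : 'I_N) : B i = A (enum_val i) by rewrite /B valK.
have B0 k : (0 <= (enorm (radon_val nu (B k)))%:E)%E by rewrite lee_fin enorm_ge0.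
apply: (@le_trans _ _ (\sum_(0 <= k <oo) (enorm (radon_val nu (B k)))%:E)%E).
  apply: (@le_trans _ _ (\sum_(0 <= k < N) (enorm (radon_val nu (B k)))%:E)%E).
    rewrite big_mkord sumEFin lee_fin (reindex_onto (@enum_val T predT) enum_rank)/=; last first.
      by move=> c _; exact: enum_rankK.
    rewrite (eq_bigl xpredT) => [|i]; last by rewrite enum_valK eqxx.
    by apply: ler_sum => i _; rewrite Bi.
  by apply: nneseries_lim_ge => k _ _.
apply: ereal_sup_ubound; exists B => //; split.
- move=> k; have [kN|Nk] := ltnP k N.
    by rewrite (Bi (Ordinal kN)).
  rewrite BN//; split; first by apply: measurableI => //; exact: measurable_norm_shell.
  by apply: (@bounded_norm_shell _ (k - N)) => x [].
- apply/trivIsetP => i j _ _ ij; apply/seteqP; split => // x [].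
  have [iN|Ni] := ltnP i N; have [jN|Nj] := ltnP j N.
  + rewrite (Bi (Ordinal iN)) (Bi (Ordinal jN)) => xi xj.
    by have /enum_val_inj[] := tA _ _ _ xi xj => /eqP; rewrite (negbTE ij).
  + by rewrite (Bi (Ordinal iN)) BN// => xi [[_ +] _]; apply; exists (enum_val (Ordinal iN)).
  + by rewrite (Bi (Ordinal jN)) BN// => -[[_ +] _] xj; apply; exists (enum_val (Ordinal jN)).
  + rewrite !BN// => -[_ xi] [_ xj]; have /eqP := norm_shell_inj xi xj.
    by rewrite -(eqn_add2r N) !subnK// (negbTE ij).
- apply/seteqP; split => [x [k _]|x Ux].
    have [kN|Nk] := ltnP k N; first by rewrite (Bi (Ordinal kN)) => /AU.
    by rewrite BN// => -[[]].
  have [[c _ xc]|xV] := pselect ((\bigcup_(c in [set: T]) A c) x).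
    by exists (enum_rank c) => //; rewrite Bi enum_rankK.
  exists (N + Num.truncn `|x|)%N => //; rewrite BN ?leq_addr// addKn.
  by split; [split|exact: norm_shellP].
Qed.

(** A supremum of nonnegative sums is nonnegative once some partition exists; completing the empty
    family provides one. *)
Lemma variation_measure_ge0 U : measurable U -> (0 <= variation_measure nu U)%E.
Proof.
move=> mU; have := @finite_sum_le_variation void (fun=> set0) U mU.
by rewrite big_pred0 => [|[]//]; apply => -[].
Qed.

Lemma compact_measurable_rV K : compact K -> measurable K.
Proof.
by move=> cK; apply: closed_measurable_rV; exact: compact_closed.
Qed.

Lemma Rintegral_sum d (T : measurableType d) (m : {measure set T -> \bar R})
    (I : finType) (f : I -> T -> R) :
  (forall i, m.-integrable setT (EFin \o f i)) ->
  m.-integrable setT (EFin \o (fun x => \sum_i f i x)) /\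
  \int[m]_x (\sum_i f i x) = \sum_i \int[m]_x f i x.
Proof.
move=> fI; have fE : EFin \o (fun x => \sum_i f i x) = (fun x => \sum_i (EFin \o f i) x)%E.
  by apply/funext => x; rewrite /= sumEFin.
split; first by rewrite fE; exact: integrable_sum.
rewrite /Rintegral -[X in integral _ _ X]/(EFin \o (fun x => \sum_i f i x)) fE.
rewrite (integral_sum measurableT fI) -sum_fine// => i _.
exact: (integrable_fin_num measurableT (fI i)).
Qed.

Lemma Rintegral_step_approx (m : {measure set 'rV[R]_n -> \bar R}) K (T : finType)
    (A : T -> set 'rV[R]_n) (f : 'rV[R]_n -> R) (v : T -> R) (e : R) :
  compact K -> (m K < +oo)%E -> measurable_fun setT f -> 0 <= e ->
  (forall c, measurable (A c)) -> (forall c, A c `<=` K) ->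
  m.-integrable setT (EFin \o f) ->
  (forall x, `|f x - \sum_c v c * \1_(A c) x| <= e * \1_K x) ->
  `|\int[m]_x f x - \sum_c v c * fine (m (A c))| <= e * fine (m K).
Proof.
move=> cK mKoo mf e0 mA AK fI fv.
have mK := compact_measurable_rV cK.
have mi c : measurable_fun setT (\1_(A c) : 'rV[R]_n -> R) by exact: measurable_indic.
have Aoo c : (m (A c) < +oo)%E by apply: le_lt_trans mKoo; rewrite le_measure ?inE.
have Ii c : m.-integrable setT (EFin \o (\1_(A c) : 'rV[R]_n -> R)).
  apply/integrableP; split; first exact/measurable_EFinP.
  under eq_integral do rewrite gee0_abs ?lee_fin//.
  by rewrite integral_indic// setIT.
have [sI sE] := @Rintegral_sum _ _ m _ (fun c x => v c * \1_(A c) x)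
  (fun c => integrableZl measurableT (v c) (Ii c)).
rewrite (eq_bigr (fun c => \int[m]_x (v c * \1_(A c) x))); last first.
  move=> c _; rewrite RintegralZl//; congr (_ * _).
  by rewrite /Rintegral integral_indic// setIT.
rewrite -sE -RintegralB//.
have [] // := @bounded_support_integrable _ _ _ m
  (fun x => f x - \sum_c v c * \1_(A c) x) e _ mK mKoo.
by apply: measurable_funB => //; apply: measurable_sum => c; exact: measurable_funM.
Qed.

(** Cut [K] into cells where each component of [psi] varies by at most [1/M]. On a cell, [psi] is
    nearly a vector [p c] of the unit ball, and Cauchy-Schwarz bounds the product of [p c] with the
    mass vector of the cell by the norm of that vector. The error is [1/M] times the total mass
    [lam] of the component measures on [K]. *)
Lemma sum_radon_int_le_variation K U (psi : 'I_n -> 'rV[R]_n -> R) :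
  compact K -> measurable U -> K `<=` U -> (forall i, continuous (psi i)) ->
  (forall i x, ~ K x -> psi i x = 0) -> (forall x, \sum_i psi i x ^+ 2 <= 1) ->
  ((\sum_i radon_int nu i (psi i))%:E <= variation_measure nu U)%E.
Proof.
move=> cK mU KU cpsi psiK psi1.
have mK := compact_measurable_rV cK.
have mpsi i : measurable_fun setT (psi i) by exact: continuous_measurable_rV.
have psi_le1 i x : -1 <= psi i x <= 1.
  have : psi i x ^+ 2 <= 1.
    by apply: le_trans (psi1 x); rewrite (bigD1 i)//= lerDl sumr_ge0// => j _; exact: sqr_ge0.
  by move=> h; apply/andP; split; nra.
pose lam := \sum_i (fine (radon_pos nu i K) + fine (radon_neg nu i K)).
have lam0 : 0 <= lam by apply: sumr_ge0 => i _; rewrite addr_ge0// fine_ge0.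
suff main m : ((\sum_i radon_int nu i (psi i))%:E <=
    variation_measure nu U + (m.+1%:R^-1 * lam)%:E)%E.
  apply/lee_addgt0Pr => e e0; pose m := Num.truncn (lam / e).
  apply: (le_trans (main m)); rewrite leeD2l// lee_fin ler_pdivrMl//.
  by rewrite -ler_pdivrMr// ltW// truncnS_gt.
pose M : R := m.+1%:R; have M0 : 0 < M by [].
have M0' := ltW M0.
(* The numbers [M (psi_i + 1)] lie in [[0, 2 M]] with the right end included, so [2 M + 1] integer
   parts occur. *)
pose T := {ffun 'I_n -> 'I_(2 * m.+1).+1}.
pose A (c : T) := K `&` [set x | forall i, (c i)%:R <= M * (psi i x + 1) < (c i).+1%:R].
have mA c : measurable (A c).
  apply: measurableI => //.
  rewrite (_ : mkset _ = \bigcap_(i in [set: 'I_n])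
      ((fun x => M * (psi i x + 1)) @^-1` `[(c i)%:R, (c i).+1%:R[%classic)).
    apply: fin_bigcap_measurable => // i _; rewrite -[X in measurable X]setTI.
    have : measurable_fun setT (fun x => M * (psi i x + 1)).
      by apply: measurable_funM => //; exact: measurable_funD.
    by apply => //; exact: measurable_itv.
  apply/seteqP; split => [x Ax i _|x Ax i]; first by rewrite /= in_itv/=; exact: Ax.
  by have := Ax i I; rewrite /= in_itv.
have Ainj c c' x : A c x -> A c' x -> c = c'.
  move=> [_ xc] [_ xc']; apply/ffunP => i; apply: val_inj => /=.
  by rewrite -(truncn_def (xc i)) -(truncn_def (xc' i)).
have Acov x : K x -> exists c, A c x.
  move=> Kx; exists [ffun i => inord (Num.truncn (M * (psi i x + 1)))]; split => // i.
  have /andP[p1 p2] := psi_le1 i x.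
  have P0 : 0 <= M * (psi i x + 1) by rewrite mulr_ge0//; lra.
  rewrite ffunE inordK ?truncn_itv// ltnS -(ler_nat R).
  rewrite (le_trans (_ : _ <= M * (psi i x + 1)))//; first by case/andP: (truncn_itv P0).
  by rewrite natrM -/M mulrC ler_wpM2r//; lra.
(* The representative is a value of [psi] on the cell, which keeps its Euclidean norm at most 1; the
   corner of the cell could exceed it. *)
have /choice[p Hp] : forall c, exists p : 'rV[R]_n,
    edot p p <= 1 /\ forall x, A c x -> forall i, `|psi i x - p ord0 i| <= M^-1.
  move=> c; have [[y Ay]|nA] := pselect (exists y, A c y).
    exists (\row_i psi i y); split.
      by rewrite (le_trans _ (psi1 y))//; apply: ler_sum => i _; rewrite !mxE expr2.
    move=> x [_ Ax] i; rewrite mxE.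
    have [_ /(_ i)/andP[y1 y2]] := Ay; have /andP[x1 x2] := Ax i.
    rewrite -[leRHS]mul1r ler_pdivlMr// -[X in _ * X](ger0_norm M0') -normrM.
    rewrite ler_norml; move: y1 y2 x1 x2; rewrite -natr1 => *.
    by apply/andP; split; nra.
  exists 0; split; first by rewrite /edot big1// => i _; rewrite mxE mul0r.
  by move=> x Ax; case: nA; exists x.
have stepE i x c : A c x -> \sum_c' p c' ord0 i * \1_(A c') x = p c ord0 i.
  move=> Ax; rewrite (bigD1 c)//= big1 ?addr0; last first.
    move=> c' cc'; rewrite indicE memNset ?mulr0//.
    by move=> Ax'; rewrite (Ainj _ _ _ Ax Ax') eqxx in cc'.
  by rewrite indicE mem_set// mulr1.
have approx i x : `|psi i x - \sum_c p c ord0 i * \1_(A c) x| <= M^-1 * \1_K x.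
  have [Kx|nKx] := pselect (K x).
    have [c Ax] := Acov x Kx; rewrite (stepE _ _ _ Ax) indicE mem_set// mulr1.
    by have [_] := Hp c; apply.
  rewrite psiK// big1 ?subr0 ?normr0 ?mulr_ge0 ?invr_ge0// => c _.
  by rewrite indicE memNset ?mulr0// => -[].
have psiI i (m' : {measure set 'rV[R]_n -> \bar R}) : (m' K < +oo)%E ->
    m'.-integrable setT (EFin \o psi i).
  move=> Koo; have [] // := @bounded_support_integrable _ _ _ m' (psi i) 1 _ mK Koo.
  move=> x; rewrite mul1r indicE; have [Kx|nKx] := pselect (K x).
    by rewrite mem_set// ler_norml.
  by rewrite memNset// psiK// normr0.
have Mi0 : 0 <= M^-1 by rewrite invr_ge0.
have AK c : A c `<=` K by move=> x [].
have S i := Rintegral_step_approx cK (radon_pos_fin nu i cK) (mpsi i) Mi0 mA AK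
  (psiI i _ (radon_pos_fin nu i cK)) (approx i).
have S' i := Rintegral_step_approx cK (radon_neg_fin nu i cK) (mpsi i) Mi0 mA AK
  (psiI i _ (radon_neg_fin nu i cK)) (approx i).
apply: (@le_trans _ _ ((\sum_c enorm (radon_val nu (A c)))%:E + (M^-1 * lam)%:E)%E); last first.
  rewrite leeD2r//; apply: finite_sum_le_variation => //.
  - move=> c; have [B [Br HB]] := compact_bounded cK.
    by exists B; split => // B' BB' x /AK; exact: HB.
  - by move=> c x /AK /KU.
rewrite -EFinD lee_fin.
apply: (@le_trans _ _ (\sum_i (\sum_c p c ord0 i * radon_val nu (A c) ord0 i +
    M^-1 * (fine (radon_pos nu i K) + fine (radon_neg nu i K))))).
  apply: ler_sum => i _; have := S i; have := S' i.
  rewrite /radon_int; set a := Rintegral _ _ _; set b := Rintegral _ _ _.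
  rewrite !ler_norml => /andP[h1 h2] /andP[h3 h4].
  have -> : \sum_c p c ord0 i * radon_val nu (A c) ord0 i =
      \sum_c p c ord0 i * fine (radon_pos nu i (A c)) -
      \sum_c p c ord0 i * fine (radon_neg nu i (A c)).
    by rewrite -sumrB; apply: eq_bigr => c _; rewrite mxE mulrBr.
  rewrite mulrDr; move: h1 h4 {h2 h3}.
  move: (M^-1 * fine (radon_neg nu i K)) (M^-1 * fine (radon_pos nu i K)) => X Y h1 h4.
  lra.
rewrite big_split/= -mulr_sumr lerD2r exchange_big/=; apply: ler_sum => c _.
rewrite -[leLHS]/(edot (p c) (radon_val nu (A c))) (le_trans (edot_cauchy_schwarz _ _))//.
rewrite -[leRHS]mul1r ler_wpM2r ?enorm_ge0// -sqrtr1 ler_wsqrtr//.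
by have [] := Hp c.
Qed.

End variation_measure_bounds.

(** * Variation of shrinking neighbourhoods *)

Section variation_nbhd.
Context {R : realType} {n : nat}.
Variable nu : radon R n.
Implicit Types U C A : set 'rV[R]_n.

Lemma edotD (x y : 'rV[R]_n) : edot (x + y) (x + y) = edot x x + 2 * edot x y + edot y y.
Proof.
rewrite /edot mulr_sumr -!big_split/=; apply: eq_bigr => i _.
by rewrite !mxE; ring.
Qed.

Lemma enormD (x y : 'rV[R]_n) : enorm (x + y) <= enorm x + enorm y.
Proof.
rewrite -(@ler_pXn2r _ 2%N)// ?nnegrE ?addr_ge0 ?enorm_ge0//.
rewrite sqr_sqrtr ?edot_ge0// edotD sqrrD !sqr_sqrtr ?edot_ge0//.
by rewrite lerD2r lerD2l -[leRHS]mulr_natl ler_wpM2l// edot_cauchy_schwarz.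
Qed.

Lemma enorm_le_sum (x : 'rV[R]_n) : enorm x <= \sum_i `|x ord0 i|.
Proof.
have S0 : 0 <= \sum_i `|x ord0 i| by apply: sumr_ge0.
rewrite -(ger0_norm S0) -sqrtr_sqr ler_wsqrtr// expr2 mulr_sumr.
apply: ler_sum => i _; rewrite -expr2 -real_normK ?num_real// expr2 ler_wpM2r//.
by rewrite (bigD1 i)//= lerDl sumr_ge0.
Qed.

Lemma norm_le_compact (M : R) : compact [set x : 'rV[R]_n | `|x| <= M].
Proof.
apply: bounded_closed_compact.
  exists M; split; first exact: num_real.
  by move=> M' MM' x /= xM; rewrite (le_trans xM)// ltW.
rewrite (_ : mkset _ = (fun x : 'rV[R]_n => `|x|) @^-1` [set y | y <= M])//.
by apply: closed_comp; [move=> x _; exact: norm_continuous|exact: closed_le].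
Qed.

(** A crude majorant of the variation; as a finite sum of measures it is continuous along decreasing
    sets of finite mass. *)
Definition radon_mass U : \bar R := (\sum_i (radon_pos nu i U + radon_neg nu i U))%E.

Lemma bounded_radon_fin i A : measurable A -> bounded_set A ->
  (radon_pos nu i A \is a fin_num) * (radon_neg nu i A \is a fin_num).
Proof.
move=> mA [M [Mr HM]].
have AM : A `<=` [set x | `|x| <= M + 1] by move=> x Ax; apply: HM => //; rewrite ltrDl.
have cM : compact [set x : 'rV[R]_n | `|x| <= M + 1] by exact: norm_le_compact.
have mM := compact_measurable_rV cM.
split; rewrite ge0_fin_numE//.
  by rewrite (le_lt_trans _ (radon_pos_fin nu i cM))// le_measure ?inE.
by rewrite (le_lt_trans _ (radon_neg_fin nu i cM))// le_measure ?inE.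
Qed.

Lemma enorm_radon_val_le A : measurable A -> bounded_set A ->
  ((enorm (radon_val nu A))%:E <= radon_mass A)%E.
Proof.
move=> mA bA; apply: (@le_trans _ _ (\sum_i `|radon_val nu A ord0 i|)%:E).
  by rewrite lee_fin enorm_le_sum.
rewrite -sumEFin; apply: lee_sum => i _; rewrite mxE.
have [pf nf] := bounded_radon_fin i mA bA.
rewrite -(fineK pf) -(fineK nf) -EFinD lee_fin (le_trans (ler_normB _ _))//.
by rewrite !ger0_norm// fine_ge0.
Qed.

Lemma radon_valD A C : measurable A -> bounded_set A -> measurable C ->
  radon_val nu A = radon_val nu (A `&` C) + radon_val nu (A `\` C).
Proof.
move=> mA bA mC; apply/rowP => i; rewrite !mxE.
have mAC : measurable (A `&` C) by exact: measurableI.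
have mAD : measurable (A `\` C) by exact: measurableD.
have sub B : B `<=` A -> bounded_set B.
  by move=> BA; case: bA => M [Mr HM]; exists M; split => // M' MM' x /BA; exact: HM.
have [pI nI] := bounded_radon_fin i mAC (sub _ (@subIsetl _ _ _)).
have [pD nD] := bounded_radon_fin i mAD (sub _ (@subDsetl _ _ _)).
have E (m : {measure set 'rV[R]_n -> \bar R}) : m A = (m (A `&` C) + m (A `\` C))%E.
  by rewrite -{1}(setUIDK A C) measureU//; apply/seteqP; split => // x [[_ Cx] [_]].
by rewrite !E !fineD//; ring.
Qed.

Lemma radon_mass_bigcup (F : nat -> set 'rV[R]_n) :
  (forall k, measurable (F k)) -> trivIset setT F ->
  (\sum_(0 <= k <oo) radon_mass (F k) = radon_mass (\bigcup_k F k))%E.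
Proof.
move=> mF tF.
have E (m : {measure set 'rV[R]_n -> \bar R}) :
    (\sum_(0 <= k <oo) m (F k) = m (\bigcup_k F k))%E.
  rewrite measure_bigcup//; apply: eq_eseriesl => k.
  by rewrite in_setT.
rewrite /radon_mass nneseries_sum//; last by move=> i j _; rewrite adde_ge0.
by apply: eq_bigr => i _; rewrite nneseriesD// !E.
Qed.

(** Every piece of a partition of [U] is cut along [C]: the parts inside partition [C], and those
    outside are bounded by [radon_mass], which is countably additive. *)
Lemma variation_measure_le_mass U C : measurable U -> measurable C -> C `<=` U ->
  (variation_measure nu U <= variation_measure nu C + radon_mass (U `\` C))%E.
Proof.
move=> mU mC CU; apply: ge_ereal_sup => _ [A [mbA tA AU] <-].
have mA k : measurable (A k) by have [] := mbA k.
have bA k : bounded_set (A k) by have [] := mbA k.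
have sub k B : B `<=` A k -> bounded_set B.
  by move=> BA; case: (bA k) => M [Mr HM]; exists M; split => // M' MM' x /BA; exact: HM.
apply: (@le_trans _ _ (\sum_(0 <= k <oo) ((enorm (radon_val nu (A k `&` C)))%:E +
    radon_mass (A k `\` C)))%E).
  apply: lee_nneseries => [k _ _|k _]; first by rewrite lee_fin enorm_ge0.
  have -> : radon_val nu (A k) = radon_val nu (A k `&` C) + radon_val nu (A k `\` C).
    exact: radon_valD.
  apply: (@le_trans _ _ ((enorm (radon_val nu (A k `&` C)))%:E +
     (enorm (radon_val nu (A k `\` C)))%:E)%E); first by rewrite -EFinD lee_fin enormD.
  rewrite leeD2l// enorm_radon_val_le//; first exact: measurableD.
  by apply: (sub k); exact: subDsetl.
rewrite nneseriesD//; last 2 first.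
- by move=> k _ _; rewrite lee_fin enorm_ge0.
- by move=> k _ _; apply: sume_ge0 => i _; rewrite adde_ge0.
apply: leeD.
  apply: ereal_sup_ubound; exists (fun k => A k `&` C) => //; split.
  - move=> k; split; first exact: measurableI.
    by apply: (sub k); exact: subIsetl.
  - by apply: trivIset_setIr.
  - by rewrite -setI_bigcupl AU setIidr.
rewrite radon_mass_bigcup.
- by rewrite -setD_bigcupl AU.
- by move=> k; exact: measurableD.
- apply/trivIsetP => i j _ _ ij; apply/seteqP; split => // x [[xi _] [xj _]].
  by move/trivIsetP : tA => /(_ i j I I ij) <-.
Qed.

(** The balls are those of the sup norm, hence cubes, so this set contains the Euclidean
    [r]-neighbourhood of [U]. *)
Definition ball_nbhd U (r : R) : set 'rV[R]_n := \bigcup_(w in U) ball w r.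

Lemma ball_nbhd_open U r : open (ball_nbhd U r).
Proof. by apply: bigcup_open => w _; exact: ball_open. Qed.

(** The neighbourhoods of radius [1/(k+1)] decrease to the closure, so what they have in excess of
    it decreases to the empty set and its mass tends to 0. *)
Lemma variation_measure_nbhd U (e : R) : bounded_set U -> 0 < e ->
  exists2 r, 0 < r &
    (variation_measure nu (ball_nbhd U r) <= variation_measure nu (closure U) + e%:E)%E.
Proof.
move=> bU e0; pose C := closure U.
have mC : measurable C by apply: closed_measurable_rV; exact: closed_closure.
pose F (k : nat) := ball_nbhd U k.+1%:R^-1 `\` C.
have mN k : measurable (ball_nbhd U k.+1%:R^-1).
  by apply: open_measurable_rV; exact: ball_nbhd_open.
have mF k : measurable (F k) by exact: measurableD.
have CN r : 0 < r -> C `<=` ball_nbhd U r.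
  move=> r0 x Cx; have [w [Uw xw]] := Cx _ (nbhsx_ballx x r r0).
  by exists w => //; exact: ball_sym.
have F0 : \bigcap_k F k = set0.
  apply/seteqP; split => // x xF.
  have nC : ~ C x by have [] := xF 0%N I.
  apply: nC => B /nbhs_ballP[r /= r0 rB].
  have [k kr] : exists k : nat, k.+1%:R^-1 < r.
    exists (Num.truncn r^-1); rewrite -[ltRHS]invrK ltf_pV2 ?posrE ?invr_gt0//.
    exact: truncnS_gt.
  have [[w Uw wx] _] := xF k I; exists w; split => //; apply: rB.
  by apply: ball_sym; apply: le_ball wx; exact: ltW.
(* Boundedness of [U] gives the first excess set finite mass, as continuity from above requires. *)
have bF : bounded_set (F 0%N).
  have [M [Mr HM]] := bU; exists (M + 2); split; first by rewrite num_real.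
  move=> M' MM' x [[w Uw]]; rewrite -ball_normE/= invr1 => wx _.
  rewrite -[x](subrK w) (le_trans (ler_normD _ _))// distrC.
  have := HM (M + 1) _ _ Uw; rewrite ltrDl ltr01 => /(_ isT).
  move: MM' wx => {HM mF F0 mN CN}.
  by move=> /=; move: `|w - x| `|w| => a b; lra.
have dF : {homo F : k l / (k <= l)%N >-> (l <= k)%O}.
  move=> k l kl; apply/subsetPset => x [[w Uw wx] nC]; split => //; exists w => //.
  by apply: le_ball wx; rewrite lef_pV2 ?posrE// ler_nat.
have cvgF (m : {measure set 'rV[R]_n -> \bar R}) : m (F 0%N) \is a fin_num ->
    m (F k) @[k --> \oo] --> 0%E.
  move=> mfin; rewrite -(measure0 m) -F0; apply: nonincreasing_cvg_mu => //.
    by rewrite ltey_eq mfin.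
  by rewrite F0.
have : radon_mass (F k) @[k --> \oo] --> (\sum_(i < n) (0 + 0) : \bar R)%E.
  apply: cvg_nnesum => i _; first by apply: nearW => k; rewrite adde_ge0.
  have [pf nf] := bounded_radon_fin i (mF 0%N) bF.
  by apply: cvgeD => //; exact: cvgF.
rewrite (eq_bigr (fun=> 0%E)) => [|i _]; last by rewrite adde0.
rewrite big1// => /fine_cvgP[fF] /cvgrPdist_le/(_ _ e0).
move=> /(filterI fF)[k _ /(_ k (leqnn k))] [kf ke].
exists k.+1%:R^-1 => //.
apply: (le_trans (variation_measure_le_mass (mN _) mC (CN _ _))) => //.
rewrite leeD2l// -(fineK kf) lee_fin.
by move: ke; rewrite /= sub0r normrN; apply: le_trans; exact: ler_norm.
Qed.

End variation_nbhd.

(** * Asymptotics of the constant *)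

Section fractional_constant.
Context {R : realType}.
Local Notation mu := (@lebesgue_measure R).

Lemma measurable_Gamma_integrand (s : R) D :
  measurable_fun D (fun t : R => t `^ (s - 1) * expR (- t)).
Proof.
apply: measurable_funTS; apply: measurable_funM; first exact: measurable_powR.
by apply: measurableT_comp => //; exact: measurable_funN.
Qed.

Lemma Gamma_integrand_ge0 (s t : R) : 0 <= t `^ (s - 1) * expR (- t).
Proof. by rewrite mulr_ge0 ?powR_ge0 ?expR_ge0. Qed.

(** [Gamma] is a real-valued integral, so it would be 0 if the integral diverged; finiteness has to
    be shown at each argument used. *)
Lemma Gamma_fineK (s : R) :
  (\int[mu]_(t in `]0%R, +oo[) (t `^ (s - 1) * expR (- t))%:E < +oo)%E ->
  ((Gamma s)%:E = \int[mu]_(t in `]0%R, +oo[) (t `^ (s - 1) * expR (- t))%:E)%E.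
Proof.
move=> soo; rewrite /Gamma /Rintegral fineK// ge0_fin_numE//.
by apply: integral_ge0 => t _; rewrite lee_fin Gamma_integrand_ge0.
Qed.

Lemma Gamma_halfnat (n : nat) :
  (\int[mu]_(t in `]0%R, +oo[) (t `^ (n%:R / 2 + 1 - 1) * expR (- t))%:E =
    (Num.sqrt pi ^+ n / eball_vol n)%:E)%E.
Proof. by have [_ _ <-] := @eball_volE R n; under eq_integral do rewrite addrK. Qed.

Lemma Gamma_halfnatE (n : nat) : Gamma (n%:R / 2 + 1) = Num.sqrt pi ^+ n / eball_vol n :> R.
Proof. by apply: EFin_inj; rewrite Gamma_fineK Gamma_halfnat// ltry. Qed.

Lemma powR_le_lincomb (y a : R) : 0 <= y -> 0 < a < 1 -> y `^ a <= (1 - a) + a * y.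
Proof.
move=> y0 /andP[a0 a1].
have a1' : 0 < 1 - a by rewrite subr_gt0.
have := @conjugate_powR R (y `^ a) 1 a^-1 (1 - a)^-1 (powR_ge0 _ _) ler01.
rewrite !invr_gt0 !invrK -powRrM mulfV ?gt_eqF// powRr1// powR1 mulr1 mul1r.
by move=> /(_ a0 a1'); rewrite addrC subrK => /(_ erefl); rewrite mulrC addrC.
Qed.

(** Young's inequality [t^(a/2) <= (1 - a) + a t^(1/2)] under the integral. The right side
    interpolates between two half-integer arguments, where finiteness is known from the ball
    volumes; as [a] tends to 1 only the value at [n/2 + 1] survives. *)
Lemma Gamma_convex (n : nat) (a : R) : (1 <= n)%N -> 0 < a < 1 ->
  Gamma ((n%:R + a + 1) / 2) <=
    (1 - a) * Gamma ((n.-1)%:R / 2 + 1) + a * Gamma (n%:R / 2 + 1).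
Proof.
case: n => // n _ a01; rewrite [_.-1]/=.
have /andP[a0 a1] := a01; have a1' : 0 <= 1 - a by rewrite subr_ge0 ltW.
have n1E : n.+1%:R = n%:R + 1 :> R by rewrite natr1.
have H : (\int[mu]_(t in `]0%R, +oo[) (t `^ ((n.+1%:R + a + 1) / 2 - 1) * expR (- t))%:E <=
    ((1 - a) * Gamma (n%:R / 2 + 1) + a * Gamma (n.+1%:R / 2 + 1))%:E)%E.
  have GE k : ((Gamma (k%:R / 2 + 1))%:E =
      \int[mu]_(t in `]0%R, +oo[) (t `^ (k%:R / 2 + 1 - 1) * expR (- t))%:E)%E.
    by rewrite Gamma_fineK// Gamma_halfnat ltry.
  rewrite EFinD 2!EFinM (GE n) (GE n.+1).
  have mG s : measurable_fun (`]0%R, +oo[%classic : set R) (fun t : R => (t `^ (s - 1) * expR (- t))%:E).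
    by apply/measurable_EFinP; exact: measurable_Gamma_integrand.
  rewrite -!ge0_integralZl//;
    try by [move=> t _; rewrite lee_fin Gamma_integrand_ge0|rewrite lee_fin ltW|exact: mG].
  rewrite -ge0_integralD//;
    try by [move=> t _; rewrite mule_ge0 ?lee_fin ?Gamma_integrand_ge0// ltW
           |apply: measurable_funeM; exact: mG].
  apply: ge0_le_integral => //.
  - by move=> t _; rewrite lee_fin Gamma_integrand_ge0.
  - exact: mG.
  - by apply: emeasurable_funD; apply: measurable_funeM; exact: mG.
  move=> t; rewrite /= in_itv/= andbT => t0.
  rewrite -!EFinM -EFinD lee_fin.
  pose y := t `^ (2^-1).
  have -> : (n.+1%:R + a + 1) / 2 - 1 = n%:R / 2 + 2^-1 * a by rewrite n1E; field.
  rewrite gt0_powRD// (powRrM t 2^-1 a) -/y.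
  have -> : n%:R / 2 + 1 - 1 = n%:R / 2 :> R by ring.
  have -> : n.+1%:R / 2 + 1 - 1 = n%:R / 2 + 2^-1 :> R by rewrite n1E; field.
  rewrite gt0_powRD// -/y.
  have -> : (1 - a) * (t `^ (n%:R / 2) * expR (- t)) + a * (t `^ (n%:R / 2) * y * expR (- t)) =
     t `^ (n%:R / 2) * ((1 - a) + a * y) * expR (- t) by ring.
  rewrite ler_wpM2r ?expR_ge0// ler_wpM2l ?powR_ge0//.
  by rewrite powR_le_lincomb ?powR_ge0.
by rewrite -lee_fin Gamma_fineK// (le_lt_trans H)// ltry.
Qed.

(** Keep only [t < a], where [exp(-t) >= exp(-a)]. This captures the blow-up [1/e] of Gamma at 0 up
    to a factor tending to [exp(-a)] with [e], and [a] is at choice. *)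
Lemma Gamma_small_ge (e a : R) : 0 < e < 1 -> 0 < a ->
  expR (- a) * (a `^ e / e) <= Gamma e.
Proof.
move=> /andP[e0 e1] a0.
have mG D : measurable_fun D (fun t : R => (t `^ (e - 1) * expR (- t))%:E).
  by apply/measurable_EFinP; exact: measurable_Gamma_integrand.
have Goo : (\int[mu]_(t in `]0%R, +oo[) (t `^ (e - 1) * expR (- t))%:E < +oo)%E.
  apply: (@le_lt_trans _ _ (\int[mu]_(t in `]0%R, +oo[)
    (power_pieces e 1 1 1 1 t + expR (- t))%:E)%E).
    apply: ge0_le_integral => //.
    - by move=> t _; rewrite lee_fin Gamma_integrand_ge0.
    - exact: mG.
    - apply/measurable_EFinP; apply: measurable_funTS; apply: measurable_funD.
        exact: measurable_power_pieces.
      by apply: measurableT_comp => //; exact: measurable_funN.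
    move=> t; rewrite /= in_itv/= andbT => t0; rewrite lee_fin /power_pieces.
    case: ltP => t1.
      rewrite mul1r -[leLHS]addr0 lerD ?expR_ge0// -[leRHS]mulr1 ler_wpM2l ?powR_ge0//.
      by rewrite -expR0 ler_expR oppr_le0 ltW.
    rewrite -[leLHS]add0r lerD ?mulr_ge0 ?powR_ge0// -[leRHS]mul1r ler_wpM2r ?expR_ge0//.
    have : t `^ (e - 1) <= t `^ 0 by rewrite ler_powR// subr_le0 ltW.
    by rewrite powRr0.
  under eq_integral do rewrite EFinD.
  rewrite ge0_integralD//; last 3 first.
  - by move=> t _; rewrite lee_fin power_pieces_ge0.
  - by apply/measurable_EFinP; apply: measurable_funTS; exact: measurable_power_pieces.
  - apply/measurable_EFinP; apply: measurable_funTS.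
    by apply: measurableT_comp => //; exact: measurable_funN.
  by rewrite integral_power_pieces// integral_expRN_gt -EFinD ltry.
rewrite -lee_fin Gamma_fineK// EFinM -integral_powR_lt// -ge0_integralZl//; last 2 first.
- by apply/measurable_EFinP; apply: measurable_funTS; exact: measurable_powR.
- by move=> t _; rewrite lee_fin powR_ge0.
apply: (@le_trans _ _ (\int[mu]_(t in `]0%R, a[) (t `^ (e - 1) * expR (- t))%:E)%E).
  apply: ge0_le_integral => //.
  - by move=> t _; rewrite mule_ge0// lee_fin ?expR_ge0 ?powR_ge0.
  - by apply: measurable_funeM; apply/measurable_EFinP; apply: measurable_funTS; exact: measurable_powR.
  - exact: mG.
  move=> t; rewrite /= in_itv/= => /andP[t0 ta].
  by rewrite -EFinM lee_fin mulrC ler_wpM2l ?powR_ge0// ler_expR lerN2 ltW.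
apply: ge0_subset_integral => //; first exact: mG.
- by move=> t _; rewrite lee_fin Gamma_integrand_ge0.
- by move=> t; rewrite /= !in_itv/= andbT => /andP[].
Qed.

Lemma continuous_powRr (a : R) : 0 < a -> continuous (fun s : R => a `^ s).
Proof.
move=> a0 s; rewrite /powR gt_eqF//.
apply: (@continuous_comp _ _ _ (fun s : R => s * ln a) expR); last exact: continuous_expR.
by apply: cvgMl; exact: cvg_id.
Qed.

Variable n : nat.
Hypothesis n_ge1 : (1 <= n)%N.

(* The coefficient of [V] in [kernel_integral_le], times [frac_const]. *)
Definition main_coef (c alpha : R) : R :=
  @frac_const R n alpha * ((n%:R + alpha + 1) / 2 * ((n%:R + alpha + 1) / 2 + 1)) *
  eball_vol n * (c `^ ((1 - alpha) / 2) / ((1 - alpha) / 2)) /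
  (2 * (n%:R / 2 + 1) * (n%:R / 2 + 2)).

Lemma frac_const_ge0 alpha : 0 <= @frac_const R n alpha.
Proof.
by rewrite /frac_const divr_ge0 ?mulr_ge0 ?powR_ge0//;
  apply: Rintegral_ge0 => t _; exact: Gamma_integrand_ge0.
Qed.

(** [main_coef] with its two [alpha]-dependent values of Gamma estimated by [Gamma_convex] and
    [Gamma_small_ge]: the poles in [(1 - alpha)/2] have cancelled and what remains is continuous at
    [alpha = 1]. *)
Let bound (c a alpha : R) : R :=
  2 `^ alpha * pi `^ (- (n%:R / 2)) *
  ((1 - alpha) * Gamma ((n.-1)%:R / 2 + 1) + alpha * Gamma (n%:R / 2 + 1)) *
  (expR a / a `^ ((1 - alpha) / 2)) *
  ((n%:R + alpha + 1) / 2 * ((n%:R + alpha + 1) / 2 + 1)) *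
  eball_vol n * c `^ ((1 - alpha) / 2) / (2 * (n%:R / 2 + 1) * (n%:R / 2 + 2)).

Let main_coef_le c a alpha : 0 < a -> 0 < alpha < 1 -> main_coef c alpha <= bound c a alpha.
Proof.
move=> a0 /[dup] alpha01 /andP[al0 al1].
set e := (1 - alpha) / 2.
have e0 : 0 < e by rewrite /e; lra.
have e1 : e < 1 by rewrite /e; lra.
have [_ vol0 _] := @eball_volE R n.
have G0 := Gamma_small_ge (introT andP (conj e0 e1)) a0.
have G1 := Gamma_convex n_ge1 alpha01.
have lb0 : 0 < expR (- a) * (a `^ e / e).
  by rewrite mulr_gt0 ?expR_gt0// divr_gt0// powR_gt0.
have Ge0 : 0 < Gamma e := lt_le_trans lb0 G0.
have s0 : 0 <= (n%:R + alpha + 1) / 2 by rewrite divr_ge0// !addr_ge0// ltW.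
rewrite /main_coef /bound -/e ler_wpM2r ?invr_ge0 ?mulr_ge0 ?addr_ge0//.
rewrite /frac_const -/e.
have Gp : 0 <= Gamma ((n%:R + alpha + 1) / 2).
  by apply: Rintegral_ge0 => t _; exact: Gamma_integrand_ge0.
have P0 : 0 <= 2 `^ alpha * pi `^ (- (n%:R / 2)) by rewrite mulr_ge0 ?powR_ge0.
have S0 : 0 <= (n%:R + alpha + 1) / 2 * ((n%:R + alpha + 1) / 2 + 1).
  by rewrite mulr_ge0// addr_ge0.
move: (Gamma e) G0 Ge0 {lb0} => Ge G0 Ge0.
move: (Gamma ((n%:R + alpha + 1) / 2)) (_ + alpha * Gamma _) G1 Gp => G Gb G1 Gp.
move: (2 `^ alpha * _) (_ / 2 * (_ / 2 + 1)) P0 S0 => P S P0 S0.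
have -> : P * G / Ge * S * eball_vol n * (c `^ e / e) =
  (P * S * eball_vol n * c `^ e) * (G * (Ge * e)^-1).
  by field; rewrite !gt_eqF.
have -> : P * Gb * (expR a / a `^ e) * S * eball_vol n * c `^ e =
  (P * S * eball_vol n * c `^ e) * (Gb * (expR a / a `^ e)) by ring.
rewrite ler_wpM2l//; first by rewrite mulr_ge0 ?powR_ge0// mulr_ge0 ?(ltW vol0)// mulr_ge0.
have Gee : 0 < Ge * e by rewrite mulr_gt0.
have q0 : 0 < expR a / a `^ e by rewrite divr_gt0 ?expR_gt0 ?powR_gt0.
have H : (Ge * e)^-1 <= expR a / a `^ e.
  rewrite -[leRHS]invrK lef_pV2 ?posrE ?invr_gt0//.
  rewrite -ler_pdivrMr// (le_trans _ G0)// expRN.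
  by rewrite le_eqVlt; apply/orP; left; apply/eqP; field; rewrite !gt_eqF ?expR_gt0 ?powR_gt0.
by apply: ler_pM => //; rewrite invr_ge0 ltW.
Qed.

Lemma main_coef_lim (c eta : R) : 0 < c -> 0 < eta ->
  \forall alpha \near (1 : R)^'-, main_coef c alpha <= 1 + eta.
Proof.
move=> c0 eta0.
have h0 : 0 < 1 + eta / 2 by rewrite addr_gt0// divr_gt0.
(* The limit of [bound] is [exp a]; this [a] makes it [1 + eta/2], strictly below the target. *)
pose a := ln (1 + eta / 2).
have a0 : 0 < a by rewrite ln_gt0// ltrDl divr_gt0.
have [_ vol0 _] := @eball_volE R n.
have e_cvg : (1 - alpha) / 2 @[alpha --> (1 : R)] --> (0 : R).
  have : (1 - alpha) / 2 @[alpha --> (1 : R)] --> ((1 - 1) / 2 : R).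
    by apply: cvgMl; apply: cvgB; [exact: cvg_cst|exact: cvg_id].
  by rewrite subrr mul0r.
have pow_cvg b : 0 < b -> b `^ ((1 - alpha) / 2) @[alpha --> (1 : R)] --> (1 : R).
  move=> b0; rewrite -[X in _ --> X](powRr0 b).
  by apply: (@cvg_comp _ _ _ (fun alpha : R => (1 - alpha) / 2) (fun s => b `^ s)) e_cvg _; exact: continuous_powRr.
have s_cvg : (n%:R + alpha + 1) / 2 @[alpha --> (1 : R)] --> ((n%:R + 1 + 1) / 2 : R).
  apply: cvgMl; apply: cvgD; last exact: cvg_cst.
  by apply: cvgD; [exact: cvg_cst|exact: cvg_id].
have B : bound c a alpha @[alpha --> (1 : R)] -->
    (2 `^ 1 * pi `^ (- (n%:R / 2)) *
      ((1 - 1) * Gamma ((n.-1)%:R / 2 + 1) + 1 * Gamma (n%:R / 2 + 1)) *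
      (expR a / 1) * ((n%:R + 1 + 1) / 2 * ((n%:R + 1 + 1) / 2 + 1)) *
      eball_vol n * 1 / (2 * (n%:R / 2 + 1) * (n%:R / 2 + 2))).
  apply: cvgMl; apply: cvgM; last exact: pow_cvg.
  apply: cvgMl; apply: cvgM; last first.
    by apply: cvgM => //; apply: cvgD => //; exact: cvg_cst.
  apply: cvgM; last first.
    apply: cvgMr; apply: cvgV; first exact: oner_neq0.
    exact: pow_cvg.
  apply: cvgM; first by apply: cvgMl; exact: continuous_powRr.
  apply: cvgD; first by apply: cvgMl; apply: cvgB; [exact: cvg_cst|exact: cvg_id].
  by apply: cvgMl; exact: cvg_id.
move: B; set l := (X in _ --> X).
(* All factors but [exp a] cancel because Gamma at [n/2 + 1] is [sqrt(pi)^n / eball_vol n]; the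
   factor [2^1] meets the 2 in the denominator. *)
have -> : l = expR a.
  rewrite /l (Gamma_halfnatE n) powRr1//.
  have -> : (pi : R) `^ (- (n%:R / 2)) = (Num.sqrt pi ^+ n)^-1.
    by rewrite powRN mulrC powRrM powR12_sqrt ?pi_ge0// powR_mulrn ?sqrtr_ge0.
  have p0 : 0 < Num.sqrt (pi : R) ^+ n by rewrite exprn_gt0// sqrtr_gt0 pi_gt0.
  have n0 : 0 <= n%:R :> R by [].
  move: (Num.sqrt (pi : R) ^+ n) p0 (n%:R : R) n0 (Gamma _) (expR a) => P p0 N n0 G E.
  field; rewrite !gt_eqF//=; lra.
rewrite lnK ?posrE// => B.
have {}B : bound c a alpha @[alpha --> (1 : R)^'-] --> (1 + eta / 2).
  exact: cvg_at_left_filter.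
have H : \forall alpha \near (1 : R)^'-, bound c a alpha <= 1 + eta.
  by apply: (cvgr_le _ B); lra.
near=> alpha.
have al1 : alpha < 1 by near: alpha; exact: nbhs_left_lt.
have al0 : 0 < alpha by near: alpha; apply: nbhs_left_gt.
apply: (@le_trans _ _ (bound c a alpha)); first by apply: main_coef_le => //; rewrite al0.
by near: alpha.
Unshelve. all: by end_near. Qed.

End fractional_constant.

(** * The pairing with the fractional divergence *)

Section smoothing_by_translates.
Context {R : realType} {n : nat}.
Local Notation leb := (lebesgue_rV n : {sigma_finite_measure set 'rV[R]_n -> \bar R}).

Lemma RintegralN d (T : measurableType d) (m : {measure set T -> \bar R}) (f : T -> R) :
  m.-integrable setT (EFin \o f) -> \int[m]_x (- f x) = - \int[m]_x f x.
Proof.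
by move=> fI; under eq_Rintegral do rewrite -mulN1r; rewrite RintegralZl// mulN1r.
Qed.

Lemma lipschitz_coord_continuous (F : 'rV[R]_n -> R) (L : R) : 0 <= L ->
  (forall x z, `|F (x + z) - F x| <= L * \sum_i `|z ord0 i|) -> continuous F.
Proof.
move=> L0 HF x; apply/(@cvgrPdist_le _ _ _ (nbhs x) (nbhs_filter x)) => e e0.
have K0 : 0 < L * n%:R + 1 by rewrite ltr_wpDl// mulr_ge0.
near=> y.
have : ball x (e / (L * n%:R + 1)) y.
  by near: y; apply: nbhsx_ballx; rewrite divr_gt0.
rewrite /ball/= => -[_ xy].
have := HF x (y - x); rewrite (addrC x) subrK => HFy.
rewrite distrC (le_trans HFy)//.
have : \sum_i `|(y - x) ord0 i| <= \sum_(i < n) e / (L * n%:R + 1).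
  by apply: ler_sum => i _; rewrite !mxE distrC ltW// xy.
rewrite sumr_const card_ord -[X in _ <= X]mulr_natr => H.
rewrite (le_trans (ler_wpM2l L0 H))//.
rewrite [leLHS](_ : _ = L * n%:R * e / (L * n%:R + 1)); last by ring.
rewrite ler_pdivrMr// mulrDr mulr1 mulrC lerDl.
exact: ltW.
Unshelve. all: by end_near. Qed.

Variable g : 'rV[R]_n -> R.
Hypothesis gI : L1 g.

Let mg : measurable_fun setT g.
Proof. by have /integrableP[/measurable_EFinP] := gI. Qed.

Definition L1norm : R := \int[leb]_x `|g x|.

Let normgI : leb.-integrable setT (EFin \o (fun x => `|g x|)).
Proof. exact: (integrable_norm gI). Qed.

Lemma L1norm_ge0 : 0 <= L1norm.
Proof. exact: Rintegral_ge0. Qed.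

Lemma L1_mul_bounded (F : 'rV[R]_n -> R) (A : R) : measurable_fun setT F ->
  (forall x, `|F x| <= A) ->
  leb.-integrable setT (EFin \o (fun x => g x * F x)) /\
  `|\int[leb]_x (g x * F x)| <= A * L1norm.
Proof.
move=> mF FA.
have gFI : leb.-integrable setT (EFin \o (fun x => g x * F x)).
  apply: (le_integrable measurableT _ _ (integrableZl measurableT A normgI)).
    by apply/measurable_EFinP; exact: measurable_funM.
  move=> x _; rewrite /= lee_fin normrM mulrC.
  rewrite [leRHS]ger0_norm ?ler_wpM2r// mulr_ge0//.
  exact: le_trans (FA x).
split => //; apply: (le_trans (le_normr_Rintegral _ gFI)) => //.
rewrite /L1norm -RintegralZl//; apply: le_Rintegral => //.
- exact: (integrable_norm gFI).
- exact: (integrableZl measurableT A normgI).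
- by move=> x _; rewrite normrM mulrC ler_wpM2r.
Qed.

Definition translate_int (psi : 'rV[R]_n -> R) (z : 'rV[R]_n) : R :=
  \int[leb]_x (g x * psi (x + z)).

Section one_test_function.
Variables (Omega : set 'rV[R]_n) (psi : 'rV[R]_n -> R).
Hypothesis cpsi : Cc_smooth R Omega psi.

Lemma Cc_smooth_measurable : measurable_fun setT psi.
Proof.
by apply: continuous_measurable_rV; apply: smooth_continuous; have [] := cpsi.
Qed.

Let mpsi z : measurable_fun setT (fun x : 'rV[R]_n => psi (x + z)).
Proof. exact: (measurableT_comp Cc_smooth_measurable (measurable_rV_shift z)). Qed.

Lemma translate_int_integrable z :
  leb.-integrable setT (EFin \o (fun x : 'rV[R]_n => g x * psi (x + z))).
Proof.
have [A A0 HA] := Cc_smooth_bounded cpsi.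
by have [] := L1_mul_bounded (mpsi z) (fun x => HA (x + z)).
Qed.

Lemma translate_int_continuous : continuous (translate_int psi).
Proof.
have [L [M [L0 M0 HL HM]]] := Cc_smooth_taylor cpsi.
apply: (@lipschitz_coord_continuous _ (L * L1norm)); first by rewrite mulr_ge0// L1norm_ge0.
move=> z w; rewrite /translate_int -RintegralB//; try exact: translate_int_integrable.
under eq_Rintegral do rewrite -mulrBr.
have [] := @L1_mul_bounded (fun x : 'rV[R]_n => psi (x + (z + w)) - psi (x + z)) (L * \sum_i `|w ord0 i|).
- exact: measurable_funB.
- by move=> x; rewrite addrA; exact: lipschitz_coord_sum.
- by move=> _ /le_trans; apply; rewrite mulrAC.
Qed.

End one_test_function.

(** Regularity in [z] is inherited from [psi]: the uniform remainder bound is integrated against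
    [g], of which only the [L1] norm enters. *)
Lemma translate_int_taylor Omega psi M i : Cc_smooth R Omega psi ->
  (forall x t, `|psi (x + t *: delta_mx ord0 i) - psi x - t * partial i psi x| <= M * t ^+ 2) ->
  forall z t, `|translate_int psi (z + t *: delta_mx ord0 i) - translate_int psi z -
    t * translate_int (partial i psi) z| <= M * L1norm * t ^+ 2.
Proof.
move=> cpsi HM z t; have cp := Cc_smooth_partial i cpsi.
have I1 := translate_int_integrable cpsi; have I2 := translate_int_integrable cp.
rewrite /translate_int -RintegralB// -RintegralZl// -RintegralB//; last 2 first.
- exact: (integrableB measurableT (I1 _) (I1 _)).
- exact: (integrableZl measurableT t (I2 z)).
have E (x : 'rV[R]_n) : g x * psi (x + (z + t *: delta_mx ord0 i)) - g x * psi (x + z) -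
    t * (g x * partial i psi (x + z)) =
    g x * (psi (x + z + t *: delta_mx ord0 i) - psi (x + z) - t * partial i psi (x + z)).
  by rewrite addrA; ring.
under eq_Rintegral do rewrite E.
have mp z' := measurableT_comp (Cc_smooth_measurable cpsi) (measurable_rV_shift z').
have mp' z' := measurableT_comp (Cc_smooth_measurable cp) (measurable_rV_shift z').
have [] := @L1_mul_bounded (fun x : 'rV[R]_n => psi (x + z + t *: delta_mx ord0 i) - psi (x + z) -
  t * partial i psi (x + z)) (M * t ^+ 2).
- apply: measurable_funB; last by apply: measurable_funM => //; exact: mp'.
  apply: measurable_funB; last exact: mp.
  by have := mp (z + t *: delta_mx ord0 i); under eq_fun do rewrite /= addrA.
- by move=> x; exact: HM.
- by move=> _ /le_trans; apply; rewrite mulrAC.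
Qed.

End smoothing_by_translates.

(** * Increments of a test field and its fractional divergence *)

Section fractional_divergence_estimate.
Context {R : realType} {n : nat}.
Local Notation leb := (lebesgue_rV n : {sigma_finite_measure set 'rV[R]_n -> \bar R}).
Variables (Omega : set 'rV[R]_n) (phi : 'rV[R]_n -> 'rV[R]_n).
Hypotheses (oO : open Omega) (tphi : test_fields Omega phi).

(** Numerator in [frac_div] after the substitution [y = x + z]. *)
Definition increment (x z : 'rV[R]_n) : R := edot z (phi (x + z) - phi x).

Let cphi i : Cc_smooth R Omega (fun x => phi x ord0 i).
Proof. by apply: Cc_smooth_coord; have [] := tphi. Qed.

Let mphi i : measurable_fun setT (fun x : 'rV[R]_n => phi x ord0 i).
Proof. exact: Cc_smooth_measurable (cphi i). Qed.

Let phi1 x : enorm (phi x) <= 1.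
Proof. by rewrite -sqrtr1 ler_wsqrtr//; exact: (test_fields_enorm_le1 oO tphi). Qed.

Lemma increment_le_far x z : `|increment x z| <= 2 * Num.sqrt (edot z z).
Proof.
have E (y : 'rV[R]_n) : edot z y <= enorm z * enorm y by exact: edot_cauchy_schwarz.
have EN (y : 'rV[R]_n) : enorm (- y) = enorm y.
  by rewrite /enorm /edot; congr Num.sqrt; apply: eq_bigr => i _; rewrite !mxE mulrNN.
have N2 : enorm (phi (x + z) - phi x) <= 2.
  by rewrite (le_trans (enormD _ _))// EN (_ : 2 = 1 + 1)// lerD.
have edotN y : edot z (- y) = - edot z y.
  by rewrite /edot -sumrN; apply: eq_bigr => i _; rewrite !mxE mulrN.
rewrite mulrC ler_norml lerNl -edotN; apply/andP; split.
  by rewrite (le_trans (E _))// EN ler_wpM2l// enorm_ge0.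
by rewrite (le_trans (E _))// ler_wpM2l// enorm_ge0.
Qed.

(** Both [z] and the difference of [phi] contribute a factor controlled by the sum of the [|z_i|],
    which is at most [n |z|]. The constant depends on [phi] but is uniform in [x]. *)
Lemma increment_le_near : exists2 L, 0 <= L &
  forall x z, `|increment x z| <= L * edot z z.
Proof.
have /choice[L HL] : forall i, exists L, 0 <= L /\
    forall x z, `|phi (x + z) ord0 i - phi x ord0 i| <= L * \sum_i `|z ord0 i|.
  move=> i; have [L [M [L0 M0 HL _]]] := Cc_smooth_taylor (cphi i).
  by exists L; split => // x z; exact: (lipschitz_coord_sum HL).
pose LL := \sum_i L i.
have LL0 : 0 <= LL by apply: sumr_ge0 => i _; have [] := HL i.
exists (LL * n%:R ^+ 2); first by rewrite mulr_ge0// exprn_ge0.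
move=> x z; pose S := \sum_i `|z ord0 i|.
have S0 : 0 <= S by exact: sumr_ge0.
apply: (@le_trans _ _ (\sum_i `|z ord0 i| * (LL * S))).
  rewrite (le_trans (ler_norm_sum _ _ _))//; apply: ler_sum => i _.
  rewrite normrM ler_wpM2l// !mxE; have [_ HLi] := HL i.
  rewrite (le_trans (HLi _ _))// ler_wpM2r// /LL (bigD1 i)//= lerDl.
  by apply: sumr_ge0 => j _; have [] := HL j.
rewrite -mulr_suml -/S mulrCA -mulrA ler_wpM2l//.
have := sum_coord_le z; rewrite -/S => SE.
rewrite (le_trans (ler_pM S0 S0 SE SE))// mulrACA -!expr2 sqr_sqrtr ?edot_ge0//.
Qed.

Lemma measurable_increment :
  measurable_fun setT (fun p : 'rV[R]_n * 'rV[R]_n => increment p.1 p.2).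
Proof.
apply: measurable_sum => i; apply: measurable_funM.
  exact: (measurableT_comp (measurable_rV_coord i)).
under eq_fun do rewrite !mxE; apply: measurable_funB.
  exact: (measurableT_comp (mphi i) (@measurable_rV_add R n)).
exact: (measurableT_comp (mphi i)).
Qed.

Lemma measurable_enorm_powR (b : R) : measurable_fun setT (fun z : 'rV[R]_n => enorm z `^ b).
Proof.
rewrite (_ : (fun z => _) = (fun z => edot z z `^ (b / 2))).
  exact: (measurableT_comp (measurable_powR _) (@measurable_edot R n)).
by apply/funext => z; exact: enorm_powR.
Qed.

Variable alpha : R.
Hypothesis alpha01 : 0 < alpha < 1.
Let b := n%:R + alpha + 1.

Lemma frac_divE x : frac_div alpha phi x =
  @frac_const R n alpha * \int[leb]_z (increment x z / enorm z `^ b).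
Proof.
pose f y := edot (y - x) (phi y - phi x) / enorm (y - x) `^ b.
have mf : measurable_fun setT f.
  apply: measurable_funM.
    apply: measurable_sum => i; apply: measurable_funM.
      exact: (measurableT_comp (measurable_rV_coord i) (measurable_rV_shift (- x))).
    by under eq_fun do rewrite !mxE; apply: measurable_funB.
  under eq_fun do rewrite -powRN.
  exact: (measurableT_comp (measurable_enorm_powR _) (measurable_rV_shift (- x))).
have fE : (\int[leb]_y (f y)%:E = \int[leb]_z (increment x z / enorm z `^ b)%:E)%E.
  have /measurable_EFinP mfE := mf.
  rewrite (integral_rV_shift x mfE); apply: eq_integral => z _.
  by rewrite /= /f addrK /increment (addrC z x).
rewrite -[LHS]/(@frac_const R n alpha * fine (\int[leb]_y (f y)%:E)) fE.
by [].
Qed.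

End fractional_divergence_estimate.

(** * The estimate for a fixed exponent and a fixed test field *)

Section main_estimate.
Context {R : realType} {n : nat}.
Local Notation leb := (lebesgue_rV n : {sigma_finite_measure set 'rV[R]_n -> \bar R}).
Variables (Omega : set 'rV[R]_n) (phi : 'rV[R]_n -> 'rV[R]_n).
Hypotheses (oO : open Omega) (tphi : test_fields Omega phi).
Variable alpha : R.
Hypothesis alpha01 : 0 < alpha < 1.
Variable g : 'rV[R]_n -> R.
Hypothesis gI : L1 g.

Let b := n%:R + alpha + 1.
Let K (z : 'rV[R]_n) : R := (enorm z `^ b)^-1.

Let mg : measurable_fun setT g.
Proof. by have /integrableP[/measurable_EFinP] := gI. Qed.

Let mK : measurable_fun setT K.
Proof.
rewrite /K; under eq_fun do rewrite -powRN.
exact: measurable_enorm_powR.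
Qed.

Let K0 z : 0 <= K z. Proof. by rewrite invr_ge0 powR_ge0. Qed.

Definition averaged_increment (z : 'rV[R]_n) : R := \int[leb]_x (g x * increment phi x z).

Let cphi i : Cc_smooth R Omega (fun x => phi x ord0 i).
Proof. by apply: Cc_smooth_coord; have [] := tphi. Qed.

Let mphi i : measurable_fun setT (fun x : 'rV[R]_n => phi x ord0 i).
Proof. exact: Cc_smooth_measurable (cphi i). Qed.

Let minc := measurable_increment tphi.

Let minc1 z : measurable_fun setT (fun x => increment phi x z).
Proof. exact: (measurableT_comp minc (measurable_pair2 z)). Qed.

Let minc2 x : measurable_fun setT (increment phi x).
Proof. exact: (measurableT_comp minc (measurable_pair1 x)). Qed.

Lemma averaged_increment_le_far z :
  `|averaged_increment z| <= 2 * L1norm g * Num.sqrt (edot z z).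
Proof.
have [_] := L1_mul_bounded gI (minc1 z) (fun x => increment_le_far oO tphi x z).
by rewrite mulrAC.
Qed.

Lemma averaged_increment_le_near L : (forall x z, `|increment phi x z| <= L * edot z z) ->
  forall z, `|averaged_increment z| <= L * L1norm g * edot z z.
Proof.
move=> HL z; have [_] := L1_mul_bounded gI (minc1 z) (fun x => HL x z).
by rewrite mulrAC.
Qed.

Let G (p : 'rV[R]_n * 'rV[R]_n) : R := g p.1 * (increment phi p.1 p.2 * K p.2).

Let mG : measurable_fun setT G.
Proof.
apply: measurable_funM; first exact: (measurableT_comp mg).
by apply: measurable_funM => //; exact: (measurableT_comp mK).
Qed.

Let G_integrable : (leb \x leb)%E.-integrable setT (EFin \o G).
Proof.
have [L L0 HL] := increment_le_near tphi.
(* The minimum of the near and far bounds dominates the increment for all [x] at once, and satisfies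
   both growth conditions of [kernel_integrable]. *)
pose h (z : 'rV[R]_n) := Num.min (L * edot z z) (2 * Num.sqrt (edot z z)) : R.
have h0 (z : 'rV[R]_n) : 0 <= h z by rewrite le_min !mulr_ge0 ?edot_ge0 ?sqrtr_ge0.
have mh : measurable_fun setT h.
  apply: measurable_minr; apply: measurable_funM => //; first exact: measurable_edot.
  under eq_fun do rewrite -powR12_sqrt ?edot_ge0//.
  exact: (measurableT_comp (measurable_powR _) (@measurable_edot R n)).
have BI : leb.-integrable setT (EFin \o (fun z => h z * K z)).
  apply: (kernel_integrable alpha01 mh L0 (ler0n R 2) ltr01) => z.
    by rewrite ger0_norm// ge_min lexx.
  by rewrite ger0_norm// ge_min lexx orbT.
have B0 : (0 <= \int[leb]_z (h z * K z)%:E)%E.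
  by apply: integral_ge0 => z _; rewrite lee_fin mulr_ge0.
apply/integrable12ltyP; first exact/measurable_EFinP.
apply: (@le_lt_trans _ _ (\int[leb]_x (`|(g x)%:E| * \int[leb]_z (h z * K z)%:E))%E).
  apply: ge0_le_integral => //.
  - by move=> x _; exact: integral_ge0.
  - apply: (measurable_fun_fubini_tonelli_F (abse \o (EFin \o G))).
      by apply: measurableT_comp => //; exact/measurable_EFinP.
    by move=> p; exact: abse_ge0.
  - apply: emeasurable_funM => //.
    by apply: measurableT_comp => //; exact/measurable_EFinP.
  - move=> x _; rewrite -ge0_integralZl//; last 2 first.
    + by apply/measurable_EFinP; exact: measurable_funM.
    + by move=> z _; rewrite lee_fin mulr_ge0.
    apply: ge0_le_integral => //.
    + apply: measurableT_comp => //; apply/measurable_EFinP.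
      exact: (measurableT_comp mG (measurable_pair1 x)).
    + by apply: measurable_funeM; apply/measurable_EFinP; exact: measurable_funM.
    + move=> z _; rewrite /G/= -EFinM lee_fin !normrM ler_wpM2l//.
      rewrite (ger0_norm (K0 z)) ler_wpM2r// le_min HL.
      exact: (increment_le_far oO tphi).
rewrite ge0_integralZr//; last by apply: measurableT_comp => //; exact/measurable_EFinP.
have /integrableP[_ goo] := gI.
apply: lte_mul_pinfty => //; first exact: integral_ge0.
- by rewrite ge0_fin_numE// integral_ge0.
- have /integrableP[_] := BI; apply: le_lt_trans.
  by rewrite le_eqVlt; apply/orP; left; apply/eqP; apply: eq_integral => z _;
    rewrite /= ger0_norm// mulr_ge0.
Qed.

Let fubini_F_G x : fubini_F leb (EFin \o G) x =
  (g x * \int[leb]_z (increment phi x z * K z))%:E.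
Proof.
have [L L0 HL] := increment_le_near tphi.
have I : leb.-integrable setT (EFin \o (fun z => increment phi x z * K z)).
  apply: (kernel_integrable alpha01 (minc2 x) L0 (ler0n R 2) ltr01) => z //.
  exact: (increment_le_far oO tphi).
rewrite /fubini_F /= EFinM /Rintegral fineK; last exact: (integrable_fin_num measurableT I).
by rewrite -(integralZl measurableT I).
Qed.

(** This excludes the default value [+oo] of [frac_variation] for integrable [g]. *)
Lemma frac_div_pairing_integrable :
  leb.-integrable setT (EFin \o (fun x => g x * frac_div alpha phi x)).
Proof.
have := integrable_fubini_F G_integrable.
rewrite (funext fubini_F_G) => I.
have [c Hc] := ex_intro (fun c => forall x, frac_div alpha phi x =
  c * \int[leb]_z (increment phi x z / enorm z `^ b)) _ (frac_divE tphi alpha).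
have -> : EFin \o (fun x => g x * frac_div alpha phi x) =
    (fun x => c%:E * (g x * \int[leb]_z (increment phi x z * K z))%:E)%E.
  by apply/funext => x /=; rewrite Hc -EFinM mulrCA.
exact: (integrableZl measurableT c I).
Qed.

Let Rint_G : \int[leb]_x (g x * \int[leb]_z (increment phi x z * K z)) =
  \int[leb]_z (averaged_increment z * K z).
Proof.
rewrite /Rintegral; congr fine.
under eq_integral do rewrite -fubini_F_G.
rewrite [LHS](Fubini G_integrable); apply: eq_integral => z _.
rewrite EFinM /averaged_increment /Rintegral fineK; last first.
  apply: integrable_fin_num => //.
  by have [] := L1_mul_bounded gI (minc1 z) (fun x => increment_le_far oO tphi x z).
rewrite -integralZr//.
  by apply: eq_integral => x _; rewrite /G/= -EFinM mulrA.
by have [] := L1_mul_bounded gI (minc1 z) (fun x => increment_le_far oO tphi x z).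
Qed.

Lemma frac_div_pairingE : \int[leb]_x (g x * frac_div alpha phi x) =
  @frac_const R n alpha * \int[leb]_z (averaged_increment z / enorm z `^ b).
Proof.
have := integrable_fubini_F G_integrable.
rewrite (funext fubini_F_G) => I.
move: (@frac_const R n alpha) (frac_divE tphi alpha) => c Hc.
transitivity (c * \int[leb]_x (g x * \int[leb]_z (increment phi x z * K z))).
  have := @RintegralZl _ _ _ leb setT
    (fun x => g x * \int[leb]_z (increment phi x z * K z)) c measurableT I.
  by move=> <-; apply: eq_Rintegral => x _; rewrite Hc mulrCA.
by congr (c * _); exact: Rint_G.
Qed.

(** Subtracting the value at 0 accounts for the term [phi x] of the increment and leaves the
    difference quotients unchanged. *)
Let psi i (z : 'rV[R]_n) := translate_int g (fun x => phi x ord0 i) z -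
  translate_int g (fun x => phi x ord0 i) 0.

Lemma averaged_incrementE z : averaged_increment z = \sum_i z ord0 i * psi i z.
Proof.
have I i z' := translate_int_integrable gI (cphi i) z'.
have J i : leb.-integrable setT (EFin \o (fun x =>
    z ord0 i * (g x * phi (x + z) ord0 i - g x * phi (x + 0) ord0 i))).
  exact: (integrableZl measurableT _ (integrableB measurableT (I i z) (I i 0))).
transitivity (\sum_i \int[leb]_x (z ord0 i *
    (g x * phi (x + z) ord0 i - g x * phi (x + 0) ord0 i))).
  have [_ <-] := Rintegral_sum J; apply: eq_Rintegral => x _.
  rewrite /increment /edot mulr_sumr; apply: eq_bigr => i _.
  by rewrite !mxE addr0; ring.
apply: eq_bigr => i _.
rewrite RintegralZl ?RintegralB//; exact: (integrableB measurableT (I i z) (I i 0)).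
Qed.

Let mpsi i : measurable_fun setT (psi i).
Proof.
apply: measurable_funB => //; apply: continuous_measurable_rV.
exact: (translate_int_continuous gI (cphi i)).
Qed.

Lemma measurable_averaged_increment : measurable_fun setT averaged_increment.
Proof.
rewrite (funext averaged_incrementE); apply: measurable_sum => i.
by apply: measurable_funM => //; exact: measurable_rV_coord.
Qed.

Variables (f : 'rV[R]_n -> R) (Df : radon R n) (r V : R).
Hypotheses (gradf : is_gradient f Df) (r0 : 0 < r).
Hypothesis fg : forall x, ball_nbhd Omega r x -> g x = f x.
Hypothesis Df_le : (variation_measure Df (ball_nbhd Omega r) <= V%:E)%E.

(** For [|z| < r] the translate of [phi] by [z] is supported in the neighbourhood of [Omega], where
    [g = f]. The left side is therefore minus the integral of that translate against [Df], and the
    translate still has Euclidean norm at most 1. *)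
Lemma translated_divergence_le z : edot z z < r ^+ 2 ->
  \sum_i translate_int g (partial i (fun x : 'rV[R]_n => phi x ord0 i)) z <= V.
Proof.
move=> zr.
have near_z (x : 'rV[R]_n) : Omega (x + z) -> ball_nbhd Omega r x.
  move=> Oxz; exists (x + z) => //; split => // i' i; rewrite ord1 /ball/= !mxE addrAC subrr add0r.
  rewrite -(@ltr_pXn2r _ 2%N)// ?nnegrE ?(ltW r0)// real_normK ?num_real//.
  by apply: le_lt_trans zr; exact: edot_coord_le.
have cz i := Cc_smooth_shift z (cphi i).
have czT i : Cc_smooth R setT (fun x : 'rV[R]_n => phi (x + z) ord0 i).
  by have [? ? _] := cz i; split.
have partE i : partial i (fun x : 'rV[R]_n => phi (x + z) ord0 i) =
    (fun x => partial i (fun y => phi y ord0 i) (x + z)).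
  exact: (iter_partial_shift (fun y => phi y ord0 i) z [:: i]).
have E i : translate_int g (partial i (fun x : 'rV[R]_n => phi x ord0 i)) z =
    - radon_int Df i (fun x : 'rV[R]_n => phi (x + z) ord0 i).
  rewrite -(gradf (czT i) i) partE; apply: eq_Rintegral => x _.
  have [xs|xs] := pselect (supp (fun y => phi y ord0 i) (x + z)).
    by rewrite fg//; apply: near_z; have [_ _] := cphi i; apply.
  by rewrite (partial_notin_supp i xs) !mulr0.
pose N := (fun x : 'rV[R]_n => x + z) @^-1` supp phi.
have cN : compact N.
  have [[_ cs _] _] := tphi.
  have -> : N = (fun x : 'rV[R]_n => x + (- z)) @` supp phi.
    apply/seteqP; split => [x Nx|_ [y sy <-]]; last by rewrite /N/= subrK.
    by exists (x + z) => //; rewrite addrK.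
  apply: continuous_compact => //; apply: continuous_subspaceT.
  exact: continuous_shift_rV.
have NK i (x : 'rV[R]_n) : ~ N x -> phi (x + z) ord0 i = 0.
  move=> nx; have /eqP -> : phi (x + z) == 0; last by rewrite mxE.
  by apply: contrapT => /negP px; apply: nx; exact: subset_closure.
have mU : measurable (ball_nbhd Omega r).
  by apply: open_measurable_rV; exact: ball_nbhd_open.
have cphi_z i : continuous (fun x : 'rV[R]_n => phi (x + z) ord0 i).
  by apply: smooth_continuous; have [] := cz i.
have NI i (m : {measure set 'rV[R]_n -> \bar R}) : (m N < +oo)%E ->
    m.-integrable setT (EFin \o (fun x : 'rV[R]_n => phi (x + z) ord0 i)).
  move=> moo; have [A A0 HA] := Cc_smooth_bounded (cphi i).
  have [] // := @bounded_support_integrable _ _ _ m (fun x : 'rV[R]_n => phi (x + z) ord0 i) A N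
    (compact_measurable_rV cN) moo.
    exact: continuous_measurable_rV.
  move=> x; rewrite indicE; have [Nx|nx] := pselect (N x).
    by rewrite mem_set// mulr1.
  by rewrite memNset// mulr0 NK// normr0.
(* The sign coming from [is_gradient] is moved into the field, which keeps its support and its
   norm. *)
have radonN i : - radon_int Df i (fun x : 'rV[R]_n => phi (x + z) ord0 i) =
    radon_int Df i (fun x : 'rV[R]_n => - phi (x + z) ord0 i).
  rewrite /radon_int !RintegralN; first by ring.
    by apply: NI; exact: radon_neg_fin.
  by apply: NI; exact: radon_pos_fin.
rewrite (eq_bigr (fun i => radon_int Df i (fun x : 'rV[R]_n => - phi (x + z) ord0 i))); last first.
  by move=> i _; rewrite E radonN.
rewrite -lee_fin; apply: le_trans Df_le.
apply: (@sum_radon_int_le_variation _ _ Df N) => //.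
- by move=> x Nx; apply: near_z; have [[_ _ pO] _] := tphi; exact: pO.
- by move=> i x; exact: (cvgN (cphi_z i x)).
- by move=> i x nx; rewrite NK// oppr0.
- move=> x; rewrite (le_trans _ (test_fields_enorm_le1 oO tphi (x + z)))//.
  by apply: ler_sum => i _; rewrite sqrrN expr2.
Qed.

(** [bump_by_parts] in each coordinate turns the layer integral into that of the bump times the
    divergence of the averaged translates; where the bump is nonzero, [|z|^2 < u < r^2] and
    [translated_divergence_le] applies. *)
Lemma near_part_le u : 0 < u < r ^+ 2 -> 0 <= V ->
  (\int[leb]_z (Num.max (u - edot z z) 0 * averaged_increment z)%:E <=
   V%:E * \int[leb]_z (Num.max (u - edot z z) 0 ^+ 2 / 4)%:E)%E.
Proof.
move=> /andP[u0 ur] V0.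
pose dpsi i := translate_int g (partial i (fun x : 'rV[R]_n => phi x ord0 i)).
have cp i := Cc_smooth_partial i (cphi i).
have mdpsi i : measurable_fun setT (dpsi i).
  by apply: continuous_measurable_rV; exact: (translate_int_continuous gI (cp i)).
have [A [M [A0 M0 psiA psiM]]] : exists A M, [/\ forall i : 'I_n, 0 <= A i, forall i : 'I_n, 0 <= M i,
    forall i z, `|psi i z| <= A i &
    forall i z t, `|psi i (z + t *: delta_mx ord0 i) - psi i z - t * dpsi i z| <= M i * t ^+ 2].
  have /choice[A HA] : forall i, exists A, 0 <= A /\ forall x, `|phi x ord0 i| <= A.
    by move=> i; have [A A0 HA] := Cc_smooth_bounded (cphi i); exists A.
  have /choice[M HM] : forall i, exists M, 0 <= M /\ forall x t,
      `|phi (x + t *: delta_mx ord0 i) ord0 i - phi x ord0 i -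
        t * partial i (fun x : 'rV[R]_n => phi x ord0 i) x| <= M * t ^+ 2.
    by move=> i; have [L [M [_ M0 _ HM]]] := Cc_smooth_taylor (cphi i); exists M; split.
  exists (fun i => A i * L1norm g + A i * L1norm g), (fun i => M i * L1norm g); split.
  - by move=> i; have [? _] := HA i; rewrite addr_ge0// mulr_ge0// L1norm_ge0.
  - by move=> i; have [? _] := HM i; rewrite mulr_ge0// L1norm_ge0.
  - move=> i z; have [_ HAi] := HA i; rewrite (le_trans (ler_normB _ _))//.
    have B z' : `|translate_int g (fun x => phi x ord0 i) z'| <= A i * L1norm g.
      have [] // := @L1_mul_bounded _ _ g gI (fun x => phi (x + z') ord0 i) (A i).
      exact: (measurableT_comp (mphi i) (measurable_rV_shift z')).
    by rewrite lerD.
  - move=> i z t; have [_ HMi] := HM i.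
    rewrite /psi opprB addrA subrK.
    exact: (translate_int_taylor gI (cphi i) HMi).
have I1 i := bump_coord_integrable i u0 (mpsi i) (psiA i).
have I2 i := bump_sqr_integrable u0 (M0 i) (mdpsi i) (psiA i) (psiM i).
have E i := bump_by_parts u0 (M0 i) (mpsi i) (mdpsi i) (psiA i) (psiM i).
have [J1 S1] := Rintegral_sum I1; have [J2 S2] := Rintegral_sum I2.
have F1 : (fun z => Num.max (u - edot z z) 0 * averaged_increment z) =
    (fun z => \sum_i Num.max (u - edot z z) 0 * (z ord0 i * psi i z)).
  by apply/funext => z; rewrite averaged_incrementE mulr_sumr.
rewrite -[X in (integral _ _ X <= _)%E]/(EFin \o (fun z => Num.max (u - edot z z) 0 * averaged_increment z)) F1.
rewrite -(fineK (integrable_fin_num measurableT J1)).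
rewrite -[fine _]/(\int[leb]_z (\sum_i Num.max (u - edot z z) 0 * (z ord0 i * psi i z))).
rewrite S1 (eq_bigr _ (fun i _ => E i)) -S2 /Rintegral (fineK (integrable_fin_num measurableT J2)).
have mq : measurable_fun setT (fun z : 'rV[R]_n => (Num.max (u - edot z z) 0 ^+ 2 / 4)%:E).
  apply/measurable_EFinP; apply: measurable_funM => //; apply: measurable_funX.
  apply: measurable_maxr => //; apply: measurable_funB => //; exact: measurable_edot.
rewrite -ge0_integralZl//; last by move=> z _; rewrite lee_fin divr_ge0// sqr_ge0.
apply: le_integral_ge0 => //.
- by have /integrableP[] := J2.
- exact: measurable_funeM.
- by move=> z _; rewrite mule_ge0// lee_fin ?divr_ge0// sqr_ge0.
- move=> z _; rewrite -EFinM lee_fin -mulr_sumr mulrC.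
  have [zu|uz] := ltP (edot z z) u; last first.
    by rewrite max_r ?subr_le0// expr0n/= mul0r !mulr0.
  rewrite ler_wpM2r ?divr_ge0 ?sqr_ge0//.
  exact: (translated_divergence_le (lt_trans zu ur)).
Qed.

(** The coefficient of [M] in [kernel_integral_le], times [frac_const]. *)
Definition far_coef (c : R) : R :=
  @frac_const R n alpha * ((n%:R + alpha + 1) / 2 * ((n%:R + alpha + 1) / 2 + 1)) *
  eball_vol n * (c `^ (- (alpha / 2)) / (alpha / 2)).

Lemma frac_div_pairing_le : 0 <= V -> \int[leb]_x (g x * frac_div alpha phi x) <=
  main_coef n (r ^+ 2) alpha * V + far_coef (r ^+ 2) * (2 * L1norm g).
Proof.
move=> V0; rewrite frac_div_pairingE.
have [L L0 HL] := increment_le_near tphi.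
have Ng := L1norm_ge0 g.
have r20 : 0 < r ^+ 2 by rewrite exprn_gt0.
have := @kernel_integral_le _ n alpha alpha01 averaged_increment (L * L1norm g) (2 * L1norm g)
  (r ^+ 2) measurable_averaged_increment (mulr_ge0 L0 Ng) (mulr_ge0 (ler0n R 2) Ng) r20
  (averaged_increment_le_near HL) averaged_increment_le_far V V0
  (fun u uc => near_part_le uc V0).
move=> /(ler_wpM2l (frac_const_ge0 n alpha)) /le_trans; apply.
rewrite /main_coef /far_coef; move: (@frac_const R n alpha) => c.
by rewrite le_eqVlt; apply/orP; left; apply/eqP; ring.
Qed.

End main_estimate.

(** * Upper limit and recovery sequences *)

Section limsup_estimate.
Context {R : realType} {n : nat}.
Local Notation leb := (lebesgue_rV n : {sigma_finite_measure set 'rV[R]_n -> \bar R}).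
Hypothesis n_ge1 : (1 <= n)%N.

(** The two coefficients differ by elementary factors, among them [(1 - alpha)/alpha]; boundedness
    of [main_coef] thus yields the decay of [far_coef]. *)
Lemma far_coefE alpha (c : R) : 0 < alpha < 1 -> 0 < c ->
  @far_coef R n alpha c = main_coef n c alpha *
    (2 * (n%:R / 2 + 1) * (n%:R / 2 + 2)) * c `^ (- 2^-1) * ((1 - alpha) / alpha).
Proof.
move=> /andP[al0 al1] c0.
have k1 : 0 < n%:R / 2 + 1 :> R by rewrite ltr_wpDl// divr_ge0.
have k2 : 0 < n%:R / 2 + 2 :> R by rewrite ltr_wpDl// divr_ge0.
rewrite /far_coef /main_coef.
have -> : c `^ (- (alpha / 2)) = c `^ ((1 - alpha) / 2) * c `^ (- 2^-1).
  by rewrite -gt0_powRD//; congr (_ `^ _); field.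
move: (@frac_const R n alpha) => m; field.
by rewrite !gt_eqF// subr_gt0.
Qed.

Lemma far_coef_lim (c : R) : 0 < c -> exists2 C, 0 <= C &
  \forall alpha \near (1 : R)^'-, @far_coef R n alpha c <= C * (1 - alpha).
Proof.
move=> c0; set k := 2 * (n%:R / 2 + 1) * (n%:R / 2 + 2) : R.
have k0 : 0 <= k by rewrite !mulr_ge0// addr_ge0// divr_ge0.
(* The first 2 bounds [main_coef] near 1, the last one bounds [1/alpha] for [alpha > 1/2]. *)
exists (2 * k * c `^ (- 2^-1) * 2); first by rewrite !mulr_ge0// powR_ge0.
near=> alpha.
have al1 : alpha < 1 by near: alpha; exact: nbhs_left_lt.
have al2 : 2^-1 < alpha by near: alpha; apply: nbhs_left_gt; lra.
have al0 : 0 < alpha by apply: lt_trans al2.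
rewrite far_coefE ?al0// -/k (mulrC (1 - alpha)) (mulrA _ alpha^-1).
rewrite ler_wpM2r ?subr_ge0 ?(ltW al1)//.
have -> : main_coef n c alpha * k * c `^ (- 2^-1) * alpha^-1 =
  k * c `^ (- 2^-1) * (main_coef n c alpha * alpha^-1) by ring.
rewrite (_ : 2 * k * _ * 2 = k * c `^ (- 2^-1) * (2 * 2)); last by ring.
rewrite ler_wpM2l ?mulr_ge0 ?powR_ge0//.
have m2 : main_coef n c alpha <= 1 + 1.
  by near: alpha; exact: main_coef_lim.
have i2 : alpha^-1 <= 2 by rewrite -[leRHS]invrK lef_pV2 ?posrE// ltW.
rewrite (le_trans (ler_wpM2r _ m2)) ?invr_ge0 ?(ltW al0)//.
by rewrite ler_wpM2l.
Unshelve. all: by end_near. Qed.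

Variable Omega : set 'rV[R]_n.
Hypothesis oO : open Omega.

Lemma frac_variation_le alpha (g f : 'rV[R]_n -> R) (Df : radon R n) (r V : R) :
  0 < alpha < 1 -> L1 g -> is_gradient f Df -> 0 < r ->
  (forall x, ball_nbhd Omega r x -> g x = f x) ->
  (variation_measure Df (ball_nbhd Omega r) <= V%:E)%E -> 0 <= V ->
  (frac_variation alpha g Omega <=
    (main_coef n (r ^+ 2) alpha * V + @far_coef R n alpha (r ^+ 2) * (2 * L1norm g))%:E)%E.
Proof.
move=> al gI gradf r0 fg DfV V0; rewrite /frac_variation.
case: ifPn => [_|/asboolPn[]]; last first.
  by move=> phi tphi; exact: (frac_div_pairing_integrable oO tphi al gI).
apply: ge_ereal_sup => _ [phi tphi <-]; rewrite lee_fin.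
exact: (frac_div_pairing_le oO tphi al gI gradf r0 fg).
Qed.

Lemma ge_limsup1 (F : R -> \bar R) (l : \bar R) :
  (\forall alpha \near (1 : R)^'-, (F alpha <= l)%E) -> (limsup1 F <= l)%E.
Proof.
move=> Fl; rewrite /limsup1 /limf_esup.
apply: (@le_trans _ _ (ereal_sup [set F alpha | alpha in [set alpha | (F alpha <= l)%E]])).
  by apply: ereal_inf_lbound; exists [set alpha | (F alpha <= l)%E].
by apply: ge_ereal_sup => _ [alpha ? <-].
Qed.

Lemma limsup_frac_variation_le_nbhd (g_ : R -> 'rV[R]_n -> R) f (Df : radon R n) (r V : R) :
  is_gradient f Df -> (forall alpha, 0 < alpha < 1 -> L1 (g_ alpha)) ->
  0 < r -> (\forall alpha \near (1 : R)^'-, forall x, ball_nbhd Omega r x -> g_ alpha x = f x) ->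
  (1 - alpha) * L1norm (g_ alpha) @[alpha --> (1 : R)^'-] --> 0 ->
  (variation_measure Df (ball_nbhd Omega r) <= V%:E)%E -> 0 <= V ->
  (limsup1 (fun alpha => frac_variation alpha (g_ alpha) Omega) <= V%:E)%E.
Proof.
move=> gradf gI r0 gf gcvg DfV V0; apply/lee_addgt0Pr => e e0.
have r20 : 0 < r ^+ 2 by rewrite exprn_gt0.
have [C C0 HC] := far_coef_lim r20.
have V1 : 0 < V + 1 by rewrite ltr_wpDl.
(* Adding 1 to [V] and to [2 C] keeps the denominators positive; each of the two errors is then at
   most [e/2]. *)
have eta0 : 0 < e / 2 / (V + 1) by rewrite !divr_gt0.
have C1 : 0 < 2 * C + 1 by rewrite ltr_wpDl// mulr_ge0.
apply: ge_limsup1; near=> alpha.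
have al1 : alpha < 1 by near: alpha; exact: nbhs_left_lt.
have al0 : 0 < alpha by near: alpha; apply: nbhs_left_gt.
have al01 : 0 < alpha < 1 by rewrite al0.
have fg : forall x, ball_nbhd Omega r x -> g_ alpha x = f x by near: alpha.
apply: (le_trans (frac_variation_le al01 (gI _ al01) gradf r0 fg DfV V0)).
rewrite -EFinD lee_fin.
have mc : main_coef n (r ^+ 2) alpha <= 1 + e / 2 / (V + 1).
  by near: alpha; exact: (main_coef_lim n_ge1 r20 eta0).
have fc : @far_coef R n alpha (r ^+ 2) <= C * (1 - alpha) by near: alpha.
have nc : (1 - alpha) * L1norm (g_ alpha) <= e / 2 / (2 * C + 1).
  by near: alpha; apply: (cvgr_le 0 gcvg); rewrite !divr_gt0.
have N0 := L1norm_ge0 (g_ alpha).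
apply: (@le_trans _ _ ((1 + e / 2 / (V + 1)) * V + C * (1 - alpha) * (2 * L1norm (g_ alpha)))).
  by rewrite lerD ?ler_wpM2r// mulr_ge0.
have h1 : e / 2 / (V + 1) * V <= e / 2.
  by rewrite mulrAC ler_pdivrMr// ler_wpM2l ?ltW ?divr_gt0 ?ltrDl.
have h2 : C * (1 - alpha) * (2 * L1norm (g_ alpha)) <= e / 2.
  have -> : C * (1 - alpha) * (2 * L1norm (g_ alpha)) =
    2 * C * ((1 - alpha) * L1norm (g_ alpha)) by ring.
  apply: (le_trans (ler_wpM2l (mulr_ge0 (ler0n R 2) C0) nc)).
  by rewrite mulrA (mulrC (2 * C)) ler_pdivrMr// ler_wpM2l ?ltW ?divr_gt0 ?ltrDl.
rewrite mulrDl mul1r; lra.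
Unshelve. all: by end_near. Qed.

(** For bounded [Omega] the neighbourhoods shrink to the closure in variation; for the whole space
    the neighbourhood of radius 1 is already the closure. *)
Lemma limsup_frac_variation_le (g_ : R -> 'rV[R]_n -> R) f (Df : radon R n) :
  bounded_set Omega \/ Omega = setT ->
  is_gradient f Df -> (forall alpha, 0 < alpha < 1 -> L1 (g_ alpha)) ->
  (forall r, 0 < r ->
    \forall alpha \near (1 : R)^'-, forall x, ball_nbhd Omega r x -> g_ alpha x = f x) ->
  (1 - alpha) * L1norm (g_ alpha) @[alpha --> (1 : R)^'-] --> 0 ->
  (limsup1 (fun alpha => frac_variation alpha (g_ alpha) Omega)
    <= variation_measure Df (closure Omega))%E.
Proof.
move=> bO gradf gI gf gcvg.
have cO : measurable (closure Omega).
  by apply: closed_measurable_rV; exact: closed_closure.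
have v0 := variation_measure_ge0 Df cO.
have [voo|vfin] := eqVneq (variation_measure Df (closure Omega)) +oo%E.
  by rewrite voo leey.
have {}vfin : variation_measure Df (closure Omega) \is a fin_num.
  by rewrite ge0_fin_numE// ltey.
apply/lee_addgt0Pr => e e0.
have [r r0 Hr] : exists2 r, 0 < r & (variation_measure Df (ball_nbhd Omega r) <=
    variation_measure Df (closure Omega) + e%:E)%E.
  case: bO => [bO|OT]; first exact: variation_measure_nbhd.
  exists 1 => //; have -> : ball_nbhd Omega 1 = closure Omega.
    rewrite OT closureT; apply/seteqP; split => // x _.
    by exists x => //; exact: ballxx.
  by rewrite leeDl// lee_fin ltW.
rewrite -(fineK vfin) -EFinD.
apply: (limsup_frac_variation_le_nbhd gradf gI r0 (gf r r0) gcvg).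
  by rewrite EFinD fineK.
by rewrite addr_ge0 ?fine_ge0// ltW.
Qed.

End limsup_estimate.

(** * Truncations with slowly growing radius *)

Section recovery_sequence.
Context {R : realType} {n : nat}.
Local Notation leb := (lebesgue_rV n : {sigma_finite_measure set 'rV[R]_n -> \bar R}).

Definition norm_ball (k : nat) : set 'rV[R]_n := [set x | `|x| < k%:R].

Lemma measurable_norm_ball k : measurable (norm_ball k).
Proof.
rewrite (_ : norm_ball k = setT `&` (fun x : 'rV[R]_n => `|x|) @^-1` `]-oo, k%:R[%classic).
  by apply: measurable_norm_rV => //; exact: measurable_itv.
by rewrite setTI; apply/seteqP; split => x; rewrite /norm_ball/= in_itv.
Qed.

Lemma bounded_sub_norm_ball (A : set 'rV[R]_n) : bounded_set A ->
  exists k0, forall k, (k0 <= k)%N -> A `<=` norm_ball k.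
Proof.
move=> [M [Mr HM]]; exists (Num.truncn (M + 1)).+1 => k kM x Ax.
rewrite /norm_ball/= (le_lt_trans (HM (M + 1) _ _ Ax)) ?ltrDl//.
by rewrite (lt_le_trans (truncnS_gt _))// ler_nat.
Qed.

Lemma bounded_ball_nbhd (A : set 'rV[R]_n) r : bounded_set A -> bounded_set (ball_nbhd A r).
Proof.
move=> [M [Mr HM]]; exists (M + 1 + r); split; first exact: num_real.
move=> M' MM' x [w Aw]; rewrite -ball_normE/= => wx.
rewrite -[x](subrK w) (le_trans (ler_normD _ _))// distrC.
have := HM (M + 1) _ _ Aw; rewrite ltrDl ltr01 => /(_ isT).
move: MM' wx => {HM} /=; move: `|w - x| `|w| => a b; lra.
Qed.

Lemma L1_L1loc (g : 'rV[R]_n -> R) : L1 g -> L1loc g.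
Proof.
move=> gI; split; first by have /integrableP[/measurable_EFinP] := gI.
by move=> K cK; apply: (integrableS _ _ _ gI) => //; exact: compact_measurable_rV.
Qed.

Variable f : 'rV[R]_n -> R.
Hypothesis fI : L1loc f.

(** A sharp cut keeps indicators indicators. The jump that it creates on the boundary of the ball is
    eventually far from a bounded [Omega], where only the [L1] norm is felt. *)
Definition truncation (k : nat) (x : 'rV[R]_n) : R := f x * \1_(norm_ball k) x.

Lemma truncation_L1 k : L1 (truncation k).
Proof.
have [mf fK] := fI.
have cK : compact [set x : 'rV[R]_n | `|x| <= k%:R] by exact: norm_le_compact.
have : leb.-integrable (norm_ball k) (EFin \o f).
  apply: (integrableS _ _ _ (fK _ cK)).
  - exact: compact_measurable_rV.
  - exact: measurable_norm_ball.
  - by move=> x; rewrite /norm_ball/= => /ltW.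
move/(integrable_mkcond _ (measurable_norm_ball k)).
apply: eq_integrable => // x _; rewrite patchE /truncation/= indicE.
by case: ifPn => _; rewrite ?mulr1 ?mulr0.
Qed.

Lemma truncation0 x : truncation 0 x = 0.
Proof.
by rewrite /truncation indicE memNset ?mulr0// /norm_ball/= => /(le_lt_trans (normr_ge0 _)); rewrite ltxx.
Qed.

Lemma truncation_in k x : norm_ball k x -> truncation k x = f x.
Proof. by move=> kx; rewrite /truncation indicE mem_set// mulr1. Qed.

(** A diagonal choice: [N alpha] is the largest [k] with [(1 - alpha) m k <= 1/(k+1)], among those
    not exceeding [1/(1 - alpha)]. Each fixed [k] is eventually eligible, so [N] tends to infinity,
    and the defining inequality then gives the second claim. *)
Lemma slow_radius : exists N : R -> nat,
  (forall k, \forall alpha \near (1 : R)^'-, (k <= N alpha)%N) /\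
  (1 - alpha) * L1norm (truncation (N alpha)) @[alpha --> (1 : R)^'-] --> 0.
Proof.
pose m k := L1norm (truncation k).
have m0 : m 0%N = 0.
  rewrite /m /L1norm (@eq_Rintegral _ _ _ _ _ (cst 0)); last by move=> x _; rewrite truncation0 normr0.
  by rewrite Rintegral_cst// mul0r.
have mge0 k : 0 <= m k by exact: L1norm_ge0.
(* The cap makes a largest [k] exist; [k = 0] is always eligible, since the ball of radius 0 is
   empty and [m 0 = 0]. *)
pose P alpha k := (k <= Num.truncn (1 - alpha)^-1)%N && ((1 - alpha) * m k <= k.+1%:R^-1).
have /choice[N HN] : forall alpha, exists N, P alpha N /\ forall k, P alpha k -> (k <= N)%N.
  move=> alpha.
  have P0 : exists k, P alpha k by exists 0%N; rewrite /P leq0n m0 mulr0 invr1 ler01.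
  have Pb k : P alpha k -> (k <= Num.truncn (1 - alpha)^-1)%N by case/andP.
  by exists (ex_maxn P0 Pb); case: ex_maxnP => k Pk kmax; split.
have Ninf k : \forall alpha \near (1 : R)^'-, (k <= N alpha)%N.
  have mk : 0 < m k + 1 by rewrite ltr_wpDl.
  near=> alpha; have [_] := HN alpha; apply; apply/andP.
  have al1 : alpha < 1 by near: alpha; exact: nbhs_left_lt.
  have al1' : 0 < 1 - alpha by rewrite subr_gt0.
  split.
    rewrite truncn_ge_nat ?invr_ge0 ?(ltW al1')//.
    apply: (@le_trans _ _ k.+1%:R); first by rewrite ler_nat.
    rewrite -[leLHS]invrK lef_pV2 ?posrE ?invr_gt0// lerBlDr -lerBlDl; apply: ltW.
    by near: alpha; apply: nbhs_left_gt; rewrite ltrBlDr ltrDl.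
  apply: (@le_trans _ _ (k.+1%:R^-1 / (m k + 1) * m k)).
    rewrite ler_wpM2r// lerBlDr -lerBlDl ltW//.
    by near: alpha; apply: nbhs_left_gt; rewrite ltrBlDr ltrDl divr_gt0.
  by rewrite mulrAC ler_pdivrMr// ler_wpM2l// lerDl.
exists N; split => //.
apply/cvgrPdist_le => e e0.
pose k := Num.truncn e^-1.
near=> alpha.
have al1 : alpha < 1 by near: alpha; exact: nbhs_left_lt.
have kN : (k <= N alpha)%N by near: alpha.
have [/andP[_ Pm] _] := HN alpha.
have al1' : 0 <= 1 - alpha by rewrite subr_ge0 ltW.
rewrite sub0r normrN ger0_norm ?mulr_ge0 ?L1norm_ge0//.
rewrite (le_trans Pm)// -[e]invrK lef_pV2 ?posrE ?invr_gt0//.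
by rewrite (le_trans (ltW (truncnS_gt e^-1)))// ler_nat ltnS.
Unshelve. all: by end_near. Qed.

End recovery_sequence.

Section recovery_limits.
Context {R : realType} {n : nat}.
Local Notation leb := (lebesgue_rV n : {sigma_finite_measure set 'rV[R]_n -> \bar R}).

(** On a given compact set the truncations are eventually equal to [f], so the integral is
    eventually 0. *)
Lemma truncation_L1loc_cvg (f : 'rV[R]_n -> R) (N : R -> nat) :
  (forall k, \forall alpha \near (1 : R)^'-, (k <= N alpha)%N) ->
  L1loc_cvg (fun alpha => truncation f (N alpha)) f.
Proof.
move=> Ninf K cK; have [k0 Hk0] := bounded_sub_norm_ball (compact_bounded cK).
apply: cvg_near_cst; near=> alpha; apply: integral0_eq => x Kx.
rewrite truncation_in ?subrr ?normr0//; apply: (Hk0 _ _ _ Kx).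
by near: alpha.
Unshelve. all: by end_near. Qed.

Lemma indic_norm_ball (E : set 'rV[R]_n) k :
  \1_(E `&` norm_ball k) = truncation \1_E k :> ('rV[R]_n -> R).
Proof. by apply/funext => x; rewrite /truncation indicI. Qed.

Lemma measurable_indic_set (E : set 'rV[R]_n) :
  measurable_fun setT (\1_E : 'rV[R]_n -> R) -> measurable E.
Proof.
move=> /(_ measurableT [set 1] (measurable_set1 _)); rewrite setTI.
rewrite (_ : _ @^-1` _ = E)//; apply/seteqP; split => x /=; rewrite indicE.
  by case: (boolP (x \in E)) => [/set_mem//|_ /eqP]; rewrite eq_sym oner_eq0.
by move=> Ex; rewrite mem_set.
Qed.

End recovery_limits.

Lemma one_minus_cvg0 {R : realType} (c : R) :
  (1 - alpha) * c @[alpha --> (1 : R)^'-] --> (0 : R).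
Proof.
apply: cvg_at_left_filter.
have : (1 - alpha) * c @[alpha --> (1 : R)] --> (1 - 1) * c.
  by apply: cvgMr_tmp; apply: cvgB; [exact: cvg_cst|exact: cvg_id].
by rewrite subrr mul0r.
Qed.

Theorem theorem4p14 (R : realType) (n : nat) (n_ge1 : (1 <= n)%N)
    (Omega : set 'rV[R]_n) (Omega_open : open Omega) :
  (forall (f : 'rV[R]_n -> R) (Df : radon R n),
    BV f -> is_gradient f Df -> bounded_set Omega \/ Omega = setT ->
    (limsup1 (fun alpha => frac_variation alpha f Omega)
       <= variation_measure Df (closure Omega))%E /\
    (forall E : set 'rV[R]_n, f = \1_E ->
       exists E_ : R -> set 'rV[R]_n,
         [/\ forall alpha, 0 < alpha < 1 -> measurable (E_ alpha),
             forall alpha, 0 < alpha < 1 -> L1 (\1_(E_ alpha) : 'rV[R]_n -> R),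
             L1_cvg (fun alpha => \1_(E_ alpha)) \1_E &
             (limsup1 (fun alpha => frac_variation alpha \1_(E_ alpha) Omega)
                <= variation_measure Df (closure Omega))%E])) /\
  (forall (f : 'rV[R]_n -> R) (Df : radon R n),
    BVloc f -> is_gradient f Df -> bounded_set Omega ->
    (Gamma_limsup L1loc L1loc_cvg
       (fun alpha g => frac_variation alpha g Omega) f
       <= variation_measure Df (closure Omega))%E /\
    (forall E : set 'rV[R]_n, f = \1_E ->
       exists E_ : R -> set 'rV[R]_n,
         [/\ forall alpha, 0 < alpha < 1 -> measurable (E_ alpha),
             L1loc_cvg (fun alpha => \1_(E_ alpha)) \1_E &
             (limsup1 (fun alpha => frac_variation alpha \1_(E_ alpha) Omega)
                <= variation_measure Df (closure Omega))%E])).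
Proof.
split=> f Df.
  move=> [fI _] gradf bO.
  have limf : (limsup1 (fun alpha => frac_variation alpha f Omega)
      <= variation_measure Df (closure Omega))%E.
    (* The family is constantly [f]: agreement near [Omega] is trivial, and [(1 - alpha)] times a
       fixed norm tends to 0. *)
    apply: (limsup_frac_variation_le n_ge1 Omega_open bO gradf) => //.
    - by move=> r r0; near=> alpha.
    - exact: one_minus_cvg0.
  split=> // E fE; exists (fun=> E); split.
  - move=> _ _; apply: measurable_indic_set; rewrite -fE.
    by have /integrableP[/measurable_EFinP] := fI.
  - by move=> _ _; rewrite -fE.
  - apply: cvg_near_cst; near=> alpha; apply: integral0_eq => x _.
    by rewrite subrr normr0.
  - by rewrite -fE.
move=> [fI _] gradf bO.
have [N [Ninf Nm]] := slow_radius f.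
have limf : (limsup1 (fun alpha => frac_variation alpha (truncation f (N alpha)) Omega)
    <= variation_measure Df (closure Omega))%E.
  apply: (limsup_frac_variation_le n_ge1 Omega_open (or_introl bO) gradf) => //.
  - by move=> alpha _; exact: (truncation_L1 fI).
  - move=> r r0.
    (* Boundedness of [Omega] puts its whole neighbourhood inside the truncation ball for [alpha]
       near 1. *)
    have [k0 Hk0] := bounded_sub_norm_ball (bounded_ball_nbhd r bO).
    near=> alpha => x Ox; apply: truncation_in; apply: (Hk0 _ _ _ Ox).
    by near: alpha.
split.
  apply: le_trans limf; apply: ereal_inf_lbound.
  exists (fun alpha => truncation f (N alpha)) => //; split.
    by move=> alpha _; apply: L1_L1loc; exact: (truncation_L1 fI).
  exact: truncation_L1loc_cvg.
(* Cutting a set by a ball truncates its indicator, so the same bound and the same convergence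
   apply. *)
move=> E fE; exists (fun alpha => E `&` norm_ball (N alpha)); split.
- move=> alpha _; apply: measurableI; last exact: measurable_norm_ball.
  by apply: measurable_indic_set; rewrite -fE; have [] := fI.
- suff -> : (fun alpha => \1_(E `&` norm_ball (N alpha)) : 'rV[R]_n -> R) =
      (fun alpha => truncation f (N alpha)).
    by rewrite -fE; exact: truncation_L1loc_cvg.
  by apply/funext => alpha; rewrite indic_norm_ball fE.
- suff -> : (fun alpha => frac_variation alpha \1_(E `&` norm_ball (N alpha)) Omega) =
      (fun alpha => frac_variation alpha (truncation f (N alpha)) Omega) by [].
  by apply/funext => alpha; rewrite indic_norm_ball fE.
Unshelve. all: by end_near. Qed.
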